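(* For every pair of integers $d\ge2$ and $0\le k\le d$, the subset $\mathcal{R}at(\mathbb{R};\mathbf{Gr}_k(\mathbb{C}^d))$ is dense in $\dot H^{1/2}(\mathbb{R};\mathbf{Gr}_k(\mathbb{C}^d))$.
   Context: The complex Grassmannian is identified with $\mathbf{Gr}_k(\mathbb{C}^d)=\{U\in M_d(\mathbb{C})\mid U=U^*,\ U^2=\mathbb{1}_d,\ \operatorname{Tr}(U)=d-2k\}$, where $M_d(\mathbb{C})=\mathbb{C}^{d\times d}$. $\mathcal{R}at(\mathbb{R};\mathbf{Gr}_k(\mathbb{C}^d))$ is the set of maps $\mathbb{R}\to\mathbf{Gr}_k(\mathbb{C}^d)$ that are rational in $x\in\mathbb{R}$. $\dot H^{1/2}(\mathbb{R};\mathbf{Gr}_k(\mathbb{C}^d))$ is the set of $\mathbf{U}\in\dot H^{1/2}(\mathbb{R};M_d(\mathbb{C}))$ with $\mathbf{U}(x)\in\mathbf{Gr}_k(\mathbb{C}^d)$ for a.e. $x$, equipped with the semi-norm $$\|\mathbf{U}\|_{\dot H^{1/2}}^2=\frac1{2\pi}\int_{\mathbb{R}}\int_{\mathbb{R}}\frac{|\mathbf{U}(x)-\mathbf{U}(y)|_F^2}{|x-y|^2}\,dx\,dy,\qquad |A|_F=\sqrt{\operatorname{Tr}(A^*A)} .$$ Density means: for every $\mathbf{U}\in\dot H^{1/2}(\mathbb{R};\mathbf{Gr}_k(\mathbb{C}^d))$ there are $\mathbf{U}_n\in\mathcal{R}at(\mathbb{R};\mathbf{Gr}_k(\mathbb{C}^d))$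 with $\|\mathbf{U}_n-\mathbf{U}\|_{\dot H^{1/2}}\to0$. *)

(* Defs.v *)
From HB Require Import structures.
From mathcomp Require Import all_boot all_order all_algebra.
From mathcomp Require Import all_classical all_reals all_analysis.
From mathcomp Require Import spectral.
From mathcomp.real_closed Require Import complex.
Set Implicit Arguments.
Unset Strict Implicit.
Unset Printing Implicit Defensive.
Import Order.TTheory GRing.Theory Num.Theory.
Import numFieldNormedType.Exports.
Local Open Scope classical_set_scope.
Local Open Scope ring_scope.
Local Open Scope complex_scope.
Local Open Scope sesquilinear_scope.

Definition Gr (R : realType) (d k : nat) : set 'M[R[i]]_d :=
  [set U | [/\ U = U^t*, U *m U = 1%:M & \tr U = d%:R - (2 * k)%:R]].

(* The trace is real and nonnegative, so taking Re only casts it to R. *)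
Definition frobenius (R : realType) (d : nat) (A : 'M[R[i]]_d) : R :=
  Num.sqrt (complex.Re (\tr (A^t* *m A))).

(* The value of the integrand at y = x is immaterial, the diagonal being
   a null set. *)
Definition dotH12_norm (R : realType) (d : nat) (U : R -> 'M[R[i]]_d)
    : \bar R :=
  sqrte (((2 * pi)^-1)%:E *
    \int[lebesgue_measure]_x \int[lebesgue_measure]_y
      (frobenius (U x - U y) ^+ 2 / `|x - y| ^+ 2)%:E)%E.

(* Elements of the Sobolev space are represented by Borel functions; a
   finite seminorm already forces local square integrability. *)
Definition dotH12 (R : realType) (d : nat) : set (R -> 'M[R[i]]_d) :=
  [set U : R -> 'M[R[i]]_d |
    (forall i j,
       measurable_fun setT (fun x => complex.Re (U x i j)) /\
       measurable_fun setT (fun x => complex.Im (U x i j))) /\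
    (dotH12_norm U < +oo)%E].

Definition dotH12_Gr (R : realType) (d k : nat) : set (R -> 'M[R[i]]_d) :=
  [set U : R -> 'M[R[i]]_d |
    dotH12 U /\ {ae lebesgue_measure, forall x, Gr k (U x)}].

Definition rational_mx (R : realType) (d : nat) (U : R -> 'M[R[i]]_d) :=
  forall i j, exists p q : {poly R[i]},
    forall x : R, q.[x%:C] != 0 /\ U x i j = p.[x%:C] / q.[x%:C].

Definition Rat_Gr (R : realType) (d k : nat) : set (R -> 'M[R[i]]_d) :=
  [set U : R -> 'M[R[i]]_d | rational_mx U /\ forall x, Gr k (U x)].

Definition dotH12_dense (R : realType) (d : nat)
    (A B : set (R -> 'M[R[i]]_d)) :=
  A `<=` B /\
  forall U, B U -> exists2 V : nat -> R -> 'M[R[i]]_d,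
    (forall n, A (V n)) & dotH12_norm (V n \- U) @[n --> \oo] --> 0%E.

(* Main.v *)
(* Writing U = 1 - 2P turns Grassmannian-valued maps into rank-k Hermitian
   projections.  In the coordinate x = tan t the seminorm becomes, entrywise,
   the integral of (f x - f y)^2 / sin^2 (s - t) over two copies of the circle,
   and it decreases under averaging against the rational kernel cos^M (s - t).
   Maps of finite seminorm have vanishing mean oscillation, so the averages W
   of P are uniformly close to the set of projections, and McWeeny's iteration
   p -> 3 p^2 - 2 p^3 moves W to a projection Q.  Since Q is a Lipschitz
   function of W, Pratt's lemma yields convergence of Q to P in seminorm.
   Q is only a uniform limit of rational maps.  A rational map with values in
   the projections is obtained by induction on the rank: for a generic constant
   vector e the vector Q x *m e never vanishes, hence the projection onto it,
   built from a rational approximation v of that vector as v v^* / (v^* v),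
   is rational and can be split off. *)
From HB Require Import structures.
From mathcomp Require Import all_boot all_order all_algebra.
From mathcomp Require Import all_classical all_reals all_analysis.
From mathcomp Require Import measurable_realfun spectral zify ring lra.
From mathcomp.real_closed Require Import complex.
Require Import Defs.
Set Implicit Arguments.
Unset Strict Implicit.
Unset Printing Implicit Defensive.
Import Order.TTheory GRing.Theory Num.Theory.
Import numFieldNormedType.Exports.
Local Open Scope classical_set_scope.
Local Open Scope complex_scope.
Local Open Scope sesquilinear_scope.
Local Open Scope ring_scope.

(** * The measure dx / (1 + x^2) *)

(** Uniform convergence alone says nothing about the energy. Each uniform approximation by rational
    functions is therefore carried together with a Lipschitz constant for the chordal metric that
    does not depend on the index; a constant then dominates the energy densities, and it is
    integrable because the circle has finite measure. A bounded rational function always has such a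
    constant, infinity included. For the averages the domination comes from the energy itself: they
    are convex combinations of rotates, and the energy is rotation invariant. Polynomial iteration
    keeps rationality but reaches exact projections only in the limit, where rationality is lost.
    The projection onto a line is exact and rational at once, as soon as the spanning vector is
    rational and never 0. Such a vector exists for reasons of dimension: with [x] real and [g x]
    away from 0, the scalars [z] with [f x + z g x = 0] trace only a curve in the complex plane.
    Counting replaces this remark, for a lower bound uniform in [x] is needed. *)

Section transfer.
Local Open Scope ereal_scope.
Context d1 d2 (X : measurableType d1) (Y : measurableType d2) (R : realType).
Variables (phi : X -> Y) (mphi : measurable_fun setT phi).
Variables (mu : {measure set X -> \bar R}) (D : set X) (mD : measurable D).
Variables (w : X -> R) (mw : measurable_fun setT w) (w0 : forall x, (0 <= w x)%R).
Variables (nu : {measure set Y -> \bar R}).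
Hypothesis nuE : forall A, measurable A ->
  nu A = \int[mu]_(x in D) (w x * \1_A (phi x))%:E.

Import HBNNSimple.

(** One statement for push-forwards ([w = 1]) and for measures with a density ([phi = id]); the
    push-forward by [tan], the density [1 / (1 + x^2)] and translations are instances. Linearity
    extends [nuE] to simple functions, monotone convergence to the rest. *)
Lemma ge0_integral_transfer (G : Y -> \bar R) :
  measurable_fun [set: Y] G -> (forall y, 0 <= G y) ->
  \int[nu]_y G y = \int[mu]_(x in D) (G (phi x) * (w x)%:E).
Proof.
move=> mG G0.
pose f_ := nnsfun_approx measurableT mG.
have mfphi n : measurable_fun setT (f_ n \o phi).
  exact: measurableT_comp.
transitivity (limn (fun n => \int[nu]_x (f_ n x)%:E)).
  rewrite -monotone_convergence//.
  - apply: eq_integral => y _; apply/esym/cvg_lim => //.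
    by apply: cvg_nnsfun_approx.
  - by move=> n; exact/measurable_EFinP/measurable_funP.
  - by move=> n y _; rewrite lee_fin.
  - by move=> y _ m n mn; rewrite lee_fin; exact/lefP/nd_nnsfun_approx.
rewrite [X in limn X](_ : _ =
    (fun n => \int[mu]_(x in D) (f_ n (phi x) * w x)%:E)); last first.
  apply/funext => n.
  have mI k : measurable (f_ n @^-1` [set k]).
    by rewrite -(setTI (_ @^-1` _)); exact: measurable_funP.
  transitivity (\sum_(k \in range (f_ n)) \int[mu]_(x in D)
      (k * (w x * \1_(f_ n @^-1` [set k]) (phi x)))%:E).
    under eq_integral do rewrite fimfunE -fsumEFin//.
    rewrite ge0_integral_fsum//; last 2 first.
    - by move=> y; exact/measurable_EFinP/measurable_funM.
    - by move=> y x _; rewrite nnfun_muleindic_ge0.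
    apply: eq_fsbigr => r rr.
    rewrite integralZl_indic_nnsfun// integral_indic//= setIT nuE//.
    have r0 : (0 <= r)%R by move: rr; rewrite inE => -[y _ <-].
    under [in RHS]eq_integral do rewrite EFinM.
    rewrite ge0_integralZl//.
    - apply/measurable_EFinP/measurable_funTS/measurable_funM => //.
      by apply: measurableT_comp => //; exact: measurable_indic.
    - by move=> x _; rewrite lee_fin mulr_ge0.
  rewrite -ge0_integral_fsum//.
  - apply: eq_integral => x _; rewrite fsumEFin//; congr EFin.
    rewrite [in RHS]fimfunE mulrC fsbig_distrr//=.
    by apply: eq_fsbigr => r _; rewrite mulrCA.
  - move=> r; apply/measurable_EFinP/measurable_funTS/measurable_funM => //.
    apply/measurable_funM => //.
    by apply: measurableT_comp => //; exact: measurable_indic.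
  - move=> r x _; rewrite lee_fin mulrCA mulr_ge0//.
    by rewrite -lee_fin nnfun_muleindic_ge0.
rewrite -monotone_convergence//.
- apply: eq_integral => x _; apply/cvg_lim => //.
  under eq_fun do rewrite EFinM.
  apply: cvgeZr; rewrite ?fin_num_EFin//.
  by apply: cvg_nnsfun_approx.
- move=> n; apply/measurable_EFinP/measurable_funTS.
  by apply: measurable_funM => //; exact: mfphi.
- by move=> n x _; rewrite lee_fin mulr_ge0.
- move=> x _ m n mn; rewrite lee_fin ler_wpM2r//.
  exact/lefP/nd_nnsfun_approx.
Qed.

End transfer.

Section circle_measure.
Context {R : realType}.
Local Open Scope ereal_scope.

Local Notation J := `](- (pi / 2))%R, (pi / 2)%R[%classic.

Lemma measurable_fun_inv d (T : measurableType d) (D : set T) (f : T -> R) :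
  measurable_fun D f -> measurable_fun D (fun x => (f x)^-1)%R.
Proof.
move=> mf.
(* Inversion is reduced to a real power of the absolute value. At a zero of [f] both sides are 0,
   because [0^-1 = 0]. *)
have -> : (fun x => (f x)^-1)%R = (fun x => f x * (`|f x| `^ (-1)) ^+ 2)%R.
  apply/funext => x.
  have [->|f0] := eqVneq (f x) 0%R; first by rewrite invr0 mul0r.
  by rewrite powR_inv1 ?normr_ge0// exprVn real_normK ?num_real// expr2 invfM mulrA mulfV ?mul1r.
apply: measurable_funM => //; apply: measurable_funX.
have mn : measurable_fun D (fun x => `|f x|%R) by exact: measurableT_comp.
exact: (measurableT_comp (measurable_powR (-1)%R) mn).
Qed.

Lemma measurable_tan : measurable_fun [set: R] (@tan R).
Proof.
rewrite /tan; apply: measurable_funM.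
  by apply: continuous_measurable_fun; exact: continuous_sin.
apply: measurable_fun_inv.
by apply: continuous_measurable_fun; exact: continuous_cos.
Qed.

(* Push-forward of the Lebesgue measure of ]-pi/2, pi/2[ by tan, that is,
   dx / (1 + x^2). *)
Definition circle_measure (A : set (measurableTypeR R)) : \bar R :=
  lebesgue_measure (J `&` (@tan R) @^-1` A).

Let mJtan (A : set (measurableTypeR R)) : measurable A ->
  measurable (J `&` (@tan R) @^-1` A).
Proof.
move=> mA; apply: measurableI => //.
by rewrite -[X in measurable X]setTI; exact: measurable_tan.
Qed.

Let circle0 : circle_measure set0 = 0.
Proof. by rewrite /circle_measure preimage_set0 setI0 measure0. Qed.

Let circle_ge0 A : 0 <= circle_measure A.
Proof. exact: measure_ge0. Qed.

Let circle_sigma_additive : semi_sigma_additive circle_measure.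
Proof.
move=> F mF tF mUF; rewrite /circle_measure preimage_bigcup setI_bigcupr.
apply: measure_semi_sigma_additive.
- by move=> n; exact: mJtan.
- apply/trivIsetP => /= i j _ _ ij; move/trivIsetP : tF => /(_ i j I I ij) FF.
  rewrite -subset0 => t [[_ Fi] [_ Fj]].
  by have : (F i `&` F j) (tan t) by []; rewrite FF.
- by rewrite -setI_bigcupr -preimage_bigcup; exact: mJtan.
Qed.

HB.instance Definition _ := isMeasure.Build _ _ _ circle_measure
  circle0 circle_ge0 circle_sigma_additive.

Lemma circle_measureT : circle_measure setT = (pi : R)%:E.
Proof.
rewrite /circle_measure preimage_setT setIT lebesgue_measure_itv/= lte_fin.
rewrite gtrN ?divr_gt0 ?pi_gt0// -EFinD opprK; congr EFin.
by rewrite -splitr.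
Qed.

Let circle_fin : fin_num_fun circle_measure.
Proof.
apply: lty_fin_num_fun.
change (circle_measure setT < +oo); rewrite circle_measureT; exact: ltry.
Qed.

HB.instance Definition _ :=
  Measure_isFinite.Build _ _ _ circle_measure circle_fin.

Lemma integral_circle_tan (G : R -> \bar R) :
  measurable_fun setT G -> (forall y, 0 <= G y) ->
  \int[circle_measure]_y G y = \int[lebesgue_measure]_(t in J) G (tan t).
Proof.
move=> mG G0.
rewrite (@ge0_integral_transfer _ _ (measurableTypeR R) (measurableTypeR R) R
   (@tan R) measurable_tan lebesgue_measure J _ (cst 1%R))//=; first last.
- move=> A mA; under eq_integral do rewrite mul1r.
  rewrite integral_indic//=; last first.
    by rewrite -[X in measurable X]setTI; exact: measurable_tan.
  by rewrite /circle_measure; congr lebesgue_measure; apply/seteqP; split=> t [].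
by under eq_integral do rewrite mule1.
Qed.

End circle_measure.

Section density.
Context {R : realType}.
Local Open Scope ereal_scope.
Local Notation mu := (@lebesgue_measure R).
Local Notation J := `](- (pi / 2))%R, (pi / 2)%R[%classic.

Lemma onesq_gt0 (x : R) : (0 < 1 + x ^+ 2)%R.
Proof. by rewrite ltr_wpDr// sqr_ge0. Qed.

Lemma onesq_neq0 (x : R) : (1 + x ^+ 2 != 0)%R.
Proof. by rewrite gt_eqF// onesq_gt0. Qed.

Definition cauchy_density (x : R) : R := (1 + x ^+ 2)^-1%R.

Lemma cauchy_density_ge0 x : (0 <= cauchy_density x)%R.
Proof. by rewrite invr_ge0 ltW// onesq_gt0. Qed.

Lemma continuous_cauchy_density : continuous cauchy_density.
Proof.
move=> x; apply: cvgV; first exact: onesq_neq0.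
by apply: cvgD; [exact: cvg_cst|exact: exprn_continuous].
Qed.

Lemma measurable_cauchy_density : measurable_fun setT cauchy_density.
Proof. exact: continuous_measurable_fun continuous_cauchy_density. Qed.

Let mE : measurable_fun setT (EFin \o cauchy_density).
Proof. by apply/measurable_EFinP; exact: measurable_cauchy_density. Qed.

Definition cauchy_measure (A : set (measurableTypeR R)) : \bar R :=
  \int[mu]_(x in A) (cauchy_density x)%:E.

Let cauchy0 : cauchy_measure set0 = 0.
Proof. by rewrite /cauchy_measure integral_set0. Qed.

Let cauchy_ge0 A : 0 <= cauchy_measure A.
Proof. by apply: integral_ge0 => x _; rewrite lee_fin cauchy_density_ge0. Qed.

Let cauchy_sigma_additive : semi_sigma_additive cauchy_measure.
Proof.
move=> /= F mF tF mUF; rewrite /cauchy_measure; apply: cvg_toP.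
  apply: ereal_nondecreasing_is_cvgn => m n mn.
  by apply: lee_sum_nneg_natr => // k _ _; exact: cauchy_ge0.
rewrite ge0_integral_bigcup//=.
- exact: measurable_funTS.
- by move=> x _; rewrite lee_fin cauchy_density_ge0.
Qed.

HB.instance Definition _ := isMeasure.Build _ _ _ cauchy_measure
  cauchy0 cauchy_ge0 cauchy_sigma_additive.

Lemma cauchy_measure_itvoc (a b : R) : (a < b)%R ->
  cauchy_measure `]a, b] = (atan b - atan a)%:E.
Proof.
move=> ab; rewrite /cauchy_measure integral_itv_obnd_cbnd; last first.
  by apply: measurable_funTS; exact: mE.
rewrite (@continuous_FTC2 _ _ (@atan R))//.
- by apply: continuous_subspaceT; exact: continuous_cauchy_density.
- split.
  + by move=> x _; exact: derivable_atan.
  + by apply: cvg_at_right_filter; exact: continuous_atan.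
  + by apply: cvg_at_left_filter; exact: continuous_atan.
- by move=> x _; rewrite derive1_atan.
Qed.

Lemma circle_measure_itvoc (a b : R) : (a < b)%R ->
  circle_measure `]a, b] = (atan b - atan a)%:E.
Proof.
move=> ab; rewrite /circle_measure.
rewrite (_ : J `&` _ = `]atan a, atan b]%classic).
  by rewrite lebesgue_measure_itv/= lte_fin lt_atan// EFinB.
apply/seteqP; split => t /=; rewrite !in_itv/=.
  move=> [tJ /andP[at_ tb]].
  have tJ' : t \in `](- (pi / 2))%R, (pi / 2)%R[ by rewrite in_itv.
  by rewrite -(tanK tJ') lt_atan//= le_atan.
move=> /andP[at_ tb].
have tJ : (- (pi / 2) < t < pi / 2)%R.
  by rewrite (lt_trans (atan_gtNpi2 a) at_) (le_lt_trans tb (atan_ltpi2 b)).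
split=> //.
have inJ (c : R) : atan c \in `](- (pi / 2))%R, (pi / 2)%R[.
  by rewrite in_itv/= atan_gtNpi2 atan_ltpi2.
rewrite -(atanK a) -(atanK b) ltr_tan ?inJ ?in_itv//= leNgt ltr_tan ?inJ ?in_itv//.
by rewrite -leNgt at_.
Qed.

(** Both measures give []a, b]] the mass [atan b - atan a], one by monotonicity of [tan], the other
    by the fundamental theorem of calculus. The tangent form shows the rotation invariance, the
    density form leads back to the Lebesgue integrals of [dotH12_norm]. *)
Lemma circle_measureE A : measurable A -> circle_measure A = cauchy_measure A.
Proof.
apply: (@measure_unique _ R (measurableTypeR R) (@ocitv R)
  (fun n => `](- n%:R)%R, n%:R%R]%classic) _ _ _ _
  circle_measure cauchy_measure) => //.
- exact: ocitvI.
- by move=> n; exists (- n%:R, n%:R)%R.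
- rewrite -subTset => x _ /=.
  exists (Num.truncn `|x|).+1 => //=; rewrite in_itv/=.
  have := truncnS_gt `|x|%R; rewrite ltr_norml => /andP[-> /ltW ->]//.
- move=> _ [[a b] _ <-]/=.
  have [ab|ba] := ltP a b; last by rewrite set_itv_ge -?leNgt ?bnd_simp// !measure0.
  by rewrite [LHS]circle_measure_itvoc// [RHS]cauchy_measure_itvoc.
- move=> n; apply: (@le_lt_trans _ _ (circle_measure setT)).
    by apply: le_measure; rewrite ?inE.
  by rewrite circle_measureT ltry.
Qed.

Lemma integral_circle_density (G : R -> \bar R) :
  measurable_fun setT G -> (forall y, 0 <= G y) ->
  \int[circle_measure]_y G y = \int[mu]_x (G x * (cauchy_density x)%:E).
Proof.
move=> mG G0.
rewrite (@ge0_integral_transfer _ _ (measurableTypeR R) (measurableTypeR R) R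
   id _ mu setT _ cauchy_density)//=.
- exact: measurable_cauchy_density.
- by move=> x; exact: cauchy_density_ge0.
- move=> A mA; rewrite circle_measureE// /cauchy_measure integral_mkcond.
  apply: eq_integral => x _; rewrite patchE indicE/=.
  by case: ifPn => xA; rewrite ?mulr1 ?mulr0.
Qed.

End density.

(** * Rotation invariance in the tangent coordinate *)

Section rotation.
Context {R : realType}.
Local Open Scope ereal_scope.
Local Notation mu := (@lebesgue_measure R).
Local Notation nu := (@circle_measure R).
Local Notation J := `](- (pi / 2))%R, (pi / 2)%R[%classic.

Lemma lebesgue_measure_shift (h : R) (A : set R) : measurable A ->
  mu ((fun t : R => t + h)%R @^-1` A) = mu A.
Proof.
move=> mA.
have mh : measurable_fun [set: R] (fun t : R => t + h)%R.
  by apply: measurable_funD.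
transitivity (pushforward mu (fun t : R => (t + h)%R : measurableTypeR R) A) => //.
apply/esym/lebesgue_measure_unique => //= _ [[a b]] _ <-.
rewrite /pushforward (_ : _ @^-1` _ = `](a - h)%R, (b - h)%R]%classic); last first.
  by apply/seteqP; split=> t /=; rewrite !in_itv/= ltrBlDr lerBrDr.
rewrite !lebesgue_measure_itv/= !lte_fin ltrD2r.
by case: ifPn => // _; rewrite -!EFinB; congr EFin; ring.
Qed.

Lemma ge0_integral_shift (a b h : R) (G : R -> \bar R) :
  measurable_fun setT G -> (forall y, 0 <= G y) ->
  \int[mu]_(t in `[a, b[) G (t + h)%R =
  \int[mu]_(t in `[(a + h)%R, (b + h)%R[) G t.
Proof.
move=> mG G0.
have mh : measurable_fun [set: R] (fun t : R => t + h)%R.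
  by apply: measurable_funD.
pose H := G \_ `[(a + h)%R, (b + h)%R[.
have mH : measurable_fun [set: R] H.
  by apply/(measurable_restrictT _ _).1 => //; exact: measurable_funTS.
have H0 y : 0 <= H y by rewrite /H patchE; case: ifPn.
rewrite [RHS]integral_mkcond.
rewrite (@ge0_integral_transfer _ _ (measurableTypeR R) (measurableTypeR R) R
   (fun t => t + h)%R mh mu setT _ (cst 1%R))//=; last first.
  move=> A mA; under eq_integral do rewrite mul1r.
  rewrite integral_indic//= ?setIT; last first.
    by rewrite -[X in measurable X]setTI; exact: mh.
  exact/esym/lebesgue_measure_shift.
rewrite [LHS]integral_mkcond; apply: eq_integral => t _.
rewrite mule1 /H !patchE.
congr (if _ then _ else _).
by rewrite !mem_setE !in_itv/= lerD2r ltrD2r.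
Qed.

Lemma ge0_integral_itv_split (a b c : R) (G : R -> \bar R) :
  measurable_fun setT G -> (forall y, 0 <= G y) -> (a <= b <= c)%R ->
  \int[mu]_(t in `[a, c[) G t =
  \int[mu]_(t in `[a, b[) G t + \int[mu]_(t in `[b, c[) G t.
Proof.
move=> mG G0 /andP[ab bc].
rewrite -ge0_integral_setU//=.
- by rewrite -itv_bndbnd_setU// bnd_simp.
- exact: measurable_funTS.
- rewrite disj_set2E; apply/eqP; rewrite -subset0 => t [/=].
  by rewrite !in_itv/= => /andP[_ tb] /andP[/(lt_le_trans tb)]; rewrite ltxx.
Qed.

Lemma ge0_integral_periodic_shift (a p h : R) (G : R -> \bar R) :
  measurable_fun setT G -> (forall y, 0 <= G y) -> (0 <= h <= p)%R ->
  (forall t, G (t + p)%R = G t) ->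
  \int[mu]_(t in `[a, (a + p)%R[) G (t + h)%R = \int[mu]_(t in `[a, (a + p)%R[) G t.
Proof.
move=> mG G0 /andP[h0 hp] Gp.
rewrite ge0_integral_shift//.
rewrite (@ge0_integral_itv_split _ (a + p) _)// ?lerD2r ?lerDl ?h0//; last first.
  by rewrite lerD2l hp.
rewrite [RHS](@ge0_integral_itv_split _ (a + h) _)// ?lerDl ?lerD2l ?h0//.
rewrite addeC; congr (_ + _).
(* The part of the shifted interval beyond [a + p] is moved back by one period onto [[a, a + h[]. *)
have -> : (a + p + h = a + h + p)%R by rewrite addrAC.
rewrite -ge0_integral_shift//.
by apply: eq_integral => t _; rewrite Gp.
Qed.

(** Addition law of the tangent: for [x = tan s] and [y = tan t] this is [tan (s + t)], a rotation
    of the circle. Where [x * y = 1] the quotient is 0 by convention, so the invariances of [chi2]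
    hold off one point only. *)
Definition oplus (x y : R) : R := ((x + y) / (1 - x * y))%R.

Lemma cos_atan_neq0 (x : R) : cos (atan x) != 0%R.
Proof. by rewrite cos_atan invr_eq0 sqrtr_eq0 -ltNge onesq_gt0. Qed.

Lemma ge0_integral_circle_oplus (x : R) (G : R -> \bar R) :
  measurable_fun setT G -> (forall y, 0 <= G y) ->
  \int[nu]_y G (oplus x y) = \int[nu]_y G y.
Proof.
move=> mG G0.
have moplus : measurable_fun [set: R] (oplus x).
  apply: measurable_funM; first exact: measurable_funD.
  apply: measurable_fun_inv; apply: measurable_funB => //.
have mGt : measurable_fun [set: R] (G \o @tan R).
  exact: measurableT_comp mG measurable_tan.
rewrite !integral_circle_tan//; last exact: measurableT_comp mG moplus.
(* This covers the exceptional [t] too: where [cos (t + atan x) = 0], both [tan] and [oplus] are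
   quotients by 0, hence 0. *)
have E : \int[mu]_(t in J) G (oplus x (tan t)) =
    \int[mu]_(t in J) G (tan (t + atan x)%R).
  apply: eq_integral => t; rewrite inE/= in_itv/= => tJ.
  rewrite tanD ?cos_atan_neq0//; last by rewrite gt_eqF// cos_gt0_pihalf.
  by rewrite atanK /oplus [(tan t + x)%R]addrC [(tan t * x)%R]mulrC.
have pi0 : (0 < pi :> R)%R by exact: pi_gt0.
have shift (h : R) : (0 <= h <= pi)%R ->
    \int[mu]_(t in J) G (tan (t + h)%R) = \int[mu]_(t in J) G (tan t).
  move=> hp.
  have mGh : measurable_fun [set: R] (fun t => G (tan (t + h))).
    by apply: (measurableT_comp mGt); exact: measurable_funD.
  rewrite -!(@integral_itv_bndoo _ _ _ _ true true); try exact: measurable_funTS.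
  have e : (- (pi / 2) + pi = pi / 2 :> R)%R by lra.
  have := @ge0_integral_periodic_shift (- (pi / 2))%R pi h (G \o @tan R) mGt
    (fun t => G0 _) hp (fun t => congr1 G (tanDpi t)).
  by rewrite e.
rewrite E; have [x0|x0] := leP 0%R (atan x).
  apply: shift; rewrite x0/= ltW// (lt_trans (atan_ltpi2 x))//; lra.
(* A negative angle is raised by [pi], the period of [tan], into the range of [shift]. *)
rewrite -(shift (atan x + pi)%R); last first.
  by have := atan_gtNpi2 x; move=> ?; lra.
by apply: eq_integral => t _; rewrite addrA tanDpi.
Qed.

End rotation.

(** * The chordal distance *)

Section chordal.
Context {R : realType}.
Implicit Types x y z h : R.

(* The squared chordal distance, sin^2 (s - t) for x = tan s and y = tan t. *)
Definition chi2 x y : R := (x - y) ^+ 2 / ((1 + x ^+ 2) * (1 + y ^+ 2)).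

Lemma chi2_ge0 x y : 0 <= chi2 x y.
Proof.
by rewrite divr_ge0 ?sqr_ge0// mulr_ge0// ltW// onesq_gt0.
Qed.

Lemma chi2C x y : chi2 x y = chi2 y x.
Proof. by rewrite /chi2 -(sqrrN (x - y)) opprB [X in _ / X]mulrC. Qed.

Lemma chi2_eq0 x y : (chi2 x y == 0) = (x == y).
Proof.
rewrite mulf_eq0 sqrf_eq0 subr_eq0 invr_eq0 mulf_eq0.
by rewrite !(negbTE (onesq_neq0 _)) !orbF.
Qed.

Lemma onem_chi2 x y :
  1 - chi2 x y = (1 + x * y) ^+ 2 / ((1 + x ^+ 2) * (1 + y ^+ 2)).
Proof.
rewrite /chi2; field.
by rewrite !onesq_neq0.
Qed.

Lemma chi2_le1 x y : chi2 x y <= 1.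
Proof.
rewrite -subr_ge0 onem_chi2.
by rewrite divr_ge0 ?sqr_ge0// mulr_ge0// ltW// onesq_gt0.
Qed.

Lemma chi20 y : 1 - chi2 0 y = (1 + y ^+ 2)^-1.
Proof. by rewrite onem_chi2 mul0r addr0 expr0n/= addr0 expr1n !mul1r. Qed.

Lemma chi2_triangle x y z : chi2 y z <= 2 * (chi2 x y + chi2 x z).
Proof.
have x0 := onesq_gt0 x; have y0 := onesq_gt0 y; have z0 := onesq_gt0 z.
rewrite -subr_ge0.
(* With [A] and [B] the angles from [x] to [y] and from [x] to [z], this reads [2 (sin^2 A + sin^2
   B) - sin^2 (A - B) = sin^2 (A + B) + 4 sin^2 A sin^2 B]. *)
have -> : 2 * (chi2 x y + chi2 x z) - chi2 y z =
  (((y - x) * (1 + x * z) + (z - x) * (1 + x * y)) ^+ 2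
  + 2 * (x - y) ^+ 2 * (x - z) ^+ 2 + 2 * (x - y) ^+ 2 * (x - z) ^+ 2)
   / ((1 + x ^+ 2) ^+ 2 * (1 + y ^+ 2) * (1 + z ^+ 2)).
  by rewrite /chi2; field; rewrite !onesq_neq0.
have xyz : 0 <= 2 * (x - y) ^+ 2 * (x - z) ^+ 2.
  by rewrite -mulrA mulr_ge0// mulr_ge0 ?sqr_ge0.
apply: divr_ge0; first by rewrite -addrA addr_ge0 ?addr_ge0 ?sqr_ge0.
by apply/ltW; rewrite !mulr_gt0// exprn_gt0.
Qed.

Lemma onesq_oplus x h : 1 - x * h != 0 ->
  1 + oplus x h ^+ 2 = (1 + x ^+ 2) * (1 + h ^+ 2) / (1 - x * h) ^+ 2.
Proof. by move=> xh; rewrite /oplus; field. Qed.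

Lemma chi2_oplus x y h : 1 - x * h != 0 -> 1 - y * h != 0 ->
  chi2 (oplus x h) (oplus y h) = chi2 x y.
Proof.
move=> xh yh; rewrite /chi2 !onesq_oplus// /oplus; field.
by rewrite !onesq_neq0 xh yh.
Qed.

Lemma chi2_oplusl x y : 1 - x * y != 0 -> chi2 x (oplus x y) = chi2 0 y.
Proof.
move=> xy; rewrite /chi2 onesq_oplus// /oplus expr0n/=; field.
by rewrite !onesq_neq0 xy.
Qed.

Lemma oplusC x y : oplus x y = oplus y x.
Proof. by rewrite /oplus [x + y]addrC [x * y]mulrC. Qed.

End chordal.

Section power_bounds.
Context {R : realType}.

(** Bernoulli gives [M y <= (1 + y)^M], and [(1 + y) (1 - y) <= 1]. Through this bound a power of
    [1 - chi2] pays for a factor [N^2 chi2]. *)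
Lemma expr_onem_mul_le (y : R) (M : nat) : 0 <= y <= 1 ->
  M%:R * y * (1 - y) ^+ M <= 1.
Proof.
move=> /andP[y0 y1].
have y1' : 0 <= 1 - y by rewrite subr_ge0.
apply: (@le_trans _ _ ((1 + y) ^+ M * (1 - y) ^+ M)); last first.
  rewrite -exprMn exprn_ile1//; first by rewrite mulr_ge0// addr_ge0.
  by nra.
rewrite ler_wpM2r ?exprn_ge0//.
elim: M => [|M IH]; first by rewrite mul0r expr0.
rewrite exprS mulrDl mul1r -natr1 mulrDl mul1r lerD//.
rewrite -[leLHS]mulr1 ler_wpM2l//.
by rewrite exprn_ege1// lerDl.
Qed.

Lemma expr_inv_onesq_ge (y : R) (M : nat) : 1 - M%:R * y ^+ 2 <= (1 + y ^+ 2)^-1 ^+ M.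
Proof.
have y0 := onesq_gt0 y; set s := y ^+ 2 in y0 *.
have s0 : 0 <= s by rewrite sqr_ge0.
elim: M => [|M IH]; first by rewrite mul0r subr0 expr0.
have i1 : (1 + s)^-1 <= 1 by rewrite invf_le1// lerDl.
have i0 : 0 <= (1 + s)^-1 by rewrite invr_ge0 ltW.
have i2 : 1 - s <= (1 + s)^-1.
  by rewrite -[leRHS]mul1r ler_pdivlMr//; nra.
have e0 : 0 <= (1 + s)^-1 ^+ M by rewrite exprn_ge0.
have e1 : (1 + s)^-1 ^+ M <= 1 by rewrite exprn_ile1.
rewrite exprS -natr1; nra.
Qed.

End power_bounds.

(** * Rational averages and the energy *)

Section mollifier.
Context {R : realType}.
Local Notation nu := (@circle_measure R).

Lemma measurable_fun_oplus d (T : measurableType d) (f g : T -> R) :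
  measurable_fun setT f -> measurable_fun setT g ->
  measurable_fun setT (fun t => oplus (f t) (g t)).
Proof.
move=> mf mg; apply: measurable_funM; first exact: measurable_funD.
apply: measurable_fun_inv; apply: measurable_funB => //.
exact: measurable_funM.
Qed.

Lemma measurable_fun_chi2 d (T : measurableType d) (f g : T -> R) :
  measurable_fun setT f -> measurable_fun setT g ->
  measurable_fun setT (fun t => chi2 (f t) (g t)).
Proof.
move=> mf mg; apply: measurable_funM.
  by apply: measurable_funX; exact: measurable_funB.
apply: measurable_fun_inv; apply: measurable_funM;
  by apply: measurable_funD => //; exact: measurable_funX.
Qed.

Lemma bounded_integrable (f : R -> R) (B : R) :
  measurable_fun setT f -> (forall x, `|f x| <= B) ->
  nu.-integrable setT (EFin \o f).
Proof.
move=> mf fB; apply: measurable_bounded_integrable => //.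
  by rewrite [X in (X < _)%E]circle_measureT ltry.
exists B; split; first exact: num_real.
by move=> M BM x _; apply: le_trans (fB x) _; exact: ltW.
Qed.

Lemma circle_set1 (a : R) : nu [set a] = 0%E.
Proof.
rewrite circle_measureE; last exact: measurable_set1.
rewrite /cauchy_measure integral_set1//.
Qed.

Lemma ae_oplus_neq0 (x : R) : {ae nu, forall y, 1 - x * y != 0}.
Proof.
exists [set x^-1]; split; [exact: measurable_set1|exact: circle_set1|].
move=> y /= /negP; rewrite negbK subr_eq0 => /eqP xy.
have x0 : x != 0 by apply: contra_eq_neq xy => ->; rewrite mul0r oner_neq0.
by apply: (mulfI x0); rewrite mulfV.
Qed.

Lemma ge0_integral_kernel_oplus (x : R) (M : nat) (H : R -> R) :
  measurable_fun setT H -> (forall y, 0 <= H y) ->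
  (\int[nu]_y (H y * (1 - chi2 x y) ^+ M)%:E =
   \int[nu]_y (H (oplus x y) * (1 - chi2 0 y) ^+ M)%:E)%E.
Proof.
move=> mH H0.
have mk (z : R) : measurable_fun setT (fun y => (1 - chi2 z y) ^+ M).
  by apply: measurable_funX; apply: measurable_funB => //; exact: measurable_fun_chi2.
have k0 (z y : R) : 0 <= (1 - chi2 z y) ^+ M.
  by rewrite exprn_ge0// subr_ge0 chi2_le1.
rewrite -(@ge0_integral_circle_oplus _ x); last 2 first.
- by apply/measurable_EFinP; exact: measurable_funM mH (mk x).
- by move=> y; rewrite lee_fin mulr_ge0.
have mo : measurable_fun setT (oplus x) by apply: (@measurable_fun_oplus _ _ (cst x) id).
have mHo : measurable_fun setT (fun y => H (oplus x y)).
  exact: measurableT_comp mH mo.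
apply: ge0_ae_eq_integral => //.
- apply/measurable_EFinP/measurable_funM => //.
  exact: (measurableT_comp (mk x) mo).
- by apply/measurable_EFinP; exact: measurable_funM mHo (mk 0).
- by move=> y _; rewrite lee_fin mulr_ge0.
- by move=> y _; rewrite lee_fin mulr_ge0.
have aex := ae_oplus_neq0 x.
by apply: (@filterS _ _ (ae_filter_ringOfSetsType nu) _ _ _ aex) => y xy _; rewrite chi2_oplusl.
Qed.

(* 1 - chi2 x y is cos^2 (s - t) for x = tan s and y = tan t: the kernel is
   concentrated at the scale 1/N and a rational function of x. *)
Definition kernel_mass (N : nat) : R := \int[nu]_y ((1 - chi2 0 y) ^+ (2 * N ^ 2)).

Definition kernel (N : nat) (x y : R) : R :=
  (1 - chi2 x y) ^+ (2 * N ^ 2) / kernel_mass N.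

Lemma measurable_onem_chi2X (x : R) M :
  measurable_fun setT (fun y => (1 - chi2 x y) ^+ M).
Proof.
by apply: measurable_funX; apply: measurable_funB => //; exact: measurable_fun_chi2.
Qed.

Lemma onem_chi2X_ge0 (x y : R) M : 0 <= (1 - chi2 x y) ^+ M.
Proof. by rewrite exprn_ge0// subr_ge0 chi2_le1. Qed.

Lemma onem_chi2X_le1 (x y : R) M : (1 - chi2 x y) ^+ M <= 1.
Proof.
by rewrite exprn_ile1 ?subr_ge0 ?chi2_le1// lerBlDr lerDl chi2_ge0.
Qed.

Lemma integrable_onem_chi2X (x : R) M :
  nu.-integrable setT (fun y => ((1 - chi2 x y) ^+ M)%:E).
Proof.
apply: (@bounded_integrable _ 1); first exact: measurable_onem_chi2X.
by move=> y; rewrite ger0_norm ?onem_chi2X_ge0 ?onem_chi2X_le1.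
Qed.

Lemma kernel_mass_ge (N : nat) : (0 < N)%N -> (8 * N%:R)^-1 <= kernel_mass N.
Proof.
move=> N0; rewrite /kernel_mass /Rintegral.
set M := (2 * N ^ 2)%N.
have Nr0 : 0 < N%:R :> R by rewrite ltr0n.
have I : (\int[nu]_y ((1 - chi2 0 y) ^+ M)%:E \is a fin_num)%E.
  apply: integrable_fin_num => //; exact: integrable_onem_chi2X.
rewrite -lee_fin fineK//.
rewrite integral_circle_density; last 2 first.
- by apply/measurable_EFinP; exact: measurable_onem_chi2X.
- by move=> y; rewrite lee_fin onem_chi2X_ge0.
under eq_integral do rewrite -EFinM.
(* Together with the density the integrand is the power [2 N^2 + 1] of [1 / (1 + y^2)]; on this
   interval it is at least [1 - (2 N^2 + 1) / (4 N^2) >= 1/4]. The length [1 / (2 N)] times [1/4]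
   gives the constant 8. *)
set A := `[0, (2 * N%:R)^-1]%classic : set R.
have mA : measurable A by exact: measurable_itv.
have mI (D : set R) : measurable_fun D (fun y => ((1 - chi2 0 y) ^+ M * cauchy_density y)%:E).
  apply: measurable_funTS; apply/measurable_EFinP/measurable_funM.
    exact: measurable_onem_chi2X.
  exact: measurable_cauchy_density.
apply: (@le_trans _ _ (\int[lebesgue_measure]_(y in A)
    ((1 - chi2 0 y) ^+ M * cauchy_density y)%:E)%E); last first.
  apply: ge0_subset_integral => //=.
  - exact: mI.
  - by move=> y _; rewrite lee_fin mulr_ge0 ?onem_chi2X_ge0 ?cauchy_density_ge0.
apply: (@le_trans _ _ (\int[lebesgue_measure]_(y in A) (4^-1)%:E)%E).
  rewrite integral_cst// [X in (_ <= _ * X)%E](_ : _ = lebesgue_measure `[0, (2 * N%:R)^-1])//.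
  rewrite lebesgue_measure_itv/= lte_fin invr_gt0 mulr_gt0//.
  rewrite -EFinB subr0 -EFinM lee_fin -invfM.
  by rewrite lef_pV2 ?posrE ?mulr_gt0//; lra.
apply: ge0_le_integral => //=.
- exact: (mI A).
- move=> y; rewrite /A/= in_itv/= => /andP[y0 yN].
  rewrite lee_fin chi20 /cauchy_density -exprSr.
  apply: le_trans (expr_inv_onesq_ge _ _).
  have : y ^+ 2 <= (2 * N%:R)^-1 ^+ 2 by rewrite lerXn2r ?nnegrE// invr_ge0 mulr_ge0.
  have -> : (2 * N%:R)^-1 ^+ 2 = (4 * (N ^ 2)%:R)^-1 :> R.
    by rewrite exprVn natrX exprMn; congr (_ * _)^-1; ring.
  move=> y2.
  have N1 : (1 : R) <= (N ^ 2)%:R by rewrite ler1n expn_gt0 N0.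
  have : y ^+ 2 * (4 * (N ^ 2)%:R) <= 1.
    rewrite -ler_pdivlMr; last by rewrite mulr_gt0// (lt_le_trans _ N1).
    by rewrite mul1r.
  have s0 : y ^+ 2 <= y ^+ 2 * (N ^ 2)%:R by rewrite ler_peMr ?sqr_ge0.
  rewrite -[M.+1%:R]natr1 /M natrM; move: N1 s0; clear.
  move: (y ^+ 2) ((N ^ 2)%:R : R) => s n n1 s1 s2.
  by rewrite mulrDl -mulrA [n * s]mulrC; lra.
Qed.

Lemma kernel_mass_gt0 N : (0 < N)%N -> 0 < kernel_mass N.
Proof.
move=> N0; apply: lt_le_trans (kernel_mass_ge N0).
by rewrite invr_gt0 mulr_gt0// ltr0n.
Qed.

Lemma kernel_ge0 N (x y : R) : 0 <= kernel N x y.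
Proof.
rewrite divr_ge0 ?onem_chi2X_ge0//.
by apply: Rintegral_ge0 => z _; exact: onem_chi2X_ge0.
Qed.

Lemma kernel_le N (x y : R) : (0 < N)%N ->
  kernel N x y <= 8 * N%:R * (1 - chi2 x y) ^+ (2 * N ^ 2).
Proof.
move=> N0; rewrite /kernel mulrC ler_wpM2r ?onem_chi2X_ge0//.
rewrite invf_ple ?posrE ?kernel_mass_gt0 ?mulr_gt0 ?ltr0n//.
exact: kernel_mass_ge.
Qed.

End mollifier.

Section mollify.
Context {R : realType}.
Local Notation nu := (@circle_measure R).

Lemma measurable_kernel N d (T : measurableType d) (f g : T -> R) :
  measurable_fun setT f -> measurable_fun setT g ->
  measurable_fun setT (fun t => kernel N (f t) (g t)).
Proof.
move=> mf mg; apply: measurable_funM => //.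
apply: measurable_funX; apply: measurable_funB => //.
exact: measurable_fun_chi2.
Qed.

Lemma kernel_bound N (x y : R) : (0 < N)%N -> kernel N x y <= 8 * N%:R.
Proof.
move=> N0; apply: le_trans (kernel_le _ _ N0) _.
by rewrite -[leRHS]mulr1 ler_wpM2l// ?onem_chi2X_le1// mulr_ge0.
Qed.

Lemma bounded_integrable_kernel N (f : R -> R) (B x : R) : (0 < N)%N ->
  measurable_fun setT f -> (forall y, `|f y| <= B) ->
  nu.-integrable setT (EFin \o (fun y => f y * kernel N x y)).
Proof.
move=> N0 mf fB; apply: (@bounded_integrable _ _ (B * (8 * N%:R))).
  apply: measurable_funM => //.
  exact: (@measurable_kernel _ _ _ (cst x) id).
move=> y; rewrite normrM ler_pM// ger0_norm ?kernel_ge0//.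
exact: kernel_bound.
Qed.

Lemma integrable_kernel N (x : R) : (0 < N)%N ->
  nu.-integrable setT (EFin \o (fun y => kernel N x y)).
Proof.
move=> N0.
apply: eq_integrable (@bounded_integrable_kernel N (cst 1) 1 x N0 _ _) => //.
- by move=> y _ /=; rewrite mul1r.
- by move=> y; rewrite normr1.
Qed.

Lemma ge0_Rintegral_kernel_oplus N (f : R -> R) (x : R) :
  measurable_fun setT f -> (forall y, 0 <= f y) ->
  \int[nu]_y (f y * kernel N x y) = \int[nu]_y (f (oplus x y) * kernel N 0 y).
Proof.
move=> mf f0; rewrite /Rintegral; congr fine.
have Z0 : 0 <= (kernel_mass N)^-1 :> R.
  by rewrite invr_ge0; apply: Rintegral_ge0 => z _; exact: onem_chi2X_ge0.
transitivity (\int[nu]_y (f y * (kernel_mass N)^-1 *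
    (1 - chi2 x y) ^+ (2 * N ^ 2))%:E)%E.
  by apply: eq_integral => y _; rewrite /kernel mulrA mulrAC.
rewrite (@ge0_integral_kernel_oplus R x _ (fun y => f y * (kernel_mass N)^-1)).
- by apply: eq_integral => y _; rewrite /kernel mulrA mulrAC.
- exact: measurable_funM.
- by move=> y; rewrite mulr_ge0.
Qed.

Lemma Rintegral_kernel N (x : R) : (0 < N)%N -> \int[nu]_y kernel N x y = 1.
Proof.
move=> N0.
transitivity (\int[nu]_y (cst 1 y * kernel N x y)).
  by apply: eq_Rintegral => y _; rewrite mul1r.
rewrite ge0_Rintegral_kernel_oplus//.
transitivity (\int[nu]_y ((1 - chi2 0 y) ^+ (2 * N ^ 2) * (kernel_mass N)^-1)).
  by apply: eq_Rintegral => y _; rewrite mul1r.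
rewrite RintegralZr//; last exact: integrable_onem_chi2X.
by rewrite divff// gt_eqF// kernel_mass_gt0.
Qed.

Lemma Rintegral_kernelD N (f : R -> R) (B c x : R) : (0 < N)%N ->
  measurable_fun setT f -> (forall y, `|f y| <= B) ->
  \int[nu]_y ((f y + c) * kernel N x y) = \int[nu]_y (f y * kernel N x y) + c.
Proof.
move=> N0 mf fB.
transitivity (\int[nu]_y (f y * kernel N x y + c * kernel N x y)).
  by apply: eq_Rintegral => y _; rewrite mulrDl.
have ik := integrable_kernel x N0.
rewrite RintegralD//.
- by rewrite RintegralZl// Rintegral_kernel// mulr1.
- exact: bounded_integrable_kernel fB.
- by apply: (@bounded_integrable_kernel N (cst c) `|c|).
Qed.

Definition mollify N (f : R -> R) (x : R) : R := \int[nu]_y (f y * kernel N x y).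

Lemma mollify_oplus N (f : R -> R) (B x : R) : (0 < N)%N ->
  measurable_fun setT f -> (forall y, `|f y| <= B) ->
  mollify N f x = \int[nu]_y (f (oplus x y) * kernel N 0 y).
Proof.
(* Adding [B] makes the function nonnegative, where the substitution is available; the kernel has
   mass 1, so both sides grow by [B]. *)
move=> N0 mf fB; apply: (addIr B).
have mo : measurable_fun setT (oplus x) by apply: (@measurable_fun_oplus _ _ _ (cst x) id).
rewrite -(Rintegral_kernelD _ _ N0 mf fB).
rewrite -(@Rintegral_kernelD N (fun y => f (oplus x y)) B)//; last first.
  exact: measurableT_comp mf mo.
apply: ge0_Rintegral_kernel_oplus; first exact: measurable_funD.
by move=> y; have := fB y; rewrite ler_norml => /andP[+ _]; rewrite -subr_ge0 opprK.
Qed.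

(** The variance [\int (g - m)^2 k] about the mean [m] is nonnegative; since [k] has mass 1,
    expanding the square gives the inequality. *)
Lemma jensen_sq (k g : R -> R) (K B : R) :
  measurable_fun setT k -> (forall y, 0 <= k y <= K) -> \int[nu]_y k y = 1 ->
  measurable_fun setT g -> (forall y, `|g y| <= B) ->
  (\int[nu]_y (g y * k y)) ^+ 2 <= \int[nu]_y (g y ^+ 2 * k y).
Proof.
move=> mk kK k1 mg gB.
have kn y : `|k y| <= K by have /andP[k0 kK'] := kK y; rewrite ger0_norm.
have ik : nu.-integrable setT (EFin \o k) by exact: bounded_integrable kn.
have igk : nu.-integrable setT (EFin \o (fun y => g y * k y)).
  apply: (@bounded_integrable _ _ (B * K)); first exact: measurable_funM.
  by move=> y; rewrite normrM ler_pM.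
have ig2k : nu.-integrable setT (EFin \o (fun y => g y ^+ 2 * k y)).
  apply: (@bounded_integrable _ _ (B ^+ 2 * K)).
    by apply: measurable_funM => //; exact: measurable_funX.
  by move=> y; rewrite normrM ler_pM// normrX lerXn2r// nnegrE (le_trans _ (gB y)).
set m := \int[nu]_y (g y * k y).
have : 0 <= \int[nu]_y ((g y - m) ^+ 2 * k y).
  by apply: Rintegral_ge0 => y _; rewrite mulr_ge0 ?sqr_ge0//; have /andP[] := kK y.
have -> : \int[nu]_y ((g y - m) ^+ 2 * k y) =
    \int[nu]_y (g y ^+ 2 * k y + (- (2 * m) * (g y * k y) + m ^+ 2 * k y)).
  by apply: eq_Rintegral => y _; ring.
have i1 : nu.-integrable setT (EFin \o (fun y => - (2 * m) * (g y * k y))).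
  exact: (integrableZl measurableT (- (2 * m)) igk).
have i2 : nu.-integrable setT (EFin \o (fun y => m ^+ 2 * k y)).
  exact: (integrableZl measurableT (m ^+ 2) ik).
rewrite RintegralD//; last exact: (integrableD measurableT i1 i2).
rewrite RintegralD// !RintegralZl// k1 -/m; lra.
Qed.

End mollify.

(** * The energy of a scalar function and its decrease under averaging *)

Section energy.
Context {R : realType}.
Local Notation nu := (@circle_measure R).
Local Open Scope ereal_scope.

Lemma measurable_fun_integral d (T : measurableType d) (G : T -> R -> \bar R) :
  measurable_fun setT (fun p : T * R => G p.1 p.2) -> (forall x y, 0 <= G x y) ->
  measurable_fun setT (fun x => \int[nu]_y G x y).
Proof.
move=> mG G0.
exact: (@measurable_fun_fubini_tonelli_F _ _ T (measurableTypeR R) R nu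
  (fun p => G p.1 p.2) mG (fun p => G0 p.1 p.2)).
Qed.

Lemma circle_fubini (G : R -> R -> \bar R) :
  measurable_fun setT (fun p : R * R => G p.1 p.2) -> (forall x y, 0 <= G x y) ->
  \int[nu]_x \int[nu]_y G x y = \int[nu]_y \int[nu]_x G x y.
Proof.
move=> mG G0.
exact: (@fubini_tonelli _ _ (measurableTypeR R) (measurableTypeR R) R nu nu
  (fun p => G p.1 p.2) mG (fun p => G0 p.1 p.2)).
Qed.

(** On the diagonal the integrand is [0 / 0 = 0], which keeps pointwise comparisons valid for all
    pairs. *)
Definition energy (f : R -> R) : \bar R :=
  \int[nu]_x \int[nu]_y ((f x - f y) ^+ 2 / chi2 x y)%:E.

Lemma energy_integrand_ge0 (f : R -> R) x y : (0 <= (f x - f y) ^+ 2 / chi2 x y)%R.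
Proof. by rewrite divr_ge0 ?sqr_ge0 ?chi2_ge0. Qed.

Lemma energy_ge0 f : 0 <= energy f.
Proof.
apply: integral_ge0 => x _; apply: integral_ge0 => y _.
by rewrite lee_fin energy_integrand_ge0.
Qed.

Lemma measurable_energy_integrand d (T : measurableType d) (u v s t : T -> R) :
  measurable_fun setT u -> measurable_fun setT v ->
  measurable_fun setT s -> measurable_fun setT t ->
  measurable_fun setT (fun p => (u p - v p) ^+ 2 / chi2 (s p) (t p))%R.
Proof.
move=> mu mv ms mt; apply: measurable_funM.
  by apply: measurable_funX; exact: measurable_funB.
by apply: measurable_fun_inv; exact: measurable_fun_chi2.
Qed.

Lemma measurable_mollify N (f : R -> R) (B : R) : (0 < N)%N ->
  measurable_fun setT f -> (forall y, `|f y| <= B)%R ->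
  measurable_fun setT (mollify N f).
Proof.
move=> N0 mf fB.
have -> : mollify N f = (fun x =>
    fine (\int[nu]_y ((f y + B) * kernel N x y)%:E) - B)%R.
  apply/funext => x; apply: (addIr B).
  by rewrite subrK -(Rintegral_kernelD _ _ N0 mf fB).
apply: measurable_funB => //.
apply: measurableT_comp => //.
apply: measurable_fun_integral.
  apply/measurable_EFinP/measurable_funM.
    by apply: measurable_funD => //; exact: measurableT_comp mf measurable_snd.
  by apply: measurable_kernel; [exact: measurable_fst|exact: measurable_snd].
move=> x y; rewrite lee_fin mulr_ge0 ?kernel_ge0//.
by have := fB y; rewrite ler_norml => /andP[+ _]; rewrite -subr_ge0 opprK.
Qed.

Lemma EFin_Rintegral (f : R -> R) : nu.-integrable setT (EFin \o f) ->
  (\int[nu]_y f y)%R%:E = \int[nu]_y (f y)%:E.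
Proof. by move=> fi; rewrite /Rintegral fineK// integrable_fin_num. Qed.

(** A rotation preserves both [chi2] and the circle measure. One variable is rotated at a time, off
    the point where the denominator of [oplus] vanishes. *)
Lemma energy_oplus (f : R -> R) (h : R) : measurable_fun setT f ->
  \int[nu]_x \int[nu]_y ((f (oplus x h) - f (oplus y h)) ^+ 2 / chi2 x y)%:E =
  energy f.
Proof.
move=> mf.
pose G (x y : R) := ((f x - f y) ^+ 2 / chi2 x y)%:E.
have mG : measurable_fun setT (fun p : R * R => G p.1 p.2).
  apply/measurable_EFinP/measurable_energy_integrand => //;
  exact: measurableT_comp mf _.
have G0 x y : 0 <= G x y by rewrite lee_fin energy_integrand_ge0.
have mG1 x : measurable_fun setT (G x).
  apply/measurable_EFinP; exact: (@measurable_energy_integrand _ _ (cst (f x)) f (cst x) id).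
have moh : measurable_fun setT (oplus ^~ h).
  exact: (@measurable_fun_oplus _ _ _ id (cst h)).
have mfo : measurable_fun setT (fun x => f (oplus x h)) by exact: measurableT_comp mf moh.
have aeh := ae_oplus_neq0 h.
pose G' (x y : R) := ((f (oplus x h) - f (oplus y h)) ^+ 2 / chi2 x y)%:E.
have mG' : measurable_fun setT (fun p : R * R => G' p.1 p.2).
  apply/measurable_EFinP/measurable_energy_integrand => //;
  exact: measurableT_comp mfo _.
have mG'1 x : measurable_fun setT (G' x).
  apply/measurable_EFinP; exact: (@measurable_energy_integrand _ _
    (cst (f (oplus x h))) (fun y => f (oplus y h)) (cst x) id).
have G'0 x y : 0 <= G' x y.
  by rewrite lee_fin divr_ge0 ?sqr_ge0 ?chi2_ge0.
transitivity (\int[nu]_x \int[nu]_y G (oplus h x) y); last first.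
  rewrite (@ge0_integral_circle_oplus _ h (fun x => \int[nu]_y G x y))//.
  - exact: measurable_fun_integral.
  - by move=> x; apply: integral_ge0 => y _; exact: G0.
apply: ge0_ae_eq_integral => //.
- exact: measurable_fun_integral.
- have moh' : measurable_fun setT (oplus h).
    exact: (@measurable_fun_oplus _ _ _ (cst h) id).
  apply: (measurableT_comp _ moh' (f := fun x => \int[nu]_y G x y)).
  exact: measurable_fun_integral.
- by move=> x _; apply: integral_ge0 => y _; exact: G'0.
- by move=> x _; apply: integral_ge0 => y _; exact: G0.
apply: (@filterS _ _ (ae_filter_ringOfSetsType nu) _ _ _ aeh) => x xh _.
rewrite -(@ge0_integral_circle_oplus _ h (G (oplus h x)))//.
have mGo : measurable_fun setT (fun y => G (oplus h x) (oplus h y)).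
  apply: measurableT_comp (mG1 (oplus h x)) _.
  exact: (@measurable_fun_oplus _ _ _ (cst h) id).
apply: ge0_ae_eq_integral => //.
- exact: mG'1.
- by move=> y _; exact: G'0.
apply: (@filterS _ _ (ae_filter_ringOfSetsType nu) _ _ _ aeh) => y yh _.
by rewrite /G /G' ![oplus h _]oplusC chi2_oplus// mulrC.
Qed.

(** [mollify N f] averages the rotates [f (oplus x h)] with the weight [kernel N 0 h], a probability
    density in [h]. Jensen's inequality bounds its energy by the average of the energies of the
    rotates, and these all equal [energy f]; Tonelli brings the integral in [h] outside. *)
Lemma energy_mollify N (f : R -> R) (B : R) : (0 < N)%N ->
  measurable_fun setT f -> (forall y, `|f y| <= B)%R ->
  energy (mollify N f) <= energy f.
Proof.
move=> N0 mf fB.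
pose D (x y h : R) := (f (oplus x h) - f (oplus y h))%R.
have moxh : measurable_fun setT (fun p : R * R => f (oplus p.1 p.2)).
  apply: (measurableT_comp mf); exact: measurable_fun_oplus.
have mofx (x : R) : measurable_fun setT (fun h : R => f (oplus x h)).
  apply: (measurableT_comp mf); exact: (@measurable_fun_oplus _ _ _ (cst x) id).
pose F (x y h : R) := (D x y h ^+ 2 / chi2 x y * kernel N 0 h)%:E.
have F0 x y h : 0 <= F x y h.
  by rewrite lee_fin mulr_ge0 ?kernel_ge0// divr_ge0 ?sqr_ge0 ?chi2_ge0.
have mF : measurable_fun setT (fun q : (R * R) * R => F q.1.1 q.2 q.1.2).
  apply/measurable_EFinP/measurable_funM; last first.
    apply: (@measurable_kernel _ _ _ _ (cst 0%R)) => //.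
    exact: (measurableT_comp measurable_snd measurable_fst).
  apply: measurable_energy_integrand => //.
  - exact: (measurableT_comp moxh measurable_fst).
  - apply: (measurableT_comp mf); apply: measurable_fun_oplus => //.
    exact: (measurableT_comp measurable_snd measurable_fst).
  - exact: (measurableT_comp measurable_fst measurable_fst).
have mk0 : measurable_fun setT (kernel N (0 : R)).
  exact: (@measurable_kernel _ _ _ _ (cst 0%R) id).
have DB x y h : (`|D x y h| <= B + B)%R.
  by rewrite (le_trans (ler_normB _ _))// lerD.
have iD x y : nu.-integrable setT (EFin \o (fun h => D x y h ^+ 2 * kernel N 0 h)%R).
  apply: (@bounded_integrable_kernel _ _ _ ((B + B) ^+ 2)) => //.
    by apply: measurable_funX; exact: measurable_funB.
  by move=> h; rewrite normrX lerXn2r// nnegrE (le_trans _ (DB x y h)).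
have pt x y : ((mollify N f x - mollify N f y) ^+ 2 / chi2 x y)%:E <=
    \int[nu]_h F x y h.
  have -> : \int[nu]_h F x y h =
      (\int[nu]_h (D x y h ^+ 2 * kernel N 0 h) / chi2 x y)%R%:E.
    rewrite mulrC EFinM EFin_Rintegral// -ge0_integralZl//.
    - by apply: eq_integral => h _; rewrite /F -EFinM; congr EFin; rewrite [RHS]mulrCA mulrA.
    - by case/integrableP : (iD x y).
    - by move=> h _; rewrite lee_fin mulr_ge0 ?sqr_ge0 ?kernel_ge0.
    - by rewrite lee_fin invr_ge0 chi2_ge0.
  rewrite lee_fin ler_wpM2r ?invr_ge0 ?chi2_ge0//.
  rewrite !(mollify_oplus _ N0 mf fB) -RintegralB//; last 2 first.
  - exact: (@bounded_integrable_kernel _ _ _ B).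
  - exact: (@bounded_integrable_kernel _ _ _ B).
  rewrite (_ : \int[nu]_h _ = \int[nu]_h (D x y h * kernel N 0 h))%R; last first.
    by apply: eq_Rintegral => h _; rewrite mulrBl.
  apply: (@jensen_sq _ _ _ (8 * N%:R) (B + B)) => //.
  - by move=> h; rewrite kernel_ge0 kernel_bound.
  - exact: Rintegral_kernel.
  - exact: measurable_funB.
have mF1 x : measurable_fun setT (fun p : R * R => F x p.1 p.2).
  apply: (measurableT_comp mF (g := fun p : R * R => ((x, p.2), p.1))).
  by apply: measurable_fun_pair => //; apply: measurable_fun_pair.
have mF2 : measurable_fun setT (fun q : (R * R) => \int[nu]_y F q.1 y q.2).
  exact: measurable_fun_integral.
apply: (@le_trans _ _ (\int[nu]_x \int[nu]_y \int[nu]_h F x y h)).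
  have mm := measurable_mollify N0 mf fB.
  apply: ge0_le_integral => //.
  - by move=> x _; apply: integral_ge0 => y _; rewrite lee_fin energy_integrand_ge0.
  - apply: measurable_fun_integral.
      by apply/measurable_EFinP/measurable_energy_integrand => //;
        exact: measurableT_comp mm _.
    by move=> x y; rewrite lee_fin energy_integrand_ge0.
  - apply: (@measurable_fun_integral _ _ (fun x y => \int[nu]_h F x y h)).
      apply: (@measurable_fun_integral _ _ (fun p h => F p.1 p.2 h)) => //.
      apply: (measurableT_comp mF (g := fun q : (R * R) * R => ((q.1.1, q.2), q.1.2))).
      apply: measurable_fun_pair; first apply: measurable_fun_pair => //.
        exact: (measurableT_comp measurable_fst measurable_fst).
      exact: (measurableT_comp measurable_snd measurable_fst).
    by move=> x y; apply: integral_ge0 => h _; exact: F0.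
  - move=> x _; apply: ge0_le_integral => //.
    + by move=> y _; rewrite lee_fin energy_integrand_ge0.
    + apply/measurable_EFinP.
      exact: (@measurable_energy_integrand _ _ (cst (mollify N f x)) (mollify N f) (cst x) id).
    + exact: (@measurable_fun_integral _ _ (F x) (mF1 x) (F0 x)).
apply: (@le_trans _ _ (\int[nu]_h (energy f * (kernel N 0 h)%:E))); last first.
  rewrite ge0_integralZl//.
  - by rewrite -EFin_Rintegral ?integrable_kernel// Rintegral_kernel// mule1.
  - exact/measurable_EFinP.
  - by move=> h _; rewrite lee_fin kernel_ge0.
  - exact: energy_ge0.
under eq_integral => x _ do rewrite (@circle_fubini (F x))//.
rewrite (@circle_fubini (fun x h => \int[nu]_y F x y h))//=; last first.
  by move=> x h; apply: integral_ge0 => y _; exact: F0.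
rewrite le_eqVlt; apply/orP; left; apply/eqP; apply: eq_integral => h _.
have kh0 : (0 <= (kernel N 0 h)%:E)%E by rewrite lee_fin kernel_ge0.
rewrite -(energy_oplus h mf).
have mfo : measurable_fun setT (fun x => f (oplus x h)).
  by apply: (measurableT_comp mf); exact: (@measurable_fun_oplus _ _ _ id (cst h)).
rewrite -ge0_integralZr//.
- apply: eq_integral => x _; rewrite -ge0_integralZr//.
  + apply/measurable_EFinP.
    exact: (@measurable_energy_integrand _ _ (cst (f (oplus x h)))
      (fun y => f (oplus y h)) (cst x) id).
  + by move=> y _; rewrite lee_fin divr_ge0 ?sqr_ge0 ?chi2_ge0.
- apply: measurable_fun_integral.
    by apply/measurable_EFinP/measurable_energy_integrand => //;
      exact: measurableT_comp mfo _.
  by move=> x y; rewrite lee_fin divr_ge0 ?sqr_ge0 ?chi2_ge0.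
- move=> x _; apply: integral_ge0 => y _.
  by rewrite lee_fin divr_ge0 ?sqr_ge0 ?chi2_ge0.
Qed.

End energy.

(** * Almost everywhere convergence of the averages *)

Section convergence.
Context {R : realType}.
Local Notation nu := (@circle_measure R).
Local Open Scope ereal_scope.

(** For [s = chi2 x y], the kernel is at most [8 N (1 - s)^(2 N^2)], and
    [2 N^2 s (1 - s)^(2 N^2) <= 1]; the constant is [8 / 2]. *)
Lemma kernel_chi2_le N (x y : R) : (0 < N)%N ->
  (kernel N x y * chi2 x y <= 4 / N%:R)%R.
Proof.
move=> N0; have Nr : (0 < N%:R :> R)%R by rewrite ltr0n.
have s01 : (0 <= chi2 x y <= 1)%R by rewrite chi2_ge0 chi2_le1.
have := expr_onem_mul_le (2 * N ^ 2) s01; rewrite natrM natrX.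
have := kernel_le x y N0; have := kernel_ge0 N x y.
move: (kernel N x y) (chi2 x y) s01 => k s /andP[s0 s1] k0.
move: ((1 - s) ^+ _)%R => e ke es.
rewrite ler_pdivlMr//.
have : (k * s <= 8 * N%:R * e * s)%R by rewrite ler_wpM2r.
move=> /(ler_wpM2r (ltW Nr)) /le_trans; apply.
suff -> : (8 * N%:R * e * s * N%:R = 4 * (2 * N%:R ^+ 2 * s * e))%R by lra.
by ring.
Qed.

Lemma mollifyB_sq_le N (f : R -> R) (B : R) (x c : R) : (0 < N)%N ->
  measurable_fun setT f -> (forall y, `|f y| <= B)%R ->
  ((mollify N f x - c) ^+ 2)%:E <= \int[nu]_y ((f y - c) ^+ 2 * kernel N x y)%:E.
Proof.
move=> N0 mf fB.
have fcB y : (`|f y - c| <= B + `|c|)%R.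
  by rewrite (le_trans (ler_normB _ _))// lerD.
have mfc : measurable_fun setT (fun y => f y - c)%R by exact: measurable_funB.
have ik : nu.-integrable setT (EFin \o (fun y => (f y - c) ^+ 2 * kernel N x y)%R).
  apply: (@bounded_integrable_kernel _ _ _ ((B + `|c|) ^+ 2)) => //.
    exact: measurable_funX.
  by move=> h; rewrite normrX lerXn2r// nnegrE (le_trans _ (fcB h)).
rewrite -EFin_Rintegral// lee_fin.
rewrite /mollify -(Rintegral_kernelD _ _ N0 mf fB).
apply: (@jensen_sq _ _ _ (8 * N%:R) (B + `|c|)) => //.
- exact: (@measurable_kernel _ _ _ _ (cst x) id).
- by move=> h; rewrite kernel_ge0 kernel_bound.
- exact: Rintegral_kernel.
Qed.

(** By Jensen the square is at most the average of [(f y - f x)^2], and [kernel_chi2_le] turns the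
    kernel into [(4 / N) / chi2]. The rate [1 / N] is the reason for taking powers of two as scales:
    the bounds become summable. *)
Lemma mollify_L2 N (f : R -> R) (B : R) : (0 < N)%N ->
  measurable_fun setT f -> (forall y, `|f y| <= B)%R ->
  \int[nu]_x ((mollify N f x - f x) ^+ 2)%:E <= (4 / N%:R)%:E * energy f.
Proof.
move=> N0 mf fB.
have mI : measurable_fun setT (fun p : R * R => (f p.1 - f p.2) ^+ 2 / chi2 p.1 p.2)%R.
  by apply: measurable_energy_integrand => //; exact: measurableT_comp mf _.
have mE x : measurable_fun setT (fun y => ((f x - f y) ^+ 2 / chi2 x y)%:E).
  by apply/measurable_EFinP; exact: (@measurable_energy_integrand _ _ _ (cst (f x)) f (cst x) id).
have mE1 : measurable_fun setT (fun x => \int[nu]_y ((f x - f y) ^+ 2 / chi2 x y)%:E).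
  apply: measurable_fun_integral; first exact/measurable_EFinP.
  by move=> x y; rewrite lee_fin energy_integrand_ge0.
have N4 : 0 <= (4 / N%:R)%:E :> \bar R by rewrite lee_fin divr_ge0.
rewrite /energy -ge0_integralZl//; last first.
  by move=> x _; apply: integral_ge0 => y _; rewrite lee_fin energy_integrand_ge0.
apply: ge0_le_integral => //.
- by move=> x _; rewrite lee_fin sqr_ge0.
- apply/measurable_EFinP/measurable_funX/measurable_funB => //.
  exact: measurable_mollify fB.
- by apply: emeasurable_funM => //; exact: measurable_cst.
move=> x _; apply: le_trans (mollifyB_sq_le x (f x) N0 mf fB) _.
rewrite -ge0_integralZl//; last 2 first.
- exact: mE.
- by move=> y _; rewrite lee_fin energy_integrand_ge0.
apply: ge0_le_integral => //.
- by move=> y _; rewrite lee_fin mulr_ge0 ?sqr_ge0 ?kernel_ge0.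
- apply/measurable_EFinP/measurable_funM.
    by apply: measurable_funX; exact: measurable_funB.
  exact: (@measurable_kernel _ _ _ _ (cst x) id).
- by apply: emeasurable_funM; [exact: measurable_cst|exact: mE].
move=> y _; rewrite -EFinM lee_fin.
have [->|xy] := eqVneq x y; first by rewrite subrr expr0n/= !mul0r mulr0.
have c0 : (0 < chi2 x y)%R by rewrite lt_neqAle chi2_ge0 andbT eq_sym chi2_eq0.
rewrite -[(f y - f x)%R]opprB sqrrN [leRHS]mulrCA ler_wpM2l ?sqr_ge0//.
by rewrite ler_pdivlMr// kernel_chi2_le.
Qed.

(** The sum of the series has a finite integral, so it is finite almost everywhere, and the terms of
    a convergent series tend to 0. *)
Lemma ae_cvg0_of_summable (g : nat -> R -> R) (C : R) :
  (forall n, measurable_fun setT (g n)) -> (forall n x, 0 <= g n x)%R ->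
  (forall n, \int[nu]_x (g n x)%:E <= (C / 2 ^+ n)%:E) ->
  {ae nu, forall x, (g ^~ x) @ \oo --> (0%R : R)}.
Proof.
move=> mg g0 gC.
have C0 : (0 <= C)%R.
  have := gC 0%N; rewrite expr0 divr1 => /(le_trans _).
  by rewrite -lee_fin; apply; apply: integral_ge0 => x _; rewrite lee_fin.
pose G x := \sum_(n <oo) (g n x)%:E.
have mgE n : measurable_fun setT (EFin \o g n) by exact/measurable_EFinP.
have intG : \int[nu]_x G x = \sum_(n <oo) \int[nu]_x (g n x)%:E.
  by rewrite integral_nneseries//= => n x _; rewrite lee_fin.
have mG : measurable_fun setT G.
  apply: (@ge0_emeasurable_sum _ _ _ _ (fun n x => (g n x)%:E) xpredT).
    by move=> k x _ _; rewrite lee_fin.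
  by move=> k _; exact: mgE.
have G0 x : 0 <= G x by apply: nneseries_ge0 => n _ _; rewrite lee_fin.
have Gfin : \int[nu]_x G x < +oo.
  rewrite intG; apply: (@le_lt_trans _ _ (\sum_(n <oo) (C / 2 ^+ n)%:E)).
    apply: lee_nneseries => [n _ _|n _]; last exact: gC.
    by apply: integral_ge0 => x _; rewrite lee_fin.
  apply: (@le_lt_trans _ _ (C * 2)%:E); last exact: ltry.
  apply: lime_le.
    by apply: is_cvg_nneseries => n _ _; rewrite lee_fin divr_ge0// exprn_ge0.
  apply: nearW => n; rewrite sumEFin lee_fin.
  suff -> : (\sum_(0 <= i < n) C / 2 ^+ i = C * 2 - C * 2 / 2 ^+ n)%R.
    by rewrite lerBlDr lerDl divr_ge0 ?exprn_ge0// mulr_ge0.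
  elim: n => [|n IH]; first by rewrite big_nil expr0 divr1 subrr.
  by rewrite big_nat_recr//= IH exprS; field; rewrite expf_neq0.
have iG : nu.-integrable setT G.
  apply/integrableP; split; first exact: mG.
  apply: le_lt_trans Gfin; rewrite le_eqVlt; apply/orP; left; apply/eqP.
  by apply: eq_integral => x _; rewrite gee0_abs.
have := integrable_ae measurableT iG.
apply: (@filterS _ _ (ae_filter_ringOfSetsType nu)) => x /(_ I) Gx.
apply: cvg_series_cvg_0.
apply: nondecreasing_is_cvgn.
  by apply: nondecreasing_series => n _ _; exact: g0.
exists (fine (G x)) => _ [n _ <-].
rewrite -lee_fin fineK// /series/= -sumEFin.
by apply: nneseries_lim_ge => k _; rewrite lee_fin.
Qed.

Lemma mollify_ae_cvg (f : R -> R) (B : R) :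
  measurable_fun setT f -> (forall y, `|f y| <= B)%R -> energy f < +oo ->
  {ae nu, forall x, mollify (2 ^ n) f x @[n --> \oo] --> f x}.
Proof.
move=> mf fB fE.
have Ef : energy f \is a fin_num by rewrite ge0_fin_numE// energy_ge0.
have mm n : measurable_fun setT (mollify (2 ^ n) f).
  by apply: (measurable_mollify _ mf fB); rewrite expn_gt0.
have := @ae_cvg0_of_summable (fun n x => (mollify (2 ^ n) f x - f x) ^+ 2)%R
  (4 * fine (energy f))%R.
move=> /(_ _ _ _)/wrap[].
- by move=> n; apply: measurable_funX; exact: measurable_funB.
- by move=> n x; exact: sqr_ge0.
- move=> n; apply: le_trans (mollify_L2 _ mf fB) _; first by rewrite expn_gt0.
  by rewrite -[in leLHS](fineK Ef) -EFinM lee_fin natrX mulrAC.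
apply: (@filterS _ _ (ae_filter_ringOfSetsType nu)) => x h.
apply/cvgrPdist_le => e e0.
move/cvgrPdist_le : h => /(_ (e ^+ 2)%R (exprn_gt0 2 e0)).
apply: filterS => n; rewrite sub0r normrN normrX => h.
by rewrite distrC -(@ler_pXn2r _ 2)// ?nnegrE// ltW.
Qed.

End convergence.

(** * Integrals over pairs of points and Pratt's lemma *)

Section product_measure.
Context {R : realType}.
Local Notation nu := (@circle_measure R).
Local Open Scope ereal_scope.

Lemma circle_tonelli (G : R -> R -> \bar R) :
  measurable_fun setT (fun p : R * R => G p.1 p.2) -> (forall x y, 0 <= G x y) ->
  \int[nu \x nu]_p G p.1 p.2 = \int[nu]_x \int[nu]_y G x y.
Proof.
move=> mG G0.
exact: (@fubini_tonelli1 _ _ (measurableTypeR R) (measurableTypeR R) R nu nu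
  (fun p => G p.1 p.2) mG (fun p => G0 p.1 p.2)).
Qed.

Lemma ae_product (P : R -> Prop) : {ae nu, forall x, P x} ->
  {ae nu \x nu, forall p : R * R, P p.1 /\ P p.2}.
Proof.
move=> [N [mN N0 sN]].
have mT : measurable [set: measurableTypeR R] by [].
exists (N `*` setT `|` setT `*` N); split.
- by apply: measurableU; exact: measurableX.
- rewrite null_set_setU//; try exact: measurableX.
    by transitivity (nu N * nu setT); [exact: product_measure1E|rewrite N0 mul0e].
  by transitivity (nu setT * nu N); [exact: product_measure1E|rewrite N0 mule0].
move=> [x y] /= /not_andP[nP|nP]; [left|right]; split => //=; exact: sN.
Qed.

(* Pratt's form of the dominated convergence theorem, from Fatou's lemma
   applied to T n - a n. *)
Lemma pratt_cvg0 d (X : measurableType d) (m : {measure set X -> \bar R})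
    (a T : nat -> X -> R) (T0 : X -> R) :
  (forall n, measurable_fun setT (a n)) -> (forall n, measurable_fun setT (T n)) ->
  measurable_fun setT T0 ->
  (forall n x, 0 <= a n x <= T n x)%R -> (forall x, 0 <= T0 x)%R ->
  {ae m, forall x, a ^~ x @ \oo --> 0%R} ->
  {ae m, forall x, T ^~ x @ \oo --> T0 x} ->
  (forall n, \int[m]_x (T n x)%:E <= \int[m]_x (T0 x)%:E) ->
  \int[m]_x (T0 x)%:E < +oo ->
  \int[m]_x (a n x)%:E @[n --> \oo] --> 0.
Proof.
move=> ma mT mT0 aT T00 a0 TT0 iT iT0.
have an0 n x : (0 <= a n x)%R by have /andP[] := aT n x.
have Tn0 n x : (0 <= T n x)%R by have /andP[] := aT n x; exact: le_trans.
have iT0f : \int[m]_x (T0 x)%:E \is a fin_num.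
  by rewrite ge0_fin_numE//; apply: integral_ge0 => x _; rewrite lee_fin.
pose b n x := (T n x - a n x)%R.
have b0 n x : (0 <= b n x)%R by rewrite subr_ge0; have /andP[] := aT n x.
have mb n : measurable_fun setT (b n) by exact: measurable_funB.
have := @fatou _ X R m setT measurableT (fun n x => (b n x)%:E).
move=> /(_ _ _)/wrap[].
- by move=> n; apply/measurable_EFinP.
- by move=> n x _; rewrite lee_fin.
have -> : \int[m]_x limn_einf (fun n => (b n x)%:E) = \int[m]_x (T0 x)%:E.
  apply: ge0_ae_eq_integral => //.
  - rewrite /limn_einf; apply: measurableT_comp => //.
    apply: measurable_fun_limn_esup => n; apply: measurableT_comp => //.
    exact/measurable_EFinP.
  - exact/measurable_EFinP.
  - move=> x _; rewrite limn_einf_lim; apply: lime_ge; first exact: is_cvg_einfs.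
    apply: nearW => n; apply: le_ereal_inf_tmp => _ [k _ <-].
    by rewrite lee_fin.
  - by move=> x _; rewrite lee_fin.
  apply: (@filterS2 _ _ (ae_filter_ringOfSetsType m) _ _ _ _ a0 TT0) => x ax Tx _.
  have bx : b ^~ x @ \oo --> T0 x by rewrite -[T0 x]subr0; exact: cvgB.
  have bxE : (EFin \o (b ^~ x)) @ \oo --> (T0 x)%:E.
    by apply/fine_cvgP; split; [exact: nearW|exact: bx].
  by rewrite (cvg_limn_einf_sup bxE).1.
move=> h.
have sumI n : \int[m]_x (b n x)%:E + \int[m]_x (a n x)%:E = \int[m]_x (T n x)%:E.
  rewrite -ge0_integralD//; try exact/measurable_EFinP.
  - by apply: eq_integral => x _; rewrite -EFinD subrK.
  - by move=> x _; rewrite lee_fin.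
  - by move=> x _; rewrite lee_fin.
rewrite limn_einf_lim in h.
have ia0 n : 0 <= \int[m]_x (a n x)%:E by apply: integral_ge0 => x _; rewrite lee_fin.
have ib0 n : 0 <= \int[m]_x (b n x)%:E by apply: integral_ge0 => x _; rewrite lee_fin.
have iaf n : \int[m]_x (a n x)%:E \is a fin_num.
  rewrite ge0_fin_numE// (le_lt_trans _ iT0)// (le_trans _ (iT n))// -sumI.
  by rewrite leeDr.
apply/fine_cvgP; split; first by apply: nearW => n; exact: iaf.
apply/cvgrPdist_le => e e0.
have he : \int[m]_x (T0 x)%:E - e%:E < limn (einfs (fun n => \int[m]_x (b n x)%:E)).
  by apply: lt_le_trans h; rewrite lteBlDr// lteDl.
have limE : limn (einfs (fun n => \int[m]_x (b n x)%:E)) =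
   ereal_sup (range (einfs (fun n => \int[m]_x (b n x)%:E))).
  by apply/cvg_lim => //; exact: cvg_einfs_sup.
rewrite limE in he.
have [_ [k _ <-] hk] := ereal_sup_gt he.
exists k => // n /= kn.
rewrite sub0r normrN ger0_norm ?fine_ge0// -lee_fin fineK//.
have hn : \int[m]_x (T0 x)%:E - e%:E < \int[m]_x (b n x)%:E.
  apply: lt_le_trans hk _.
  by apply: ereal_inf_lbound; exists n.
have ibf : \int[m]_x (b n x)%:E \is a fin_num.
  rewrite ge0_fin_numE// (le_lt_trans _ iT0)// (le_trans _ (iT n))// -sumI.
  by rewrite leeDl.
have := iT n; rewrite -sumI.
move: hn (iT0f) ibf (iaf n).
move: (\int[m]_x (T0 x)%:E) (\int[m]_x (b n x)%:E) (\int[m]_x (a n x)%:E).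
by move=> [u||]// [v||]// [w||]//; rewrite -EFinB -EFinD !lee_fin lte_fin => uv _ _ _ ?; lra.
Qed.

End product_measure.

(** * Vanishing mean oscillation *)

Section vmo.
Context {R : realType}.
Local Notation nu := (@circle_measure R).

(** Each power is written as a square [A^2]. With [u = N^2 chi2 x y], Bernoulli's bound gives
    [u A^2 <= 1/2] for the linear terms ([h1]) and [u A <= 1] for the quadratic ones ([h2]). After
    [chi2 y z <= 2 (a + b)] there remains [128 + 256 * 4 = 1152]. The factor [1 + N^2 chi2 y z] is
    what makes [vmo_mass] tend to 0 rather than stay bounded. *)
Lemma kernel_pair_le N (x y z : R) : (0 < N)%N ->
  kernel N x y * kernel N x z * (chi2 y z * (1 + N%:R ^+ 2 * chi2 y z)) <= 1152.
Proof.
move=> N0; have n0 : 0 < N%:R :> R by rewrite ltr0n.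
have sab := chi2_triangle x y z; have s0 := chi2_ge0 y z.
have a01 : 0 <= chi2 x y <= 1 by rewrite chi2_ge0 chi2_le1.
have b01 : 0 <= chi2 x z <= 1 by rewrite chi2_ge0 chi2_le1.
have := expr_onem_mul_le (2 * N ^ 2) a01; rewrite natrM natrX.
have := expr_onem_mul_le (2 * N ^ 2) b01; rewrite natrM natrX.
have := expr_onem_mul_le (N ^ 2) a01; rewrite natrX.
have := expr_onem_mul_le (N ^ 2) b01; rewrite natrX.
have := onem_chi2X_le1 x y (2 * N ^ 2); have := onem_chi2X_le1 x z (2 * N ^ 2).
have := onem_chi2X_ge0 x y (2 * N ^ 2); have := onem_chi2X_ge0 x z (2 * N ^ 2).
have := onem_chi2X_ge0 x y (N ^ 2); have := onem_chi2X_ge0 x z (N ^ 2).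
have := kernel_le x y N0; have := kernel_ge0 N x y.
have := kernel_le x z N0; have := kernel_ge0 N x z.
have -> : (1 - chi2 x y) ^+ (2 * N ^ 2) = ((1 - chi2 x y) ^+ (N ^ 2)) ^+ 2.
  by rewrite -exprM mulnC.
have -> : (1 - chi2 x z) ^+ (2 * N ^ 2) = ((1 - chi2 x z) ^+ (N ^ 2)) ^+ 2.
  by rewrite -exprM mulnC.
move: (kernel N x y) (kernel N x z) => k k'.
move: ((1 - chi2 x y) ^+ (N ^ 2)) ((1 - chi2 x z) ^+ (N ^ 2)) => A B.
move: sab s0 a01 b01; move: (chi2 x y) (chi2 x z) (chi2 y z) => a b s.
move: (N%:R : R) n0 => n n0 sab s0 /andP[a0 a1] /andP[b0 b1].
move=> k'0 k'B k0 kA B0 A0 B20 A20 B21 A21 vB uA vB2 uA2.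
set u := n ^+ 2 * a in uA *; set v := n ^+ 2 * b in vB *.
have n20 : 0 < n ^+ 2 by rewrite exprn_gt0.
have u0 : 0 <= u by rewrite mulr_ge0// ltW.
have v0 : 0 <= v by rewrite mulr_ge0// ltW.
have kk : k * k' <= 64 * n ^+ 2 * (A ^+ 2 * B ^+ 2).
  suff -> : 64 * n ^+ 2 * (A ^+ 2 * B ^+ 2) = 8 * n * A ^+ 2 * (8 * n * B ^+ 2).
    by rewrite ler_pM.
  by ring.
have ss : s * (1 + n ^+ 2 * s) <= 2 * (a + b) * (1 + 2 * (u + v)).
  rewrite ler_pM//.
    by rewrite addr_ge0// mulr_ge0// ltW.
  rewrite lerD2l /u /v -mulrDr mulrCA ler_wpM2l// ltW//.
have h1 : (u + v) * (A ^+ 2 * B ^+ 2) <= 1.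
  have : u * A ^+ 2 <= 2^-1 by move: uA2; rewrite -(mulrA 2) -/u -(mulrA 2); lra.
  have : v * B ^+ 2 <= 2^-1 by move: vB2; rewrite -(mulrA 2) -/v -(mulrA 2); lra.
  move=> e1 e2.
  have : u * A ^+ 2 * B ^+ 2 <= 2^-1.
    by apply: le_trans e2; rewrite -[leRHS]mulr1 ler_wpM2l// mulr_ge0.
  have : v * B ^+ 2 * A ^+ 2 <= 2^-1.
    by apply: le_trans e1; rewrite -[leRHS]mulr1 ler_wpM2l// mulr_ge0.
  lra.
have h2 : (u + v) ^+ 2 * (A ^+ 2 * B ^+ 2) <= 4.
  have e1 : (u * A) ^+ 2 <= 1 by rewrite exprn_ile1// mulr_ge0.
  have e2 : (v * B) ^+ 2 <= 1 by rewrite exprn_ile1// mulr_ge0.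
  have f1 : (u * A) ^+ 2 * B ^+ 2 <= 1.
    by apply: le_trans e1; rewrite -[leRHS]mulr1 ler_wpM2l// sqr_ge0.
  have f2 : (v * B) ^+ 2 * A ^+ 2 <= 1.
    by apply: le_trans e2; rewrite -[leRHS]mulr1 ler_wpM2l// sqr_ge0.
  have : (u + v) ^+ 2 * (A ^+ 2 * B ^+ 2) + (u - v) ^+ 2 * (A ^+ 2 * B ^+ 2) =
    2 * ((u * A) ^+ 2 * B ^+ 2) + 2 * ((v * B) ^+ 2 * A ^+ 2) by ring.
  have : 0 <= (u - v) ^+ 2 * (A ^+ 2 * B ^+ 2) by rewrite mulr_ge0 ?sqr_ge0// mulr_ge0.
  lra.
apply: (@le_trans _ _ (64 * n ^+ 2 * (A ^+ 2 * B ^+ 2) * (2 * (a + b) * (1 + 2 * (u + v))))).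
  by rewrite ler_pM// ?mulr_ge0// addr_ge0// mulr_ge0// ltW.
have -> : 64 * n ^+ 2 * (A ^+ 2 * B ^+ 2) * (2 * (a + b) * (1 + 2 * (u + v))) =
  128 * ((u + v) * (A ^+ 2 * B ^+ 2)) + 256 * ((u + v) ^+ 2 * (A ^+ 2 * B ^+ 2)).
  by rewrite /u /v; ring.
lra.
Qed.

Context (I : finType) (f : I -> R -> R) (B : R).
Hypothesis mf : forall c, measurable_fun setT (f c).
Hypothesis fB : forall c y, `|f c y| <= B.
Hypothesis fE : forall c, (energy (f c) < +oo)%E.

Let S (y z : R) : R := \sum_c (f c y - f c z) ^+ 2.

Let S0 y z : 0 <= S y z.
Proof. by apply: sumr_ge0 => c _; exact: sqr_ge0. Qed.

Let mS d (T : measurableType d) (u v : T -> R) :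
  measurable_fun setT u -> measurable_fun setT v ->
  measurable_fun setT (fun p => S (u p) (v p)).
Proof.
move=> mu mv; apply: measurable_sum => c; apply: measurable_funX.
by apply: measurable_funB; exact: measurableT_comp.
Qed.

(** By [kernel_pair_le] this majorizes [S y z * kernel N x y * kernel N x z] for every centre [x] at
    once, so that closeness derived from it is uniform in [x]. *)
Definition vmo_integrand (N : nat) (y z : R) : R :=
  1152 * (S y z / chi2 y z) / (1 + N%:R ^+ 2 * chi2 y z).

Definition vmo_mass N : \bar R :=
  (\int[nu]_z \int[nu]_y (vmo_integrand N y z)%:E)%E.

Let W0 N (y z : R) : 0 < 1 + N%:R ^+ 2 * chi2 y z.
Proof. by rewrite ltr_wpDr// mulr_ge0 ?sqr_ge0 ?chi2_ge0. Qed.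

Lemma vmo_integrand_ge0 N y z : 0 <= vmo_integrand N y z.
Proof.
apply: divr_ge0; last exact/ltW/W0.
apply: mulr_ge0; first exact: ler0n.
by apply: divr_ge0; [exact: S0|exact: chi2_ge0].
Qed.

Lemma measurable_vmo_integrand N d (T : measurableType d) (u v : T -> R) :
  measurable_fun setT u -> measurable_fun setT v ->
  measurable_fun setT (fun p => vmo_integrand N (u p) (v p)).
Proof.
move=> mu mv; apply: measurable_funM.
  apply: measurable_funM; first exact: measurable_cst.
  apply: measurable_funM; first exact: mS.
  by apply: measurable_fun_inv; exact: measurable_fun_chi2.
apply: measurable_fun_inv; apply: measurable_funD => //; apply: measurable_funM => //.
exact: measurable_fun_chi2.
Qed.

(* If no value of the family were close to the average, the average of the
   squared distances would exceed vmo_mass. *)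
Lemma mollify_close N (x delta : R) : (0 < N)%N -> (vmo_mass N < delta%:E)%E ->
  exists z, forall c, (mollify N (f c) x - f c z) ^+ 2 <= delta.
Proof.
move=> N0 Nd; apply/not_existsP => h.
have d0 : 0 <= delta.
  rewrite -lee_fin; apply: le_trans (ltW Nd); apply: integral_ge0 => z _.
  by apply: integral_ge0 => y _; rewrite lee_fin vmo_integrand_ge0.
have mk : measurable_fun setT (kernel N x) by exact: (@measurable_kernel _ _ _ _ (cst x) id).
have mSz z : measurable_fun setT (fun y => (S y z * kernel N x y)%:E).
  apply/measurable_EFinP/measurable_funM => //.
  exact: (@mS _ _ id (cst z)).
have dI z : (delta%:E <= \int[nu]_y (S y z * kernel N x y)%:E)%E.
  have /existsNP[c /negP] := h z; rewrite -ltNge -lte_fin => /ltW /le_trans; apply.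
  apply: le_trans (mollifyB_sq_le _ _ N0 (mf c) (fB c)) _.
  apply: ge0_le_integral => //.
  - by move=> y _; rewrite lee_fin mulr_ge0 ?sqr_ge0 ?kernel_ge0.
  - apply/measurable_EFinP/measurable_funM => //.
    apply: measurable_funX; apply: (measurable_funB (mf c)); exact: measurable_cst.
  - exact: mSz.
  - move=> y _; rewrite lee_fin ler_wpM2r ?kernel_ge0// /S (bigD1 c)//= lerDl.
    by apply: sumr_ge0 => i _; exact: sqr_ge0.
have mI : measurable_fun setT (fun z => \int[nu]_y (S y z * kernel N x y)%:E)%E.
  apply: (@measurable_fun_integral _ _ _ (fun z y => (S y z * kernel N x y)%:E)).
    apply/measurable_EFinP/measurable_funM.
      exact: (mS measurable_snd measurable_fst).
    exact: (measurableT_comp mk measurable_snd).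
  by move=> z y; rewrite lee_fin mulr_ge0 ?kernel_ge0.
have I0 z : (0 <= \int[nu]_y (S y z * kernel N x y)%:E)%E.
  by apply: integral_ge0 => y _; rewrite lee_fin mulr_ge0 ?kernel_ge0.
suff : (delta%:E <= vmo_mass N)%E by rewrite leNgt Nd.
apply: (@le_trans _ _ (\int[nu]_z (delta%:E * (kernel N x z)%:E))%E).
  rewrite ge0_integralZl//.
  - by rewrite -EFin_Rintegral ?integrable_kernel// Rintegral_kernel// mule1.
  - exact/measurable_EFinP.
  - by move=> z _; rewrite lee_fin kernel_ge0.
apply: ge0_le_integral => //.
- by move=> z _; rewrite mule_ge0// lee_fin kernel_ge0.
- by apply: emeasurable_funM => //; exact/measurable_EFinP.
- apply: (@measurable_fun_integral _ _ _ (fun z y => (vmo_integrand N y z)%:E)).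
    by apply/measurable_EFinP; exact: measurable_vmo_integrand.
  by move=> z y; rewrite lee_fin vmo_integrand_ge0.
move=> z _.
apply: (@le_trans _ _ (\int[nu]_y (S y z * kernel N x y)%:E * (kernel N x z)%:E)%E).
  by rewrite lee_wpmul2r// lee_fin kernel_ge0.
rewrite -ge0_integralZr//; last 3 first.
- exact: mSz.
- by move=> y _; rewrite lee_fin mulr_ge0 ?kernel_ge0.
- by rewrite lee_fin kernel_ge0.
apply: ge0_le_integral => //.
- move=> y _; rewrite -EFinM lee_fin; apply: mulr_ge0; last exact: kernel_ge0.
  by apply: mulr_ge0; [exact: S0|exact: kernel_ge0].
- by apply: emeasurable_funM; [exact: mSz|exact: measurable_cst].
- by apply/measurable_EFinP; exact: (@measurable_vmo_integrand _ _ _ id (cst z)).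
move=> y _; rewrite -EFinM lee_fin /vmo_integrand.
have [->|yz] := eqVneq y z.
  have -> : S z z = 0 by rewrite /S big1// => c _; rewrite subrr expr0n.
  by rewrite !(mul0r, mulr0).
have c0 : 0 < chi2 y z by rewrite lt_neqAle chi2_ge0 andbT eq_sym chi2_eq0.
have -> : 1152 * (S y z / chi2 y z) / (1 + N%:R ^+ 2 * chi2 y z) =
    S y z * (1152 / (chi2 y z * (1 + N%:R ^+ 2 * chi2 y z))).
  by field; rewrite !gt_eqF.
rewrite -mulrA; apply: ler_wpM2l; first exact: S0.
rewrite ler_pdivlMr; last by rewrite mulr_gt0.
exact: kernel_pair_le.
Qed.

(** Without its last denominator the integrand is 1152 times the energy densities of the family, an
    integrable majorant; off the diagonal that denominator tends to infinity. *)
Lemma vmo_mass_cvg0 : vmo_mass (2 ^ n) @[n --> \oo] --> 0%E.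
Proof.
pose g (p : R * R) := (1152 * (S p.2 p.1 / chi2 p.2 p.1))%:E.
have mg1 : measurable_fun setT (fun p : R * R => 1152 * (S p.2 p.1 / chi2 p.2 p.1)).
  apply: measurable_funM; first exact: measurable_cst.
  apply: measurable_funM; first exact: (mS measurable_snd measurable_fst).
  apply: measurable_fun_inv; exact: (measurable_fun_chi2 measurable_snd measurable_fst).
have mg : measurable_fun setT g by exact/measurable_EFinP.
have g0 p : (0 <= g p)%E by rewrite lee_fin mulr_ge0 ?ler0n// divr_ge0 ?chi2_ge0.
have mE c : measurable_fun setT (fun p : R * R => (f c p.1 - f c p.2) ^+ 2 / chi2 p.1 p.2).
  by apply: measurable_energy_integrand => //; exact: measurableT_comp (mf c) _.
have mE1 c x : measurable_fun setT (fun y => ((f c x - f c y) ^+ 2 / chi2 x y)%:E).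
  apply/measurable_EFinP.
  exact: (@measurable_energy_integrand _ _ _ (cst (f c x)) (f c) (cst x) id).
have E0 c x y : (0 <= ((f c x - f c y) ^+ 2 / chi2 x y)%:E)%E.
  by rewrite lee_fin energy_integrand_ge0.
have mE2 c : measurable_fun setT (fun x => \int[nu]_y ((f c x - f c y) ^+ 2 / chi2 x y)%:E)%E.
  by apply: measurable_fun_integral => //; exact/measurable_EFinP.
have gfin : (\int[nu]_z \int[nu]_y g (z, y) < +oo)%E.
  rewrite (_ : (\int[nu]_z _)%E = (1152%:E * \sum_c energy (f c))%E); last first.
    rewrite -ge0_integral_sum//; last first.
      by move=> c x _; apply: integral_ge0.
    rewrite -ge0_integralZl ?lee_fin ?ler0n//; last 2 first.
    - by apply: emeasurable_sum => c _; exact: mE2.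
    - by move=> x _; apply: sume_ge0 => c _; apply: integral_ge0.
    apply: eq_integral => x _.
    rewrite -ge0_integral_sum//; last by move=> c; exact: mE1.
    rewrite -ge0_integralZl ?lee_fin ?ler0n//; last 2 first.
    - by apply: emeasurable_sum => c _; exact: mE1.
    - by move=> y _; apply: sume_ge0.
    apply: eq_integral => y _; rewrite /g/= sumEFin -EFinM; congr (1152 * _)%:E.
    rewrite /S mulr_suml; apply: eq_bigr => c _.
    by rewrite chi2C -[f c y - f c x]opprB sqrrN.
  rewrite lte_mul_pinfty ?lee_fin ?ler0n//.
  by apply: lte_sum_pinfty => c _; exact: fE.
have ig : (nu \x nu)%E.-integrable setT g.
  apply/integrableP; split; first exact: mg.
  apply: le_lt_trans gfin.
  rewrite -(circle_tonelli (G := fun z y => g (z, y)))//.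
  rewrite le_eqVlt; apply/orP; left; apply/eqP; apply: eq_integral => -[x y] _.
  by rewrite gee0_abs.
have mf_ n : measurable_fun setT (fun p : R * R => (vmo_integrand (2 ^ n) p.2 p.1)%:E).
  by apply/measurable_EFinP; exact: measurable_vmo_integrand.
have := @dominated_convergence _ (measurableTypeR R * measurableTypeR R)%type R
  (nu \x nu)%E setT measurableT
  (fun n p => (vmo_integrand (2 ^ n) p.2 p.1)%:E) (cst 0%E) g mf_ (measurable_cst _) _ ig.
case.
- apply: aeW => -[z y] _ /=.
  have [->|yz] := eqVneq y z.
    apply: cvg_near_cst; apply: nearW => n.
    have Sz : S z z = 0 by rewrite /S big1// => c _; rewrite subrr expr0n.
    by rewrite /vmo_integrand Sz !(mul0r, mulr0).
  apply/fine_cvgP; split; first exact: nearW.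
  suff : (fun n => vmo_integrand (2 ^ n) y z) @ \oo --> (0 : R) by [].
  have c0 : 0 < chi2 y z by rewrite lt_neqAle chi2_ge0 andbT eq_sym chi2_eq0.
  set a := 1152 * (S y z / chi2 y z).
  have a0 : 0 <= a by rewrite mulr_ge0 ?ler0n// divr_ge0 ?chi2_ge0.
  apply: (@squeeze_cvgr _ _ _ _ (cst 0) (geometric (a / chi2 y z) 2^-1)).
  - apply: nearW => n; rewrite /= vmo_integrand_ge0/= /vmo_integrand -/a.
    have -> : a / chi2 y z * 2^-1 ^+ n = a / (2 ^+ n * chi2 y z).
      by rewrite exprVn [in RHS]invfM [RHS]mulrA mulrAC.
    apply: ler_wpM2l; first exact: a0.
    have p2 : 0 < 2 ^+ n * chi2 y z :> R by apply: mulr_gt0 => //; exact: exprn_gt0.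
    rewrite lef_pV2 ?posrE//.
    rewrite natrX -[leLHS]add0r lerD// ler_wpM2r// ?(ltW c0)//.
    by rewrite -exprM ler_weXn2l// ?ler1n// leq_pmulr.
  - exact: cvg_cst.
  - by apply: cvg_geometric; rewrite ger0_norm// invf_lt1// ltr1n.
- apply: aeW => -[z y] n _; rewrite gee0_abs ?lee_fin ?vmo_integrand_ge0//.
  rewrite /vmo_integrand ler_pdivrMr; last exact: W0.
  rewrite -[leLHS]mulr1; apply: ler_wpM2l; first by have := g0 (z, y); rewrite lee_fin.
  by rewrite lerDl mulr_ge0 ?sqr_ge0 ?chi2_ge0.
move=> _ _; rewrite integral0.
apply: cvg_trans; apply: near_eq_cvg; apply: nearW => n.
have E : (\int[nu \x nu]_p (vmo_integrand (2 ^ n) p.2 p.1)%:E)%E = vmo_mass (2 ^ n).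
  apply: (circle_tonelli (G := fun z y => (vmo_integrand (2 ^ n) y z)%:E)).
    exact: mf_.
  by move=> x y; rewrite lee_fin vmo_integrand_ge0.
by first [exact: E|exact: esym E].
Qed.

End vmo.

(** * Rationality of the averages *)

Section mollify_rational.
Context {R : realType}.
Local Notation nu := (@circle_measure R).

Lemma Rintegral_sum_ord n (g : 'I_n -> R -> R) :
  (forall k, nu.-integrable setT (EFin \o g k)) ->
  \int[nu]_y (\sum_(k < n) g k y) = \sum_(k < n) \int[nu]_y g k y.
Proof.
move=> ig.
suff [] : nu.-integrable setT (EFin \o (fun y => \sum_(k < n) g k y)) /\
  \int[nu]_y (\sum_(k < n) g k y) = \sum_(k < n) \int[nu]_y g k y by [].
elim: n g ig => [|n IH] g ig.
  under eq_Rintegral do rewrite big_ord0.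
  have -> : (fun y => \sum_(k < 0) g k y) = cst 0.
    by apply/funext => y; rewrite big_ord0.
  rewrite big_ord0 Rintegral_cst ?mul0r//; split => //.
  by apply: (@bounded_integrable _ _ 0) => // y; rewrite normr0.
have [i1 i2] := IH (fun k => g (widen_ord (leqnSn n) k)) (fun k => ig _).
have -> : (fun y => \sum_(k < n.+1) g k y) = (fun y =>
    \sum_(k < n) g (widen_ord (leqnSn n) k) y + g ord_max y).
  by apply/funext => y; rewrite big_ord_recr.
split; first exact: (integrableD measurableT i1 (ig _)).
by rewrite RintegralD// i2 big_ord_recr.
Qed.

(** The kernel is [(1 + x y)^(2 M)] over powers of [1 + x^2] and [1 + y^2], and the binomial formula
    separates the variables. The coefficients are moments of [f], finite because
    [|y|^k <= (1 + y^2)^M] for [k <= 2 M]. *)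
Lemma mollify_rational N (f : R -> R) (B : R) : (0 < N)%N ->
  measurable_fun setT f -> (forall y, `|f y| <= B) ->
  exists p : {poly R}, forall x, mollify N f x = p.[x] / (1 + x ^+ 2) ^+ (2 * N ^ 2).
Proof.
move=> N0 mf fB; set M := (2 * N ^ 2)%N.
pose h (k : 'I_(2 * M).+1) (y : R) : R :=
  f y * (y ^+ k / (1 + y ^+ 2) ^+ M / kernel_mass N).
have hB k y : `|h k y| <= B * (kernel_mass N)^-1.
  rewrite normrM ler_pM// normrM [X in _ * X]ger0_norm; last first.
    by rewrite invr_ge0 ltW// kernel_mass_gt0.
  rewrite -[leRHS]mul1r ler_wpM2r//; first by rewrite invr_ge0 ltW// kernel_mass_gt0.
  have Y := onesq_gt0 y.
  rewrite normrM [X in _ * X]ger0_norm ?invr_ge0 ?exprn_ge0 ?(ltW Y)//.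
  rewrite ler_pdivrMr ?exprn_gt0// mul1r normrX.
  have [y1|y1] := leP `|y| 1.
    apply: (@le_trans _ _ 1); first by rewrite exprn_ile1.
    by rewrite exprn_ege1// lerDl sqr_ge0.
  apply: (@le_trans _ _ (`|y| ^+ (2 * M))).
    by rewrite ler_weXn2l ?ltW// -ltnS.
  rewrite exprM lerXn2r ?nnegrE ?sqr_ge0 ?(ltW Y)//.
  by rewrite real_normK ?num_real// lerDr.
have ih k : nu.-integrable setT (EFin \o h k).
  apply: bounded_integrable (hB k).
  apply: measurable_funM => //; apply: measurable_funM => //.
  apply: measurable_funM; first exact: measurable_funX.
  apply: measurable_fun_inv; apply: measurable_funX; apply: measurable_funD => //.
exists (\poly_(k < (2 * M).+1) ('C(2 * M, k)%:R * \int[nu]_y h (inord k) y)) => x.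
rewrite horner_poly mulr_suml.
have E y : f y * kernel N x y = \sum_(k < (2 * M).+1)
    ('C(2 * M, k)%:R * x ^+ k / (1 + x ^+ 2) ^+ M) * h k y.
  rewrite /kernel -/M onem_chi2 expr_div_n -exprM [((1 + _) * _) ^+ M]exprMn exprDn.
  rewrite mulr_suml mulr_suml mulr_sumr.
  apply: eq_bigr => k _; rewrite expr1n mul1r exprMn /h -mulr_natl.
  by field; rewrite !expf_neq0 ?onesq_neq0// gt_eqF// kernel_mass_gt0.
rewrite /mollify.
under eq_Rintegral do rewrite E.
rewrite Rintegral_sum_ord; last first.
  by move=> k; exact: (integrableZl measurableT _ (ih k)).
apply: eq_bigr => k _; rewrite RintegralZl//.
by rewrite inord_val; ring.
Qed.

End mollify_rational.

(** * Rational functions and chordal Lipschitz bounds *)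

Section complex_norm.
Context {R : realType}.
Implicit Types z w : R[i].

(** Replaces the modulus: it is real-valued and submultiplicative, and estimates on it reduce to
    arithmetic in real and imaginary parts. *)
Definition n1 z : R := `|complex.Re z| + `|complex.Im z|.

Lemma n1_ge0 z : 0 <= n1 z. Proof. exact: addr_ge0. Qed.

Lemma n1_0 : n1 0 = 0. Proof. by rewrite /n1/= !normr0 addr0. Qed.

Lemma n1N z : n1 (- z) = n1 z.
Proof. by case: z => a b; rewrite /n1/= !normrN. Qed.

Lemma n1B z w : n1 (z - w) = n1 (w - z). Proof. by rewrite -n1N opprB. Qed.

Lemma n1D z w : n1 (z + w) <= n1 z + n1 w.
Proof.
case: z w => a b [c d]; rewrite /n1/=.
by rewrite addrACA lerD// ler_normD.
Qed.

Lemma n1BD z w : n1 (z - w) <= n1 z + n1 w.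
Proof. by rewrite -(n1N w) n1D. Qed.

Lemma n1M z w : n1 (z * w) <= n1 z * n1 w.
Proof.
case: z w => a b [c d]; rewrite /n1/=.
rewrite mulrDl !mulrDr -!normrM addrACA.
have := ler_normB (a * c) (b * d); have := ler_normD (a * d) (b * c); lra.
Qed.

Lemma n1_conj z : n1 z^*%C = n1 z.
Proof. by case: z => a b; rewrite /n1/= normrN. Qed.

Lemma n1_eq0 z : (n1 z == 0) = (z == 0).
Proof.
by case: z => a b; rewrite /n1/= paddr_eq0// !normr_eq0 eq_complex.
Qed.

Lemma n1_real (a : R) : n1 a%:C = `|a|.
Proof. by rewrite /n1/= normr0 addr0. Qed.

Lemma n1_le_Re z : `|complex.Re z| <= n1 z. Proof. by rewrite lerDl. Qed.

Lemma n1_le_Im z : `|complex.Im z| <= n1 z. Proof. by rewrite lerDr. Qed.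

Lemma n1_sum I (r : seq I) (P : pred I) (F : I -> R[i]) :
  n1 (\sum_(i <- r | P i) F i) <= \sum_(i <- r | P i) n1 (F i).
Proof.
elim/big_rec2 : _ => [|i x y _ h]; first by rewrite n1_0.
by apply: le_trans (n1D _ _) _; rewrite lerD2l.
Qed.

Lemma n1V z : z != 0 -> n1 z^-1 <= 2 / n1 z.
Proof.
move=> z0; have n0 : 0 < n1 z by rewrite lt_neqAle n1_ge0 andbT eq_sym n1_eq0.
rewrite ler_pdivlMr//.
case: z z0 n0 => a b z0 n0; rewrite /n1/=.
have s0 : 0 < a ^+ 2 + b ^+ 2.
  move: z0; rewrite eq_complex/= negb_and => /orP[h|h].
    by rewrite ltr_pwDl ?sqr_ge0// exprn_even_gt0.
  by rewrite ltr_wpDl ?sqr_ge0// exprn_even_gt0.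
rewrite normrN !normrM normfV (ger0_norm (ltW s0)) -mulrDl mulrAC.
rewrite ler_pdivrMr//.
have := sqr_ge0 (`|a| - `|b|); have := real_normK (num_real a); have := real_normK (num_real b).
nra.
Qed.

End complex_norm.

Section nice.
Context {R : realType}.
Implicit Types (f g : R -> R[i]) (x y K : R).

Definition chi x y : R := Num.sqrt (chi2 x y).

Lemma chi_ge0 x y : 0 <= chi x y. Proof. exact: sqrtr_ge0. Qed.

(** A chordal Lipschitz bound reaches infinity: such functions extend continuously to the circle. A
    single constant for size and variation makes the class closed under sums, products, conjugation
    and inversion away from 0. *)
Definition nice K f := (forall x, n1 (f x) <= K) /\
  forall x y, n1 (f x - f y) <= K * chi x y.

Lemma nice_ge0 K f : nice K f -> 0 <= K.
Proof. by move=> [/(_ 0) + _]; apply: le_trans; exact: n1_ge0. Qed.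

Lemma nice_le K K' f : K <= K' -> nice K f -> nice K' f.
Proof.
move=> KK' [f1 f2]; split=> [x|x y]; first exact: le_trans (f1 x) KK'.
by apply: le_trans (f2 x y) _; rewrite ler_wpM2r// chi_ge0.
Qed.

Lemma nice_ext K f g : f =1 g -> nice K f -> nice K g.
Proof. by move=> /funext ->. Qed.

Lemma nice_cst (c : R[i]) : nice (n1 c) (fun=> c).
Proof.
by split=> [//|x y]; rewrite subrr n1_0 mulr_ge0 ?chi_ge0 ?n1_ge0.
Qed.

Lemma niceD K K' f g : nice K f -> nice K' g -> nice (K + K') (fun x => f x + g x).
Proof.
move=> [f1 f2] [g1 g2]; split=> [x|x y].
  by apply: le_trans (n1D _ _) _; rewrite lerD.
rewrite opprD addrACA; apply: le_trans (n1D _ _) _.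
by rewrite mulrDl lerD.
Qed.

Lemma niceM K K' f g : nice K f -> nice K' g -> nice (2 * K * K') (fun x => f x * g x).
Proof.
move=> nf ng; have K0 := nice_ge0 nf; have K'0 := nice_ge0 ng.
case: nf ng => [f1 f2] [g1 g2]; split=> [x|x y].
  apply: le_trans (n1M _ _) _; apply: (@le_trans _ _ (K * K')).
    by rewrite ler_pM ?n1_ge0.
  by rewrite -mulrA ler_peMl ?mulr_ge0// ler1n.
have -> : f x * g x - f y * g y = (f x - f y) * g x + f y * (g x - g y) by ring.
apply: le_trans (n1D _ _) _.
have -> : 2 * K * K' * chi x y = K * chi x y * K' + K * (K' * chi x y) by ring.
by rewrite lerD//; apply: le_trans (n1M _ _) _; rewrite ler_pM ?n1_ge0.
Qed.

Lemma niceN K f : nice K f -> nice K (fun x => - f x).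
Proof.
move=> [f1 f2]; split=> [x|x y]; first by rewrite n1N.
by rewrite -opprD n1N.
Qed.

Lemma nice_conj K f : nice K f -> nice K (fun x => (f x)^*%C).
Proof.
move=> [f1 f2]; split=> [x|x y]; first by rewrite n1_conj.
by rewrite -rmorphB/= n1_conj.
Qed.

Lemma niceV K f (c : R) : 0 < c -> (forall x, c <= n1 (f x)) ->
  nice K f -> nice (2 / c + 4 * K / c ^+ 2) (fun x => (f x)^-1).
Proof.
move=> c0 cf nf; have K0 := nice_ge0 nf; case: nf => [f1 f2].
have fn0 x : f x != 0 by rewrite -n1_eq0 gt_eqF// (lt_le_trans c0).
have V x : n1 (f x)^-1 <= 2 / c.
  apply: le_trans (n1V (fn0 x)) _.
  by rewrite ler_wpM2l// lef_pV2 ?posrE// (lt_le_trans c0).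
have p1 : 0 <= 4 * K / c ^+ 2.
  by apply: divr_ge0; [exact: mulr_ge0|exact: sqr_ge0].
have p2 : 0 <= 2 / c by apply: divr_ge0 => //; exact: ltW.
split=> [x|x y]; first by rewrite (le_trans (V x))// lerDl.
have -> : (f x)^-1 - (f y)^-1 = (f x)^-1 * (f y)^-1 * (f y - f x).
  by field; rewrite !fn0.
apply: (@le_trans _ _ (4 * K / c ^+ 2 * chi x y)); last first.
  by rewrite ler_wpM2r ?chi_ge0// lerDr.
have -> : 4 * K / c ^+ 2 * chi x y = (2 / c) * (2 / c) * (K * chi x y).
  by field; rewrite gt_eqF.
apply: le_trans (n1M _ _) _; rewrite ler_pM ?n1_ge0//; last by rewrite n1B.
by apply: le_trans (n1M _ _) _; rewrite ler_pM ?n1_ge0.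
Qed.

Definition rational_fun f := exists p q : {poly R[i]},
  forall x : R, q.[x%:C] != 0 /\ f x = p.[x%:C] / q.[x%:C].

Lemma rational_ext f g : f =1 g -> rational_fun f -> rational_fun g.
Proof. by move=> /funext ->. Qed.

Lemma rational_cst (c : R[i]) : rational_fun (fun=> c).
Proof.
by exists c%:P, 1 => x; rewrite !hornerE divr1 oner_neq0.
Qed.

Lemma rationalD f g : rational_fun f -> rational_fun g ->
  rational_fun (fun x => f x + g x).
Proof.
move=> [p [q pq]] [p' [q' pq']]; exists (p * q' + p' * q), (q * q') => x.
have [q0 ->] := pq x; have [q'0 ->] := pq' x.
rewrite !hornerE mulf_neq0//; split => //.
by field; rewrite q0 q'0.
Qed.

Lemma rationalM f g : rational_fun f -> rational_fun g ->
  rational_fun (fun x => f x * g x).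
Proof.
move=> [p [q pq]] [p' [q' pq']]; exists (p * p'), (q * q') => x.
have [q0 ->] := pq x; have [q'0 ->] := pq' x.
by rewrite !hornerM mulf_neq0//; split => //; rewrite mulf_div.
Qed.

Lemma rationalN f : rational_fun f -> rational_fun (fun x => - f x).
Proof.
move=> [p [q pq]]; exists (- p), q => x.
by have [q0 ->] := pq x; rewrite !hornerE mulNr.
Qed.

Lemma rationalV f : (forall x, f x != 0) -> rational_fun f ->
  rational_fun (fun x => (f x)^-1).
Proof.
move=> f0 [p [q pq]]; exists q, p => x.
have [q0 fE] := pq x; split; last by rewrite fE invf_div.
by apply: contraNneq (f0 x) => p0; rewrite fE p0 mul0r.
Qed.

Lemma rational_conj f : rational_fun f -> rational_fun (fun x => (f x)^*%C).
Proof.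
move=> [p [q pq]].
have E (r : {poly R[i]}) (x : R) :
    (map_poly (@conjc R) r).[x%:C] = (r.[x%:C])^*%C.
  by rewrite -[x%:C in LHS]conjc_real horner_map.
exists (map_poly (@conjc R) p), (map_poly (@conjc R) q) => x.
have [q0 ->] := pq x; rewrite !E; split; first by rewrite conjc_eq0.
by rewrite -fmorph_div.
Qed.

End nice.

(** * Rational functions near infinity *)

Section bounded_rational.
Context {R : realType}.
Implicit Types (f g : R -> R[i]) (x y K : R).

Definition bnice f := exists K, nice K f.

Lemma bnice_ext f g : f =1 g -> bnice f -> bnice g.
Proof. by move=> /funext ->. Qed.

Lemma bnice_cst (c : R[i]) : bnice (fun=> c).
Proof. by exists (n1 c); exact: nice_cst. Qed.

Lemma bniceD f g : bnice f -> bnice g -> bnice (fun x => f x + g x).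
Proof. by move=> [K fK] [K' gK']; exists (K + K'); exact: niceD. Qed.

Lemma bniceM f g : bnice f -> bnice g -> bnice (fun x => f x * g x).
Proof. by move=> [K fK] [K' gK']; exists (2 * K * K'); exact: niceM. Qed.

Lemma bniceX f n : bnice f -> bnice (fun x => f x ^+ n).
Proof.
move=> fb; elim: n => [|n IH]; first exact: bnice_cst.
by apply: bnice_ext (bniceM fb IH) => x; rewrite exprS.
Qed.

Lemma bnice_sum I (r : seq I) (F : I -> R -> R[i]) :
  (forall i, bnice (F i)) -> bnice (fun x => \sum_(i <- r) F i x).
Proof.
move=> bF; elim: r => [|a r IH].
  by apply: bnice_ext (bnice_cst 0) => x; rewrite big_nil.
by apply: bnice_ext (bniceD (bF a) IH) => x; rewrite big_cons.
Qed.

Lemma chi_le_dist x y : chi x y <= `|x - y|.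
Proof.
rewrite -sqrtr_sqr ler_wsqrtr// /chi2 ler_pdivrMr ?mulr_gt0 ?onesq_gt0//.
rewrite ler_peMr ?sqr_ge0//.
have := sqr_ge0 x; have := sqr_ge0 y; nra.
Qed.

(** A coordinate near infinity, where it vanishes: up to an affine map it is the Cayley transform
    [(x - 'i) / (x + 'i)]. *)
Definition cayley x : R[i] := (x%:C + 'i)^-1.

Lemma xDi_neq0 x : x%:C + 'i != 0 :> R[i].
Proof. by rewrite eq_complex/= negb_and addr0 add0r oner_neq0 orbT. Qed.

Lemma cayleyE x : cayley x = (x / (1 + x ^+ 2)) -i* (1 + x ^+ 2)^-1.
Proof.
rewrite /cayley; apply: (mulfI (xDi_neq0 x)); rewrite mulfV ?xDi_neq0//.
apply/eqP; rewrite eq_complex /=; apply/andP; split; apply/eqP;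
  by field; rewrite onesq_neq0.
Qed.

Lemma n1_cayley x : n1 (cayley x) = (`|x| + 1) / (1 + x ^+ 2).
Proof.
rewrite cayleyE /n1/= normrN normrM normfV (ger0_norm (ltW (onesq_gt0 x))).
by rewrite mulrDl mul1r.
Qed.

Lemma n1_cayley_le x : n1 (cayley x) <= 2.
Proof.
rewrite n1_cayley ler_pdivrMr ?onesq_gt0//.
have := real_normK (num_real x); have := sqr_ge0 (`|x| - 1); nra.
Qed.

Lemma n1_cayley_inv x : 0 < `|x| -> n1 (cayley x) <= 2 / `|x|.
Proof.
move=> x0; rewrite n1_cayley ler_pdivrMr ?onesq_gt0// mulrAC ler_pdivlMr//.
have := real_normK (num_real x); have := sqr_ge0 (`|x| - 1); nra.
Qed.

(** The difference is [(y - x) / ((x + 'i) (y + 'i))], whose modulus is exactly [chi x y]; the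
    constant 2 absorbs the passage from the modulus to [n1]. *)
Lemma bnice_cayley : bnice cayley.
Proof.
exists 2; split=> [x|x y]; first exact: n1_cayley_le.
have X := onesq_gt0 x; have Y := onesq_gt0 y.
rewrite /chi -[leLHS]ger0_norm ?n1_ge0// -sqrtr_sqr.
rewrite -[2 in leRHS]ger0_norm// -sqrtr_sqr -sqrtrM ?sqr_ge0// ler_wsqrtr//.
have -> : cayley x - cayley y =
  ((y - x) * (x * y - 1) / ((1 + x ^+ 2) * (1 + y ^+ 2))) -i*
  ((y - x) * (x + y) / ((1 + x ^+ 2) * (1 + y ^+ 2))).
  rewrite !cayleyE; apply/eqP; rewrite eq_complex /=; apply/andP; split; apply/eqP;
  by field; rewrite !onesq_neq0.
set D := (1 + x ^+ 2) * (1 + y ^+ 2).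
have D0 : 0 < D by rewrite mulr_gt0.
rewrite /n1/= normrN !normrM normfV (ger0_norm (ltW D0)) /chi2 -/D.
rewrite -mulrDl -mulrDr !exprMn exprVn.
rewrite [leRHS](_ : _ = (x - y) ^+ 2 * (4 * D) / D ^+ 2); last by field; rewrite gt_eqF.
rewrite ler_pM2r ?invr_gt0 ?exprn_gt0// real_normK ?num_real// -(sqrrN (x - y)) opprB.
rewrite ler_wpM2l ?sqr_ge0//.
have := sqr_ge0 (`|x * y - 1| - `|x + y|).
have := real_normK (num_real (x * y - 1)); have := real_normK (num_real (x + y)).
rewrite /D; nra.
Qed.

End bounded_rational.

Section rational_nice.
Context {R : realType}.
Implicit Types (f g : R -> R[i]) (x y K : R) (p q : {poly R[i]}).

Lemma xcayley x : x%:C * cayley x = 1 - 'i * cayley x.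
Proof. by apply/eqP; rewrite eq_sym subr_eq -mulrDl mulfV// xDi_neq0. Qed.

Lemma bnice_xcayley : bnice (fun x : R => x%:C * cayley x).
Proof.
apply: bnice_ext (bniceD (bnice_cst 1) (bniceM (bnice_cst (- 'i)) bnice_cayley)).
by move=> x; rewrite xcayley mulNr.
Qed.

Lemma bnice_poly p m : (size p <= m.+1)%N ->
  bnice (fun x => p.[x%:C] * cayley x ^+ m).
Proof.
move=> pm.
apply: (@bnice_ext _ (fun x => \sum_(i <- index_enum 'I_m.+1)
    p`_i * ((x%:C * cayley x) ^+ i * cayley x ^+ (m - i)))).
  move=> x; rewrite (horner_coef_wide _ pm) mulr_suml; apply: eq_bigr => i _.
  by rewrite exprMn -!mulrA -exprD subnKC// -ltnS.
apply: bnice_sum => i; apply: bniceM; first exact: bnice_cst.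
apply: bniceM; apply: bniceX; [exact: bnice_xcayley|exact: bnice_cayley].
Qed.

(** Homogenization. With [u = cayley x] one has [x u = 1 - 'i u], so that [(x u)^m - 1] is divisible
    by [u]. Hence the coefficient of degree [m] is the value at infinity. *)
Lemma poly_cayley p m : (size p <= m.+1)%N ->
  exists2 H, bnice H & forall x, p.[x%:C] * cayley x ^+ m = p`_m + cayley x * H x.
Proof.
case: m => [|m] pm.
  exists (fun=> 0); first exact: bnice_cst.
  by move=> x; rewrite (horner_coef_wide _ pm) big_ord1 expr0 !mulr1 mulr0 addr0.
exists (fun x => \sum_(i < m.+1) p`_i * ((x%:C * cayley x) ^+ i * cayley x ^+ (m - i)) +
   (- 'i * p`_m.+1) * \sum_(i < m.+1) (x%:C * cayley x) ^+ i).
  apply: bniceD.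
    apply: bnice_sum => i; apply: bniceM; first exact: bnice_cst.
    apply: bniceM; apply: bniceX; [exact: bnice_xcayley|exact: bnice_cayley].
  apply: bniceM; first exact: bnice_cst.
  by apply: bnice_sum => i; apply: bniceX; exact: bnice_xcayley.
move=> x; set S1 := \sum_(i < _) _ * _; set S := \sum_(i < _) _ ^+ i.
have E1 : (\sum_(i < m.+1) p`_i * x%:C ^+ i) * cayley x ^+ m.+1 = cayley x * S1.
  rewrite /S1 mulr_suml mulr_sumr; apply: eq_bigr => i _.
  rewrite exprMn [RHS]mulrCA -!mulrA; congr (_ * _).
  rewrite [RHS]mulrCA; congr (_ * _).
  by rewrite -exprD -exprS subnKC// -ltnS.
have E2 : p`_m.+1 * x%:C ^+ m.+1 * cayley x ^+ m.+1 =
    p`_m.+1 + cayley x * (- 'i * p`_m.+1 * S).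
  have T := subrX1 (x%:C * cayley x) m.+1; rewrite -/S in T.
  rewrite -mulrA -exprMn -[X in _ * X](subrK 1) T xcayley.
  by ring.
rewrite (horner_coef_wide _ pm) big_ord_recr/= mulrDl E1 E2.
by ring.
Qed.

Lemma lipschitz_continuous (h : R -> R) K :
  (forall x y, `|h x - h y| <= K * `|x - y|) -> continuous h.
Proof.
move=> hK x; apply/cvgrPdist_le => e e0.
have K0 : 0 <= K by have := hK 1 0; rewrite subr0 normr1 mulr1; apply: le_trans.
have K1 : 0 < K + 1 by rewrite ltr_wpDl.
near=> y; apply: le_trans (hK x y) _.
apply: (@le_trans _ _ ((K + 1) * `|x - y|)); first by rewrite ler_wpM2r// lerDl.
rewrite mulrC -ler_pdivlMr//.
near: y; apply/nbhs_ballP; exists (e / (K + 1)); first by rewrite /= divr_gt0.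
by move=> y /ltW.
Unshelve. all: end_near. Qed.

Lemma n1_dist (z w : R[i]) : `|n1 z - n1 w| <= n1 (z - w).
Proof.
rewrite ler_norml; apply/andP; split.
  by rewrite lerNl opprB lerBlDr n1B; apply: le_trans (n1D _ _); rewrite subrK.
by rewrite lerBlDr; apply: le_trans (n1D _ _); rewrite subrK.
Qed.

(* As cayley x tends to 0 at infinity, l is the limit of f there. *)
Lemma nice_lower_bound f g (l : R[i]) : bnice f -> bnice g -> l != 0 ->
  (forall x, f x = l + cayley x * g x) -> (forall x, f x != 0) ->
  exists2 c, 0 < c & forall x, c <= n1 (f x).
Proof.
move=> [K fK] [K' gK'] l0 fE f0.
have K'0 := nice_ge0 gK'; have K0 := nice_ge0 fK.
have L0 : 0 < n1 l by rewrite lt_neqAle n1_ge0 andbT eq_sym n1_eq0.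
(* Beyond [A] the term [cayley x * g x] has size at most [2 K' / |x|], which is at most half of
   [n1 l]; on [[-A, A]] the minimum is attained. *)
pose A := 4 * K' / n1 l + 1.
have A0 : 0 < A by rewrite ltr_wpDl// divr_ge0 ?n1_ge0// mulr_ge0.
have [c cA cmin] : exists2 c, c \in `[- A, A]%R &
    forall t, t \in `[- A, A]%R -> n1 (f c) <= n1 (f t).
  apply: (@EVT_min R (n1 \o f)); first by rewrite ge0_cp ?ltW.
  apply: continuous_subspaceT; apply: (@lipschitz_continuous _ K) => x y.
  apply: le_trans (n1_dist _ _) _; apply: le_trans (fK.2 x y) _.
  by rewrite ler_wpM2l// chi_le_dist.
have c0 : 0 < n1 (f c) by rewrite lt_neqAle n1_ge0 andbT eq_sym n1_eq0.
exists (Num.min (n1 (f c)) (n1 l / 2)); first by rewrite lt_min c0 divr_gt0.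
move=> x; have [xA|xA] := leP `|x| A.
  by rewrite ge_min cmin// in_itv/= -ler_norml.
rewrite ge_min; apply/orP; right.
have x0 : 0 < `|x| by exact: lt_trans xA.
have h1 : n1 (cayley x * g x) <= 2 / `|x| * K'.
  by apply: le_trans (n1M _ _) _; rewrite ler_pM ?n1_ge0 ?n1_cayley_inv ?gK'.1.
have h2 : 2 / `|x| * K' <= n1 l / 2.
  rewrite mulrAC ler_pdivrMr// mulrAC ler_pdivlMr//.
  have : 4 * K' <= n1 l * A by rewrite /A mulrDr mulr1 mulrCA mulfV ?gt_eqF// mulr1 lerDl ltW.
  have : n1 l * A <= n1 l * `|x| by rewrite ler_wpM2l ?ltW.
  by lra.
have : n1 l <= n1 (f x) + n1 (cayley x * g x).
  by apply: le_trans (n1BD _ _); rewrite fE addrK.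
lra.
Qed.

(** Multiplying numerator and denominator by [cayley x ^+ m], where [m] is the larger degree, makes
    both chordal Lipschitz. The new denominator has no zero on the line, and none at infinity
    because [f] is bounded; so it stays away from 0. *)
Lemma bounded_rational_nice f (B : R) :
  rational_fun f -> (forall x, n1 (f x) <= B) -> bnice f.
Proof.
move=> [p [q pq]] fB.
have q0 x : q.[x%:C] != 0 by have [] := pq x.
have fE x : f x = p.[x%:C] / q.[x%:C] by have [] := pq x.
have B0 : 0 <= B by apply: le_trans (fB 0); exact: n1_ge0.
set m := (maxn (size p) (size q)).-1.
have qn0 : q != 0 by apply: contraNneq (q0 0) => ->; rewrite horner0.
have m1 : m.+1 = maxn (size p) (size q).
  by rewrite prednK// leq_max [X in _ || X]lt0n size_poly_eq0 qn0 orbT.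
have pm : (size p <= m.+1)%N by rewrite m1 leq_maxl.
have qm : (size q <= m.+1)%N by rewrite m1 leq_maxr.
have u0 x : cayley x ^+ m != 0 by rewrite expf_neq0// invr_eq0 xDi_neq0.
have [H bH HE] := poly_cayley qm; have [H' bH' H'E] := poly_cayley pm.
(* If [q] had smaller degree than [p], then [f] would be unbounded near infinity. *)
have l0 : q`_m != 0.
  apply/eqP => qm0.
  have pm0 : p`_m != 0.
    have : ~~ (size p <= m)%N || ~~ (size q <= m)%N.
      by rewrite -negb_and -geq_max -m1 ltnn.
    case/orP => h.
      have sp : size p = m.+1 by apply/eqP; rewrite eqn_leq pm ltnNge.
      have : lead_coef p != 0 by rewrite lead_coef_eq0 -size_poly_eq0 sp.
      by rewrite /lead_coef sp.
    have sq : size q = m.+1 by apply/eqP; rewrite eqn_leq qm ltnNge.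
    have : lead_coef q != 0 by rewrite lead_coef_eq0.
    by rewrite /lead_coef sq qm0 eqxx.
  have [K HK] := bH; have [K' HK'] := bH'.
  have P0 : 0 < n1 p`_m by rewrite lt_neqAle n1_ge0 andbT eq_sym n1_eq0.
  have KK : 0 <= B * K + K' by rewrite addr_ge0 ?(nice_ge0 HK')// mulr_ge0 ?(nice_ge0 HK).
  (* Chosen so large that [n1 (cayley x) <= 2 / x] forces the leading coefficient of [p] to be
     smaller than itself. *)
  pose x := 2 * (B * K + K') / n1 p`_m + 1.
  have x0 : 0 < x by rewrite ltr_wpDl// divr_ge0 ?n1_ge0// mulr_ge0.
  have E : p`_m = f x * (cayley x * H x) - cayley x * H' x.
    apply/eqP; rewrite eq_sym subr_eq -H'E; apply/eqP.
    have := HE x; rewrite qm0 add0r => <-.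
    by rewrite fE mulrA divfK.
  have : n1 p`_m <= B * (2 / x * K) + 2 / x * K'.
    rewrite {1}E; apply: le_trans (n1BD _ _) _; rewrite lerD//.
      apply: le_trans (n1M _ _) _; rewrite ler_pM ?n1_ge0//.
      apply: le_trans (n1M _ _) _; rewrite ler_pM ?n1_ge0 ?HK.1//.
      by rewrite -[x in leRHS]gtr0_norm// n1_cayley_inv// gtr0_norm.
    apply: le_trans (n1M _ _) _; rewrite ler_pM ?n1_ge0 ?HK'.1//.
    by rewrite -[x in leRHS]gtr0_norm// n1_cayley_inv// gtr0_norm.
  have -> : B * (2 / x * K) + 2 / x * K' = 2 * (B * K + K') / x by field; rewrite gt_eqF.
  rewrite ler_pdivlMr// /x mulrDr mulr1 mulrCA mulfV ?gt_eqF// mulr1.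
  lra.
have bF := bnice_poly qm.
have [c c0 cF] : exists2 c, 0 < c & forall x, c <= n1 (q.[x%:C] * cayley x ^+ m).
  by apply: nice_lower_bound bF bH l0 HE _ => x; rewrite mulf_neq0.
have [K FK] := bF.
have bV : bnice (fun x => (q.[x%:C] * cayley x ^+ m)^-1).
  by eexists; exact: niceV c0 cF FK.
apply: bnice_ext (bniceM (bnice_poly pm) bV) => x.
by rewrite fE invfM mulrACA mulfV ?u0// mulr1.
Qed.

End rational_nice.

(** * Uniform rational approximation with a common chordal Lipschitz constant *)

Section approx.
Context {R : realType}.
Implicit Types (f : R -> R[i]) (g : nat -> R -> R[i]) (x y K c : R).

(** The common constant [K] is what upgrades uniform convergence to convergence of the energy,
    through [energy_cvg0_chi]. *)
Definition approx g f := [/\ forall n, rational_fun (g n),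
  exists K, forall n, nice K (g n) &
  forall e, 0 < e -> exists N, forall n, (N <= n)%N -> forall x, n1 (g n x - f x) <= e].

Lemma approx_nice g f : approx g f -> exists K, nice K f /\ forall n, nice K (g n).
Proof.
move=> [_ [K gK] gf]; exists K; split=> //; split=> [x|x y].
  apply/ler_addgt0Pr => e e0; have [N h] := gf e e0.
  have -> : f x = g N x - (g N x - f x) by ring.
  by apply: le_trans (n1BD _ _) _; rewrite lerD ?h// (gK N).1.
apply/ler_addgt0Pr => e e0; have [|N h] := gf (e / 2); first by rewrite divr_gt0.
have -> : f x - f y = (g N x - g N y) - (g N x - f x) + (g N y - f y) by ring.
have := n1D (g N x - g N y - (g N x - f x)) (g N y - f y).
have := n1BD (g N x - g N y) (g N x - f x).
have := h N (leqnn N) x; have := h N (leqnn N) y; have := (gK N).2 x y; lra.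
Qed.

Lemma approx_ext g g' f f' : (forall n, g n =1 g' n) -> f =1 f' ->
  approx g f -> approx g' f'.
Proof.
move=> gg /funext <-; suff -> : g' = g by [].
by apply/funext => n; apply/funext => x; rewrite gg.
Qed.

Lemma approx_shift g f N : approx g f -> approx (fun n => g (n + N)%N) f.
Proof.
move=> [g1 [K g2] g3]; split; [by move=> n|by exists K|].
by move=> e /g3[N' h]; exists N' => n Nn x; apply: h; exact: leq_trans (leq_addr _ _).
Qed.

Lemma approx_cst (c : R[i]) : approx (fun _ _ => c) (fun=> c).
Proof.
split; first by move=> n; exact: rational_cst.
  by exists (n1 c) => n; exact: nice_cst.
by move=> e e0; exists 0%N => n _ x; rewrite subrr n1_0 ltW.
Qed.

Lemma approxD g g' f f' : approx g f -> approx g' f' ->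
  approx (fun n x => g n x + g' n x) (fun x => f x + f' x).
Proof.
move=> [g1 [K g2] g3] [h1 [K' h2] h3]; split.
- by move=> n; exact: rationalD.
- by exists (K + K') => n; exact: niceD.
move=> e e0; have e20 : 0 < e / 2 by rewrite divr_gt0.
have [N gN] := g3 _ e20; have [N' gN'] := h3 _ e20.
exists (maxn N N') => n; rewrite geq_max => /andP[n1' n2] x.
rewrite opprD addrACA; apply: le_trans (n1D _ _) _.
by rewrite [leRHS]splitr lerD ?gN ?gN'.
Qed.

Lemma approxM g g' f f' : approx g f -> approx g' f' ->
  approx (fun n x => g n x * g' n x) (fun x => f x * f' x).
Proof.
move=> a a'; have [K [fK gK]] := approx_nice a; have [K' [fK' gK']] := approx_nice a'.
case: a a' => [g1 _ g3] [h1 _ h3]; split.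
- by move=> n; exact: rationalM.
- by exists (2 * K * K') => n; exact: niceM.
move=> e e0; have K0 := nice_ge0 fK; have K'0 := nice_ge0 fK'.
have d0 : 0 < e / (K + K' + 1) by rewrite divr_gt0// ltr_wpDl// addr_ge0.
have [N gN] := g3 _ d0; have [N' gN'] := h3 _ d0.
exists (maxn N N') => n; rewrite geq_max => /andP[n1' n2] x.
have -> : g n x * g' n x - f x * f' x =
  (g n x - f x) * g' n x + f x * (g' n x - f' x) by ring.
apply: le_trans (n1D _ _) _.
apply: (@le_trans _ _ (e / (K + K' + 1) * K' + K * (e / (K + K' + 1)))).
  rewrite lerD//; apply: le_trans (n1M _ _) _; rewrite ler_pM ?n1_ge0//.
  - exact: gN.
  - by have [] := gK' n.
  - by have [] := fK.
  - exact: gN'.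
have -> : e / (K + K' + 1) * K' + K * (e / (K + K' + 1)) = e * (K + K') / (K + K' + 1).
  by field; rewrite gt_eqF// ltr_wpDl// addr_ge0.
by rewrite ler_pdivrMr ?ltr_wpDl ?addr_ge0// ler_wpM2l// ?(ltW e0)// lerDl.
Qed.

Lemma approxN g f : approx g f -> approx (fun n x => - g n x) (fun x => - f x).
Proof.
move=> [g1 [K g2] g3]; split.
- by move=> n; exact: rationalN.
- by exists K => n; exact: niceN.
by move=> e /g3[N h]; exists N => n Nn x; rewrite -opprD n1N h.
Qed.

Lemma approxB g g' f f' : approx g f -> approx g' f' ->
  approx (fun n x => g n x - g' n x) (fun x => f x - f' x).
Proof. by move=> a a'; exact: approxD a (approxN a'). Qed.

Lemma approx_conj g f : approx g f ->
  approx (fun n x => (g n x)^*%C) (fun x => (f x)^*%C).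
Proof.
move=> [g1 [K g2] g3]; split.
- by move=> n; exact: rational_conj.
- by exists K => n; exact: nice_conj.
by move=> e /g3[N h]; exists N => n Nn x; rewrite -rmorphB/= n1_conj h.
Qed.

Lemma approxV g f c : 0 < c -> (forall x, c <= n1 (f x)) ->
  (forall n x, c <= n1 (g n x)) -> approx g f ->
  approx (fun n x => (g n x)^-1) (fun x => (f x)^-1).
Proof.
move=> c0 cf cg [g1 [K g2] g3].
have nz z : c <= n1 z -> z != 0 by move=> cz; rewrite -n1_eq0 gt_eqF// (lt_le_trans c0).
have V z : c <= n1 z -> n1 z^-1 <= 2 / c.
  move=> cz; apply: le_trans (n1V (nz _ cz)) _.
  by rewrite ler_wpM2l// lef_pV2 ?posrE// (lt_le_trans c0).
split.
- by move=> n; apply: rationalV => // x; exact: nz.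
- by eexists => n; exact: niceV c0 (cg n) (g2 n).
move=> e e0; have d0 : 0 < e * c ^+ 2 / 4 by rewrite divr_gt0// mulr_gt0// exprn_gt0.
have [N h] := g3 _ d0; exists N => n Nn x.
have -> : (g n x)^-1 - (f x)^-1 = - ((g n x)^-1 * (f x)^-1 * (g n x - f x)).
  by field; rewrite !nz.
rewrite n1N.
have -> : e = (2 / c) * (2 / c) * (e * c ^+ 2 / 4) by field; rewrite gt_eqF.
apply: le_trans (n1M _ _) _; rewrite ler_pM ?n1_ge0 ?h//.
by apply: le_trans (n1M _ _) _; rewrite ler_pM ?n1_ge0 ?V.
Qed.

Lemma approx_sum (I : Type) (r : seq I) (g : I -> nat -> R -> R[i]) (f : I -> R -> R[i]) :
  (forall i, approx (g i) (f i)) ->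
  approx (fun n x => \sum_(i <- r) g i n x) (fun x => \sum_(i <- r) f i x).
Proof.
move=> a; elim: r => [|b r IH].
  by apply: approx_ext (approx_cst 0) => [n x|x]; rewrite big_nil.
by apply: approx_ext (approxD (a b) IH) => [n x|x]; rewrite big_cons.
Qed.

Lemma approx_lower_bound g f c : 0 < c -> (forall x, c <= n1 (f x)) -> approx g f ->
  exists N, forall n x, c / 2 <= n1 (g (n + N)%N x).
Proof.
move=> c0 cf [_ _ g3]; have [|N h] := g3 (c / 2); first by rewrite divr_gt0.
exists N => n x; have := h (n + N)%N (leq_addl _ _) x; rewrite n1B.
have := n1D (f x - g (n + N)%N x) (g (n + N)%N x); rewrite subrK.
have := cf x; lra.
Qed.

End approx.

(** * Rational approximation of projection-valued maps *)

Section generic_vector.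
Context {R : realType}.
Local Notation C := R[i].

(* The numerator is odd, hence node never hits the junk value 0^-1. *)
Definition node (m : nat) (b : bool) (k : 'I_(2 * m).+1) : R :=
  let t := (k%:R + 2^-1) / m%:R - 1 in if b then t^-1 else t.

Lemma chi_inv (x y : R) : x != 0 -> y != 0 -> chi x^-1 y^-1 = chi x y.
Proof.
move=> x0 y0; congr Num.sqrt; rewrite /chi2; field.
by rewrite x0 y0 !onesq_neq0 /= ?addrC ?onesq_neq0.
Qed.

Lemma node_close (m : nat) (x : R) : (0 < m)%N ->
  exists b k, chi x (@node m b k) <= m%:R^-1.
Proof.
move=> m0; have mr : 0 < m%:R :> R by rewrite ltr0n.
have close (y : R) : `|y| <= 1 -> exists k : 'I_(2 * m).+1,
    `|y - ((k%:R + 2^-1) / m%:R - 1)| <= m%:R^-1.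
  rewrite ler_norml => /andP[y1 y2].
  have y0 : 0 <= (y + 1) * m%:R by rewrite mulr_ge0//; lra.
  have /andP[k1 k2] := truncn_itv y0.
  (* The end point [y = 1] gives the index [2 * m], whence [2 * m + 1] nodes of each kind. *)
  have km : (Num.truncn ((y + 1) * m%:R) < (2 * m).+1)%N.
    rewrite ltnS -(ler_nat R) (le_trans k1)// natrM ler_wpM2r//; lra.
  exists (Ordinal km) => /=; move: k1 k2; move: (Num.truncn _) => k k1 k2.
  have -> : y - ((k%:R + 2^-1) / m%:R - 1) = ((y + 1) * m%:R - k%:R - 2^-1) / m%:R.
    by field; rewrite gt_eqF.
  rewrite normrM [X in _ * X]gtr0_norm ?invr_gt0// -[leRHS]mul1r.
  apply: ler_wpM2r; first by rewrite invr_ge0 ltW.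
  rewrite ler_norml; move: k2; rewrite -natr1; lra.
(* Inversion preserves [chi], so the reciprocal nodes serve the points outside [[-1, 1]]. *)
have [x1|x1] := leP `|x| 1.
  have [k kx] := close x x1; exists false, k.
  exact: le_trans (chi_le_dist _ _) kx.
have x0 : x != 0 by apply: contraTneq x1 => ->; rewrite normr0 ltNge negbK.
have [|k kx] := close x^-1; first by rewrite normfV invf_le1 ?ltW ?normr_gt0.
exists true, k; rewrite /node.
have t0 : (k%:R + 2^-1) / m%:R - 1 != 0 :> R.
  rewrite subr_eq0; apply/eqP => /(congr1 ( *%R^~ m%:R)).
  rewrite divfK ?gt_eqF// mul1r => E.
  have /eqP : (2 * k + 1)%:R = (2 * m)%:R :> R by rewrite natrD !natrM; lra.
  by rewrite eqr_nat; lia.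
rewrite -[x]invrK chi_inv ?invr_eq0//.
exact: le_trans (chi_le_dist _ _) kx.
Qed.

Lemma card_close_le (m L : nat) (S : {set 'I_m * 'I_m}) :
  (forall p q, p \in S -> q \in S ->
     ((p.1 <= q.1 + L)%N /\ (p.2 <= q.2 + L)%N)) ->
  (#|S| <= (2 * L).+1 * (2 * L).+1)%N.
Proof.
move=> SL; have [->|/finset.set0Pn[q qS]] := eqVneq S finset.set0; first by rewrite cards0.
pose h (p : 'I_m * 'I_m) : 'I_(2 * L).+1 * 'I_(2 * L).+1 :=
  (inord (p.1 + L - q.1), inord (p.2 + L - q.2)).
have hi : {in S &, injective h}.
  move=> [p1 p2] [r1 r2] pS rS [].
  have /= [a1 a2] := SL _ _ pS qS; have /= [b1 b2] := SL _ _ qS pS.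
  have /= [c1 c2] := SL _ _ rS qS; have /= [d1 d2] := SL _ _ qS rS.
  case: q {qS} @h a1 a2 b1 b2 c1 c2 d1 d2 => q1 q2 /= a1 a2 b1 b2 c1 c2 d1 d2.
  have w (u v : 'I_m) : (u <= v + L)%N -> (u + L - v < (2 * L).+1)%N.
    by move: (nat_of_ord u) (nat_of_ord v) => u' v'; lia.
  move=> /(congr1 val) /=; rewrite !inordK ?w// => e1.
  move=> /(congr1 val) /=; rewrite !inordK ?w// => e2.
  congr (_, _); apply: val_inj => /=; [move: e1 a1 b1 c1 d1|move: e2 a2 b2 c2 d2];
    clear; lia.
rewrite -(card_in_imset hi).
apply: leq_trans (max_card _) _.
by rewrite card_prod !card_ord.
Qed.

Lemma count_arith (a t m : nat) :
  (6 * a * t < m)%N -> (a * (2 * (2 * m).+1) * t < m * m)%N.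
Proof.
move=> h; have m1 : (0 < m)%N by exact: leq_ltn_trans h.
have : (a * (2 * (2 * m).+1) * t <= 6 * a * t * m)%N by nia.
by move=> /leq_ltn_trans; apply; rewrite ltn_mul2r m1.
Qed.

Lemma card_bigcup_le (T J : finType) (F : J -> {set T}) (n : nat) :
  (forall j, #|F j| <= n)%N -> (#|(\bigcup_j F j)%SET| <= #|J| * n)%N.
Proof.
move=> Fn; rewrite -sum_nat_const.
elim/big_rec2 : _ => [|j k A _ h]; first by rewrite cards0.
by apply: leq_trans (leq_card_setU _ _) _; exact: leq_add.
Qed.

Lemma common_nice (I : finType) (F : I -> R -> C) :
  (forall i, bnice (F i)) -> exists K, forall i, nice K (F i).
Proof.
move=> bF; pose K i := projT1 (cid (bF i)).
have KF i : nice (K i) (F i) by rewrite /K; case: cid.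
exists (\sum_i K i) => i; apply: nice_le (KF i).
rewrite (bigD1 i)//= lerDl; apply: sumr_ge0 => j _; exact: nice_ge0 (KF j).
Qed.

(* Among m^2 equally spaced values of z, each of the O(m) nodes excludes a
   bounded number, so some z makes f + z g of size at least D / m at every
   node; D exceeds the variation of f + z g between neighbouring nodes. *)
Lemma generic_scalar (I : finType) (f g : I -> R -> C) (c : R) : 0 < c ->
  (forall i, bnice (f i)) -> (forall i, bnice (g i)) ->
  exists z : C, n1 z <= 2 /\ exists2 c', 0 < c' &
    forall i x, c <= n1 (g i x) -> c' <= n1 (f i x + z * g i x).
Proof.
move=> c0 bf bg.
have [K1 fK1] := common_nice bf; have [K2 gK2] := common_nice bg.
pose K := `|K1| + `|K2|.
have K0 : 0 <= K by rewrite addr_ge0.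
have fK i : nice K (f i).
  by apply: nice_le (fK1 i); rewrite (le_trans (ler_norm _))// lerDl.
have gK i : nice K (g i).
  by apply: nice_le (gK2 i); rewrite (le_trans (ler_norm _))// lerDr.
(* Moving to a node at distance [1 / m] changes [f] by [K / m] and [z g] by [2 K / m], as
   [n1 z <= 2]; the [+ 1] leaves the lower bound [1 / m]. *)
pose D := 3 * K + 1.
have D0 : 0 < D by rewrite ltr_wpDl// mulr_ge0.
(* Two values of [z] excluded by the same node differ by at most [(2 D / m) (4 / c)], that is by [L]
   steps of the grid of mesh [1 / m]. *)
pose L := (Num.truncn (8 * D / c)).+1.
have LD : 8 * D / c <= L%:R by apply/ltW; exact: truncnS_gt.
(* The first summand wins the count: there are [2 (2 m + 1) <= 6 m] nodes for each index, each
   excluding at most [(2 L + 1)^2] values. The second gives [K / m <= c / 2], so that [g] keeps half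
   of its size at the node. *)
pose m := (6 * #|I| * ((2 * L).+1 * (2 * L).+1) + (Num.truncn (2 * K / c)).+1)%N.
have m0 : (0 < m)%N by rewrite /m addnS.
have mr : 0 < m%:R :> R by rewrite ltr0n.
have mK : 2 * K / c <= m%:R.
  by apply: (le_trans (ltW (truncnS_gt _))); rewrite ler_nat /m leq_addl.
pose pt (p : 'I_m * 'I_m) : C := (p.1%:R / m%:R) +i* (p.2%:R / m%:R).
have pt2 p : n1 (pt p) <= 2.
  have h (k : 'I_m) : `|k%:R / m%:R| <= 1 :> R.
    by rewrite ger0_norm ?divr_ge0// ler_pdivrMr// mul1r ler_nat ltnW.
  by have := h p.1; have := h p.2; rewrite /n1/=; lra.
pose J : finType := (I * (bool * 'I_(2 * m).+1))%type.
pose xj (j : J) := @node m j.2.1 j.2.2.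
pose Bad (j : J) := [set p : 'I_m * 'I_m | (c / 2 <= n1 (g j.1 (xj j))) &&
  (n1 (f j.1 (xj j) + pt p * g j.1 (xj j)) < D / m%:R)]%SET.
have BadC j : (#|Bad j| <= (2 * L).+1 * (2 * L).+1)%N.
  apply: card_close_le => p q; rewrite !inE => /andP[cg hp] /andP[_ hq].
  set w := g j.1 (xj j) in cg hp hq; set v := f j.1 (xj j) in hp hq.
  have w0 : 0 < n1 w by apply: lt_le_trans cg; rewrite divr_gt0.
  have wn0 : w != 0 by rewrite -n1_eq0 gt_eqF.
  have h : n1 (pt p - pt q) <= L%:R / m%:R.
    have -> : pt p - pt q = ((v + pt p * w) - (v + pt q * w)) * w^-1.
      by field.
    apply: le_trans (n1M _ _) _.
    have a1 : n1 (v + pt p * w - (v + pt q * w)) <= 2 * D / m%:R.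
      apply: le_trans (n1BD _ _) _.
      have -> : 2 * D / m%:R = D / m%:R + D / m%:R by rewrite -mulrDl -mulr2n mulr_natl.
      by rewrite lerD// ltW.
    have a2 : n1 w^-1 <= 4 / c.
      apply: le_trans (n1V wn0) _.
      rewrite ler_pdivrMr// mulrAC ler_pdivlMr//; lra.
    apply: (@le_trans _ _ (2 * D / m%:R * (4 / c))).
      by rewrite ler_pM ?n1_ge0.
    have -> : 2 * D / m%:R * (4 / c) = (8 * D / c) / m%:R by field; rewrite !gt_eqF.
    by rewrite ler_wpM2r// invr_ge0 ltW.
  have h1 := le_trans (n1_le_Re _) h; have h2 := le_trans (n1_le_Im _) h.
  move: h1 h2; rewrite /pt /= -!mulrBl !normrM (gtr0_norm (_ : 0 < m%:R^-1)) ?invr_gt0//.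
  rewrite !ler_pM2r ?invr_gt0// !ler_norml => /andP[_ h1] /andP[_ h2].
  by split; rewrite -(ler_nat R) natrD -lerBlDl.
have cardU : (#|(\bigcup_j Bad j)%SET| < m * m)%N.
  apply: leq_ltn_trans (card_bigcup_le BadC) _.
  rewrite !card_prod card_bool !card_ord.
  apply: count_arith; rewrite /m; lia.
have [p pU] : exists p, p \notin (\bigcup_j Bad j)%SET.
  case: (pickP (fun p => p \notin (\bigcup_j Bad j)%SET)) => [p|h]; first by exists p.
  move: cardU; suff -> : (\bigcup_j Bad j)%SET = [set: 'I_m * 'I_m]%SET.
    by rewrite cardsT card_prod card_ord ltnn.
  by apply/finset.setP => p; rewrite inE; have := h p; case: (p \in _).
exists (pt p); split; first exact: pt2.
exists m%:R^-1; first by rewrite invr_gt0.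
move=> i x cx; have [b [k xk]] := node_close x m0.
pose j : J := (i, (b, k)).
have := fK i; have := gK i => -[_ gL] [_ fL].
have fx : n1 (f i x - f i (xj j)) <= K / m%:R.
  by apply: le_trans (fL _ _) _; rewrite ler_wpM2l.
have gx : n1 (g i x - g i (xj j)) <= K / m%:R.
  by apply: le_trans (gL _ _) _; rewrite ler_wpM2l.
have KM : K / m%:R <= c / 2.
  by move: mK; rewrite !ler_pdivrMr// mulrAC ler_pdivlMr//; lra.
have gj : c / 2 <= n1 (g i (xj j)).
  have := n1D (g i x - g i (xj j)) (g i (xj j)); rewrite subrK; lra.
have : p \notin Bad j.
  by apply: contra pU => pj; apply/bigcupP; exists j.
rewrite inE gj/= -leNgt => h.
have := n1BD (f i x + pt p * g i x)
  ((f i x - f i (xj j)) + pt p * (g i x - g i (xj j))).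
have -> : f i x + pt p * g i x - (f i x - f i (xj j) + pt p * (g i x - g i (xj j))) =
  f i (xj j) + pt p * g i (xj j) by ring.
move=> /(le_trans h).
have := n1D (f i x - f i (xj j)) (pt p * (g i x - g i (xj j))).
have : n1 (pt p * (g i x - g i (xj j))) <= 2 * (K / m%:R).
  by apply: le_trans (n1M _ _) _; rewrite ler_pM ?n1_ge0.
have -> : D / m%:R = 3 * (K / m%:R) + m%:R^-1 by rewrite /D mulrDl mul1r mulrA.
lra.
Qed.

(** [generic_scalar] adds one term at a time. A bound is claimed only where some term is large;
    where the last one is small, the sum of the earlier ones prevails. *)
Lemma generic_coeffs (I : finType) l (r : I -> nat -> R -> C) :
  (forall i j, bnice (r i j)) -> forall c, 0 < c ->
  exists e : nat -> C, exists2 c', 0 < c' &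
    forall i x, (exists2 j, (j < l)%N & c <= n1 (r i j x)) ->
      c' <= n1 (\sum_(j < l) e j * r i j x).
Proof.
move=> br c c0; elim: l => [|l [e [c1 c10 IH]]].
  by exists (fun=> 0), 1 => // i x [].
have bf i : bnice (fun x => \sum_(j < l) e j * r i j x).
  by apply: bnice_sum => j; apply: bniceM => //; exact: bnice_cst.
(* The new coefficient has [n1 z <= 2], so a last term below [c1 / 4] takes at most [c1 / 2] from
   the earlier sum. *)
have d0 : 0 < Num.min c (c1 / 4) by rewrite lt_min c0 divr_gt0.
have [z [z2 [c2 c20 zP]]] := generic_scalar d0 bf (fun i => br i l).
exists (fun j => if (j == l)%N then z else e j), (Num.min c2 (c1 / 2)).
  by rewrite lt_min c20 divr_gt0.
move=> i x [j jl cj]; rewrite big_ord_recr/= eqxx.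
have -> : \sum_(k < l) (if (k == l :> nat)%N then z else e k) * r i k x =
    \sum_(k < l) e k * r i k x.
  by apply: eq_bigr => k _; rewrite ltn_eqF.
have [h|h] := leP (Num.min c (c1 / 4)) (n1 (r i l x)).
  by rewrite ge_min (zP _ _ h).
move: h; rewrite lt_min => /andP[h1 h2].
have jl' : (j < l)%N.
  move: jl; rewrite ltnS leq_eqVlt => /orP[/eqP jE|//].
  by move: h1; rewrite -jE ltNge cj.
have F : c1 <= n1 (\sum_(k < l) e k * r i k x) by apply: IH; exists j.
rewrite ge_min; apply/orP; right.
have := n1BD (\sum_(k < l) e k * r i k x + z * r i l x) (z * r i l x); rewrite addrK.
have : n1 (z * r i l x) <= 2 * (c1 / 4).
  by apply: le_trans (n1M _ _) _; rewrite ler_pM ?n1_ge0// ltW.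
lra.
Qed.

End generic_vector.

(** * Hermitian projections and rank-one updates *)

Section projections.
Context {R : realType} {d : nat}.
Local Notation C := R[i].
Local Notation M := 'M[C]_d.
Implicit Types (P Q : M) (v : 'cV[C]_d).

Lemma adjM m n p (A : 'M[C]_(m, n)) (B : 'M[C]_(n, p)) :
  (A *m B)^t* = B^t* *m A^t*.
Proof. by rewrite trmx_mul map_mxM. Qed.

Lemma adjE m n (A : 'M[C]_(m, n)) i j : (A^t*) i j = ((A j i)^*)%C.
Proof. by rewrite !mxE. Qed.

Lemma adjB m n (A B : 'M[C]_(m, n)) : (A - B)^t* = A^t* - B^t*.
Proof. by rewrite linearB/= map_mxB. Qed.

Lemma adjD m n (A B : 'M[C]_(m, n)) : (A + B)^t* = A^t* + B^t*.
Proof. by rewrite linearD/= map_mxD. Qed.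

Definition hproj (r : nat) P := [/\ P *m P = P, P = P^t* & \tr P = r%:R].

Definition sqn m (v : 'cV[C]_m) : C := (v^t* *m v) 0 0.

Lemma sqnE m (v : 'cV[C]_m) :
  sqn v = (\sum_i (complex.Re (v i 0) ^+ 2 + complex.Im (v i 0) ^+ 2))%:C.
Proof.
rewrite /sqn mxE rmorph_sum; apply: eq_bigr => i _; rewrite adjE.
by case: (v i 0) => a b /=; apply/eqP; rewrite eq_complex/=; apply/andP; split; apply/eqP; ring.
Qed.

Lemma conj_sqn m (v : 'cV[C]_m) : ((sqn v)^*)%C = sqn v.
Proof. by rewrite sqnE conjc_real. Qed.

Lemma sqn_ge m (v : 'cV[C]_m) c i : 0 <= c -> c <= n1 (v i 0) -> c ^+ 2 / 2 <= n1 (sqn v).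
Proof.
move=> c0 ci; rewrite sqnE n1_real ger0_norm; last first.
  by apply: sumr_ge0 => j _; rewrite addr_ge0 ?sqr_ge0.
rewrite (bigD1 i)//= ler_wpDr//.
  by apply: sumr_ge0 => j _; rewrite addr_ge0 ?sqr_ge0.
move: ci; rewrite /n1; case: (v i 0) => a b /= ci.
have : c ^+ 2 <= (`|a| + `|b|) ^+ 2 by rewrite lerXn2r ?nnegrE// addr_ge0.
have := real_normK (num_real a); have := real_normK (num_real b).
have := sqr_ge0 (`|a| - `|b|); rewrite ler_pdivrMr//; nra.
Qed.

Lemma mul_sqn m (v : 'cV[C]_m) : v^t* *m v = (sqn v)%:M.
Proof. by rewrite /sqn [LHS]mx11_scalar. Qed.

Lemma adj_outer v s : ((s^*)%C = s) -> (s *: (v *m v^t*))^t* = s *: (v *m v^t*).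
Proof.
move=> ss; apply/matrixP => i j; rewrite adjE !mxE rmorphM/= ss; congr (_ * _).
by rewrite rmorph_sum; apply: eq_bigr => k _; rewrite !mxE rmorphM/= conjcK mulrC.
Qed.

Lemma tr_outer v : \tr (v *m v^t*) = sqn v.
Proof. by rewrite mxtrace_mulC mul_sqn mxtrace_scalar. Qed.

Lemma outer_sq v : (v *m v^t*) *m (v *m v^t*) = sqn v *: (v *m v^t*).
Proof. by rewrite mulmxA -(mulmxA v) mul_sqn mul_mx_scalar -scalemxAl. Qed.

Lemma conj_invC (s : C) : (s^*)%C = s -> ((s^-1)^*)%C = s^-1.
Proof. by move=> ss; rewrite fmorphV/= ss. Qed.

Lemma hprojD r Q v : hproj r Q -> Q *m v = 0 -> sqn v != 0 ->
  hproj r.+1 (Q + (sqn v)^-1 *: (v *m v^t*)).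
Proof.
move=> [QQ Qa Qt] Qv s0; set s := sqn v.
have vQ : v^t* *m Q = 0 by rewrite [Q]Qa -adjM Qv trmx0 map_mx0.
split.
- rewrite mulmxDl !mulmxDr QQ -!scalemxAr -!scalemxAl mulmxA Qv mul0mx scaler0 addr0.
  rewrite -(mulmxA v) vQ mulmx0 scaler0 add0r outer_sq !scalerA.
  by rewrite -/s mulrAC mulVf// mul1r.
- by rewrite adjD -Qa adj_outer// conj_invC// conj_sqn.
- by rewrite mxtraceD mxtraceZ tr_outer Qt mulVf// natr1.
Qed.

Lemma hprojB r P v : hproj r.+1 P -> P *m v = v -> sqn v != 0 ->
  hproj r (P - (sqn v)^-1 *: (v *m v^t*)).
Proof.
move=> [PP Pa Pt] Pv s0; set s := sqn v.
have vP : v^t* *m P = v^t* by rewrite [P]Pa -adjM Pv.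
split.
- rewrite mulmxBl !mulmxBr PP -!scalemxAr -!scalemxAl mulmxA Pv.
  rewrite -(mulmxA v) vP outer_sq !scalerA -/s mulrAC mulVf// mul1r.
  by rewrite subrr subr0.
- by rewrite adjB -Pa adj_outer// conj_invC// conj_sqn.
- by rewrite raddfB/= mxtraceZ tr_outer Pt mulVf// -natr1 addrK.
Qed.

Lemma hproj_sum r P : hproj r P ->
  \sum_i \sum_j (complex.Re (P i j) ^+ 2 + complex.Im (P i j) ^+ 2) = r%:R.
Proof.
move=> [PP Pa Pt].
have E : \tr (P^t* *m P) = (\sum_i \sum_j (complex.Re (P i j) ^+ 2 + complex.Im (P i j) ^+ 2))%:C.
  rewrite exchange_big rmorph_sum; apply: eq_bigr => j _; rewrite mxE rmorph_sum.
  apply: eq_bigr => i _; rewrite adjE.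
  case: (P i j) => a b /=; apply/eqP; rewrite eq_complex/=.
  by apply/andP; split; apply/eqP; ring.
have : (\sum_i \sum_j (complex.Re (P i j) ^+ 2 + complex.Im (P i j) ^+ 2))%:C = (r%:R : R)%:C.
  by rewrite -E -Pa PP Pt rmorph_nat.
by case.
Qed.

Lemma hproj_entry r P i j : hproj r P -> n1 (P i j) <= 2 * r%:R + 1.
Proof.
move=> hP; have S := hproj_sum hP.
have : complex.Re (P i j) ^+ 2 + complex.Im (P i j) ^+ 2 <= r%:R.
  rewrite -S (bigD1 i)//= (bigD1 j)//= -addrA lerDl addr_ge0//.
    by apply: sumr_ge0 => k _; rewrite addr_ge0 ?sqr_ge0.
  by apply: sumr_ge0 => k _; apply: sumr_ge0 => l _; rewrite addr_ge0 ?sqr_ge0.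
rewrite /n1; case: (P i j) => a b /=.
rewrite -(real_normK (num_real a)) -(real_normK (num_real b)).
have := sqr_ge0 (`|a| - 2^-1); have := sqr_ge0 (`|b| - 2^-1).
by nra.
Qed.

Lemma hproj0 P : hproj 0 P -> P = 0.
Proof.
move=> /hproj_sum S; apply/matrixP => i j; rewrite mxE; apply/eqP.
have : complex.Re (P i j) ^+ 2 + complex.Im (P i j) ^+ 2 == 0.
  have h k l : 0 <= complex.Re (P k l) ^+ 2 + complex.Im (P k l) ^+ 2.
    by rewrite addr_ge0 ?sqr_ge0.
  have S1 := @psumr_eq0P _ _ _ _ (fun k _ => sumr_ge0 _ (fun l _ => h k l)) S i isT.
  by rewrite (@psumr_eq0P _ _ _ _ (fun l _ => h i l) S1 j isT).
by rewrite paddr_eq0 ?sqr_ge0// !sqrf_eq0 eq_complex.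
Qed.

(** The squared Frobenius norm of a projection is its rank, here at least 1, whereas [d^2] entries
    below [1 / (d + 1)] would contribute less than 1. The bound does not depend on [P], as a map
    [x -> P x] requires. *)
Lemma hproj_large r P : hproj r.+1 P -> exists i j, (d%:R + 1)^-1 <= n1 (P i j).
Proof.
move=> hP; apply/not_existsP => h.
have small i j : n1 (P i j) < (d%:R + 1)^-1.
  by rewrite ltNge; apply/negP => hij; apply: (h i); exists j.
have S := hproj_sum hP.
have d0 : 0 < d%:R + 1 :> R by rewrite ltr_wpDl.
have b i j : complex.Re (P i j) ^+ 2 + complex.Im (P i j) ^+ 2 <= ((d%:R + 1)^-1) ^+ 2.
  apply: (@le_trans _ _ (n1 (P i j) ^+ 2)); last first.
    by rewrite lerXn2r ?nnegrE ?n1_ge0 ?invr_ge0 ?ltW.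
  rewrite /n1; case: (P i j) => a c /=.
  rewrite -(real_normK (num_real a)) -(real_normK (num_real c)) sqrrD.
  by rewrite lerD2r lerDl mulrn_wge0// mulr_ge0.
have : \sum_i \sum_j (complex.Re (P i j) ^+ 2 + complex.Im (P i j) ^+ 2) <=
    \sum_(i < d) \sum_(j < d) ((d%:R + 1)^-1) ^+ 2.
  by apply: ler_sum => i _; apply: ler_sum => j _.
rewrite S !sumr_const !card_ord -mulrnA -[leRHS]mulr_natl natrM exprVn.
rewrite ler_pdivlMr ?exprn_gt0//.
have : (1 : R) <= r.+1%:R by rewrite ler1n.
have : (0 : R) <= d%:R by [].
move: (d%:R : R) (r.+1%:R : R) => x y x0 y1.
have : (x + 1) ^+ 2 <= y * (x + 1) ^+ 2 by rewrite ler_peMl ?sqr_ge0.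
nra.
Qed.

End projections.

(** * Splitting off lines, by induction on the rank *)

Section matrix_approx.
Context {R : realType}.
Local Notation C := R[i].

Definition mapprox m n (g : nat -> R -> 'M[C]_(m, n)) (P : R -> 'M[C]_(m, n)) :=
  forall i j, approx (fun k x => g k x i j) (fun x => P x i j).

Lemma mapprox_ext m n (g g' : nat -> R -> 'M[C]_(m, n)) (P P' : R -> 'M[C]_(m, n)) :
  (forall k, g k =1 g' k) -> P =1 P' -> mapprox g P -> mapprox g' P'.
Proof.
move=> gg PP a i j; apply: approx_ext (a i j) => [k x|x]; first by rewrite gg.
by rewrite PP.
Qed.

Lemma mapprox_shift m n (g : nat -> R -> 'M[C]_(m, n)) (P : R -> 'M[C]_(m, n)) N :
  mapprox g P -> mapprox (fun k => g (k + N)%N) P.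
Proof. by move=> a i j; exact: (approx_shift N (a i j)). Qed.

Lemma mapprox_cst m n (A : 'M[C]_(m, n)) : mapprox (fun _ _ => A) (fun=> A).
Proof. by move=> i j; exact: approx_cst. Qed.

Lemma mapproxD m n (g h : nat -> R -> 'M[C]_(m, n)) (P Q : R -> 'M[C]_(m, n)) :
  mapprox g P -> mapprox h Q ->
  mapprox (fun k x => g k x + h k x) (fun x => P x + Q x).
Proof.
move=> a b i j; apply: approx_ext (approxD (a i j) (b i j)) => [k x|x];
by rewrite mxE.
Qed.

Lemma mapproxB m n (g h : nat -> R -> 'M[C]_(m, n)) (P Q : R -> 'M[C]_(m, n)) :
  mapprox g P -> mapprox h Q ->
  mapprox (fun k x => g k x - h k x) (fun x => P x - Q x).
Proof.
move=> a b i j; apply: approx_ext (approxB (a i j) (b i j)) => [k x|x];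
by rewrite !mxE.
Qed.

Lemma mapproxM m n p (g : nat -> R -> 'M[C]_(m, n)) (h : nat -> R -> 'M[C]_(n, p))
    (P : R -> 'M[C]_(m, n)) (Q : R -> 'M[C]_(n, p)) :
  mapprox g P -> mapprox h Q ->
  mapprox (fun k x => g k x *m h k x) (fun x => P x *m Q x).
Proof.
move=> a b i j.
apply: approx_ext (approx_sum (index_enum 'I_n) (fun l => approxM (a i l) (b l j))) =>
  [k x|x]; by rewrite mxE.
Qed.

Lemma mapproxZ m n (s : nat -> R -> C) (t : R -> C) (g : nat -> R -> 'M[C]_(m, n))
    (P : R -> 'M[C]_(m, n)) :
  approx s t -> mapprox g P ->
  mapprox (fun k x => s k x *: g k x) (fun x => t x *: P x).
Proof.
by move=> a b i j; apply: approx_ext (approxM a (b i j)) => [k x|x]; rewrite mxE.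
Qed.

Lemma mapprox_adj m n (g : nat -> R -> 'M[C]_(m, n)) (P : R -> 'M[C]_(m, n)) :
  mapprox g P -> mapprox (fun k x => (g k x)^t*) (fun x => (P x)^t*).
Proof.
by move=> a i j; apply: approx_ext (approx_conj (a j i)) => [k x|x]; rewrite adjE.
Qed.

Lemma approx_sqn m (g : nat -> R -> 'cV[C]_m) (v : R -> 'cV[C]_m) :
  mapprox g v -> approx (fun k x => sqn (g k x)) (fun x => sqn (v x)).
Proof. by move=> a; exact: (mapproxM (mapprox_adj a) a 0 0). Qed.

(* Along the shifted sequence the vectors stay away from 0, so that the
   rank-one projections onto them are again approximable. *)
Lemma mapprox_outer m (g : nat -> R -> 'cV[C]_m) (v : R -> 'cV[C]_m) c :
  0 < c -> (forall x, c <= n1 (sqn (v x))) -> mapprox g v ->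
  exists N, (forall k x, sqn (g (k + N)%N x) != 0) /\
   mapprox (fun k x => (sqn (g (k + N)%N x))^-1 *: (g (k + N)%N x *m (g (k + N)%N x)^t*))
     (fun x => (sqn (v x))^-1 *: (v x *m (v x)^t*)).
Proof.
move=> c0 cv a; have [N h] := approx_lower_bound c0 cv (approx_sqn a).
have c20 : 0 < c / 2 by rewrite divr_gt0.
exists N; split.
  by move=> k x; rewrite -n1_eq0 gt_eqF// (lt_le_trans c20).
have a' := mapprox_shift N a.
apply: mapproxZ; last by apply: mapproxM a' (mapprox_adj a').
apply: (approxV c20 _ h); last exact: (approx_shift N (approx_sqn a)).
by move=> x; apply: le_trans (cv x); lra.
Qed.

Lemma approx_bnice (g : nat -> R -> C) f : approx g f -> bnice f.
Proof. by move=> /approx_nice[K [fK _]]; exists K. Qed.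

Lemma generic_image_vector d r (P : R -> 'M[C]_d) (g : nat -> R -> 'M[C]_d) :
  mapprox g P -> (forall x, hproj r.+1 (P x)) ->
  exists e : 'cV[C]_d, exists2 c, 0 < c & forall x, c <= n1 (sqn (P x *m e)).
Proof.
move=> a hP.
(* Indices beyond [d] get the entry 0, since [generic_coeffs] takes families indexed by [nat]. *)
pose col (i : 'I_d) (j : nat) (x : R) : C :=
  if insub j is Some k then P x i k else 0.
have bc i j : bnice (col i j).
  rewrite /col; case: insubP => [k _ _|_]; last exact: bnice_cst.
  exact: approx_bnice (a i k).
have c0 : 0 < (d%:R + 1)^-1 :> R by rewrite invr_gt0 ltr_wpDl.
have [e [c c10 h]] := generic_coeffs d bc c0.
exists (\col_j e j), (c ^+ 2 / 2); first by rewrite divr_gt0// exprn_gt0.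
move=> x; have [i [j ij]] := hproj_large (hP x).
apply: (@sqn_ge _ _ _ _ i); first exact: ltW.
have := h i x; rewrite mxE.
have -> : \sum_(k < d) e k * col i k x = \sum_k P x i k * (\col_j e j) k 0.
  apply: eq_bigr => k _; rewrite mxE mulrC /col.
  by case: insubP => [k' _ /val_inj->//|]; rewrite ltn_ord.
apply; exists (val j); first exact: ltn_ord.
by rewrite /col valK.
Qed.

(** Once the line through [P x *m e] is split off, the induction gives exact rational projections
    [V'] close to the remainder [Q]. The line is then put back orthogonally to [V'] rather than to
    [Q], which makes the sum an exact projection. *)
Lemma hproj_rational_approx d r (P : R -> 'M[C]_d) (g : nat -> R -> 'M[C]_d) :
  mapprox g P -> (forall x, hproj r (P x)) ->
  exists2 V, mapprox V P & forall n x, hproj r (V n x).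
Proof.
elim: r P g => [|r IH] P g a hP.
  exists (fun _ _ => 0).
    apply: mapprox_ext (mapprox_cst 0) => // x.
    by rewrite (hproj0 (hP x)).
  by move=> n x; rewrite -(hproj0 (hP x)).
have [e [c c0 cv]] := generic_image_vector a hP.
pose v x := P x *m e; pose vg n x := g n x *m e.
have av : mapprox vg v by exact: mapproxM a (mapprox_cst e).
have sv x : sqn (v x) != 0 by rewrite -n1_eq0 gt_eqF// (lt_le_trans c0 (cv x)).
have [N1 [_ ao]] := mapprox_outer c0 cv av.
pose Q x := P x - (sqn (v x))^-1 *: (v x *m (v x)^t*).
have Pv x : P x *m v x = v x by have [PP _ _] := hP x; rewrite /v mulmxA PP.
have hQ x : hproj r (Q x) by apply: hprojB.
have [V' aV' hV'] := IH Q _ (mapproxB (mapprox_shift N1 a) ao) hQ.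
(* Annihilated by [V' n x] exactly, and convergent to [v] because [Q x *m v x = 0]. *)
pose b n x := (1%:M - V' n x) *m vg n x.
have ab : mapprox b v.
  apply: mapprox_ext (mapproxM (mapproxB (mapprox_cst 1%:M) aV') av) => // x.
  rewrite mulmxBl mul1mx /Q mulmxBl Pv -scalemxAl -mulmxA mul_sqn.
  by rewrite mul_mx_scalar scalerA mulVf// scale1r subrr subr0.
have [N2 [sb ab2]] := mapprox_outer c0 cv ab.
exists (fun n x => V' (n + N2)%N x +
   (sqn (b (n + N2)%N x))^-1 *: (b (n + N2)%N x *m (b (n + N2)%N x)^t*)).
  apply: mapprox_ext (mapproxD (mapprox_shift N2 aV') ab2) => // x.
  by rewrite subrK.
move=> n x; apply: hprojD => //.
rewrite /b mulmxA mulmxBr mulmx1; have [-> _ _] := hV' (n + N2)%N x.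
by rewrite subrr mul0mx.
Qed.

End matrix_approx.

(** * Purification *)

Section matrix_norm.
Context {R : realType} {d : nat}.
Local Notation M := 'M[R[i]]_d.
Implicit Types (A B p w : M).

Definition mxn A : R := \sum_i \sum_j n1 (A i j).

Lemma mxn_ge0 A : 0 <= mxn A.
Proof. by apply: sumr_ge0 => i _; apply: sumr_ge0 => j _; exact: n1_ge0. Qed.

Lemma mxnD A B : mxn (A + B) <= mxn A + mxn B.
Proof.
rewrite /mxn -big_split; apply: ler_sum => i _; rewrite -big_split.
by apply: ler_sum => j _; rewrite mxE n1D.
Qed.

Lemma mxnN A : mxn (- A) = mxn A.
Proof. by apply: eq_bigr => i _; apply: eq_bigr => j _; rewrite mxE n1N. Qed.

Lemma mxnB A B : mxn (A - B) <= mxn A + mxn B.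
Proof. by rewrite -(mxnN B) mxnD. Qed.

Lemma n1_le_mxn A i j : n1 (A i j) <= mxn A.
Proof.
rewrite /mxn (bigD1 i)//= (bigD1 j)//= -addrA lerDl addr_ge0//.
  by apply: sumr_ge0 => k _; exact: n1_ge0.
by apply: sumr_ge0 => k _; apply: sumr_ge0 => l _; exact: n1_ge0.
Qed.

Lemma mxnM A B : mxn (A *m B) <= mxn A * mxn B.
Proof.
rewrite /mxn mulr_suml; apply: ler_sum => i _.
apply: (@le_trans _ _ (\sum_j \sum_k n1 (A i k) * n1 (B k j))).
  apply: ler_sum => j _; rewrite mxE; apply: le_trans (n1_sum _ _ _) _.
  by apply: ler_sum => k _; exact: n1M.
rewrite exchange_big mulr_suml; apply: ler_sum => k _.
rewrite -mulr_sumr ler_wpM2l ?n1_ge0// [leRHS](bigD1 k)//= lerDl.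
by apply: sumr_ge0 => l _; apply: sumr_ge0 => j _; exact: n1_ge0.
Qed.

Lemma mxn_eq0 A : mxn A <= 0 -> A = 0.
Proof.
move=> A0; apply/matrixP => i j; apply/eqP; rewrite mxE -n1_eq0 eq_le n1_ge0 andbT.
exact: le_trans (n1_le_mxn A i j) A0.
Qed.

Lemma mxn_adj A : mxn (A^t*) = mxn A.
Proof.
rewrite /mxn exchange_big; apply: eq_bigr => i _; apply: eq_bigr => j _.
by rewrite adjE n1_conj.
Qed.

Lemma n1_mxtrace A : n1 (\tr A) <= mxn A.
Proof.
rewrite /mxtrace; apply: le_trans (n1_sum _ _ _) _.
apply: ler_sum => i _; rewrite (bigD1 i)//= lerDl.
by apply: sumr_ge0 => j _; exact: n1_ge0.
Qed.

Definition defect p := p *m p - p.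

(* McWeeny purification 3 p^2 - 2 p^3: its defect is quadratically small in
   the defect of p. *)
Definition mcweeny p := p + defect p - (p *m defect p + p *m defect p).

Let mcweeny_expand (p q X y z U : M) : p *m p = q + p -> p *m q = X -> q *m p = X ->
  q *m q = y -> p *m X = y + X -> q *m X = U -> X *m p = y + X -> X *m q = U ->
  X *m X = z + U ->
  (p + q - (X + X)) *m (p + q - (X + X)) - (p + q - (X + X)) =
  z + z + (z + z) - (y + y + y).
Proof.
move=> pp pq qp qq pX qX Xp Xq XX.
rewrite !(mulmxBl, mulmxBr, mulmxDl, mulmxDr) pp pq qp qq pX qX Xp Xq XX.
by apply/matrixP => i j; rewrite !mxE; ring.
Qed.

(** This is [4 q^3 - 3 q^2], written with sums for the norm estimates: [p] and [q] commute, and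
    [p^2 = q + p] reduces every product. *)
Lemma defect_mcweeny p (q := defect p) (y := q *m q) (z := q *m y) :
  defect (mcweeny p) = z + z + (z + z) - (y + y + y).
Proof.
have c : q *m p = p *m q by rewrite /q /defect mulmxBr mulmxBl mulmxA.
have pp : p *m p = q + p by rewrite /q /defect subrK.
have e1 : p *m (p *m q) = y + p *m q by rewrite mulmxA pp mulmxDl.
have e2 : q *m (p *m q) = p *m y by rewrite mulmxA c -mulmxA.
apply: (@mcweeny_expand p q (p *m q) y z (p *m y)) => //.
- by rewrite -mulmxA c.
- by rewrite -mulmxA.
- by rewrite -mulmxA e2 mulmxA pp mulmxDl.
Qed.

Definition purify n w := iter n mcweeny w.

(** The defect [4 q^3 - 3 q^2] of a step has norm at most 7 times the square of [mxn q], hence at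
    most half of [mxn q] once [14 * mxn q <= 1]. Halving is all that is kept of the quadratic
    convergence; the increments of the iterates then form a geometric series. *)
Lemma purify_bounds (w : M) (B delta : R) : 1 <= B -> mxn w <= B ->
  mxn (defect w) <= delta -> 14 * delta <= 1 ->
  forall n, mxn (defect (purify n w)) <= delta * 2^-1 ^+ n /\
    mxn (purify n w) <= B * (2 - 2^-1 ^+ n).
Proof.
move=> B1 wB wd d14; have d0 : 0 <= delta by exact: le_trans (mxn_ge0 _) wd.
elim=> [|n [IH1 IH2]].
  by rewrite expr0 mulr1; split=> //; rewrite [X in B * X](_ : _ = 1) ?mulr1//; ring.
have t0 : 0 <= (2^-1 : R) ^+ n by rewrite exprn_ge0.
have t1 : (2^-1 : R) ^+ n <= 1 by rewrite exprn_ile1//; lra.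
rewrite /purify iterS -/(purify n w) exprS.
move: (purify n w) IH1 IH2 => p; move: ((2^-1 : R) ^+ n) t0 t1 => t t0 t1 IH1 IH2.
have q0 := mxn_ge0 (defect p).
have dt : delta * t <= delta by rewrite ler_piMr.
split.
  rewrite defect_mcweeny mulrCA; move: (defect p) IH1 q0 => q IH1 q0.
  have y1 : mxn (q *m q) <= mxn q * mxn q by exact: mxnM.
  have z1 : mxn (q *m (q *m q)) <= mxn q * (mxn q * mxn q).
    by apply: le_trans (mxnM _ _) _; rewrite ler_wpM2l.
  move: (q *m (q *m q)) z1 => z z1; move: (q *m q) y1 => y y1.
  apply: le_trans (mxnB _ _) _.
  have := mxnD (z + z) (z + z); have := mxnD z z.
  have := mxnD (y + y) y; have := mxnD y y.
  have q14 : 14 * mxn q <= 1 by lra.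
  have : mxn q * (mxn q * mxn q) <= mxn q * mxn q by rewrite ler_wpM2l// ler_piMl//; lra.
  have : 14 * (mxn q * mxn q) <= mxn q by rewrite mulrA ler_piMl.
  move: IH1 y1 z1 {q14}; move: (mxn q * (mxn q * mxn q)) => q3.
  move: (mxn q * mxn q) (mxn q) => q2 q1.
  move: (delta * t) (mxn (z + z + (z + z))) (mxn (z + z)) (mxn (y + y + y)).
  by move: (mxn (y + y)) (mxn y) (mxn z) => *; lra.
have Pq : mxn (p *m defect p) <= 2 * B * (delta * t).
  apply: le_trans (mxnM _ _) _; rewrite ler_pM ?mxn_ge0//.
  by apply: le_trans IH2 _; rewrite mulrC ler_wpM2r//; lra.
have : mxn (mcweeny p) <= mxn p + mxn (defect p) + (mxn (p *m defect p) + mxn (p *m defect p)).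
  apply: le_trans (mxnB _ _) _; rewrite lerD ?mxnD//.
have : delta * t <= B * (delta * t) by rewrite ler_peMl// mulr_ge0.
have : B * (14 * delta) * t <= B * t by rewrite ler_wpM2r// -[leRHS]mulr1 ler_wpM2l//; lra.
have -> : B * (2 - 2^-1 * t) = B * (2 - t) + B * t / 2 by field.
have -> : B * (14 * delta) * t = 14 * (B * (delta * t)) by ring.
rewrite -[2 * B * _]mulrA in Pq.
have : 0 <= B * (delta * t) by rewrite !mulr_ge0//; lra.
lra.
Qed.

Let mulmx_diff (a b a' b' : M) : a *m b - a' *m b' = a *m (b - b') + (a - a') *m b'.
Proof. by rewrite mulmxBr mulmxBl addrA subrK. Qed.

Let mcweeny_diff (p q p' q' : M) : p + q - (p *m q + p *m q) - (p' + q' - (p' *m q' + p' *m q')) =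
  (p - p') + (q - q') - (((p - p') *m q + p' *m (q - q')) + ((p - p') *m q + p' *m (q - q'))).
Proof.
rewrite mulmxBl mulmxBr; move: (p *m q) (p' *m q) (p' *m q') => a b c.
by apply/matrixP => i j; rewrite !mxE; ring.
Qed.

(** The map [q -> 4 q^3 - 3 q^2] has Lipschitz constant [6 delta + 12 delta^2 < 1/2] on defects of
    norm at most [delta], so the differences [G] of the defects halve and the iterates drift apart
    by a geometric series only. The constant 75 closes the induction: [300 / 14 + 15 <= 75 / 2],
    where the first term comes from [2 D delta t] with [D <= 150 B^2 D0], the second from
    [G + 4 B G <= 5 B G]. *)
Lemma purify_lipschitz (w w' : M) (B delta : R) : 1 <= B ->
  mxn w <= B -> mxn (defect w) <= delta -> mxn w' <= B -> mxn (defect w') <= delta ->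
  14 * delta <= 1 ->
  forall n, mxn (purify n w - purify n w') <= 150 * B ^+ 2 * mxn (w - w').
Proof.
move=> B1 wB wd wB' wd' d14.
have d0 : 0 <= delta by exact: le_trans (mxn_ge0 _) wd.
set D0 := mxn (w - w'); have D00 : 0 <= D0 by exact: mxn_ge0.
have B0 : 0 <= B by lra.
have BD : 0 <= B ^+ 2 * D0 by rewrite mulr_ge0 ?sqr_ge0.
have BBD : B * D0 <= B ^+ 2 * D0 by rewrite expr2 -mulrA ler_peMl// mulr_ge0.
have DBD : D0 <= B * D0 by rewrite ler_peMl.
suff H n : mxn (defect (purify n w) - defect (purify n w')) <= 3 * (B * D0) * 2^-1 ^+ n /\
    mxn (purify n w - purify n w') <= 75 * (B ^+ 2 * D0) * (2 - 2^-1 ^+ n).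
  move=> n; have [_ h] := H n; apply: le_trans h _.
  have -> : 150 * B ^+ 2 * D0 = 75 * (B ^+ 2 * D0) * 2 by ring.
  rewrite ler_wpM2l//; first by rewrite mulr_ge0.
  by rewrite lerBlDr lerDl exprn_ge0.
elim: n => [|n [IH1 IH2]].
  rewrite expr0 !mulr1 /=; split.
    have -> : defect w - defect w' = w *m (w - w') + (w - w') *m w' - (w - w').
      rewrite /defect mulmxBl mulmxBr; move: (w *m w) (w *m w') (w' *m w') => a b c.
      by apply/matrixP => i j; rewrite !mxE; ring.
    apply: le_trans (mxnB _ _) _; have := mxnD (w *m (w - w')) ((w - w') *m w').
    have : mxn (w *m (w - w')) <= B * D0.
      by apply: le_trans (mxnM _ _) _; rewrite ler_wpM2r.
    have : mxn ((w - w') *m w') <= D0 * B.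
      by apply: le_trans (mxnM _ _) _; rewrite ler_wpM2l.
    rewrite -/D0; lra.
  rewrite -/D0; lra.
have [bq bp] := purify_bounds B1 wB wd d14 n.
have [bq' bp'] := purify_bounds B1 wB' wd' d14 n.
have t0 : 0 <= (2^-1 : R) ^+ n by rewrite exprn_ge0.
have t1 : (2^-1 : R) ^+ n <= 1 by rewrite exprn_ile1//; lra.
rewrite /purify !iterS -/(purify n w) -/(purify n w') exprS.
move: (purify n w) (purify n w') IH1 IH2 bq bp bq' bp' => p p'.
move: ((2^-1 : R) ^+ n) t0 t1 => t t0 t1 IH1 IH2 bq bp bq' bp'.
set G := mxn (defect p - defect p') in IH1; set D := mxn (p - p') in IH2.
have G0 : 0 <= G by exact: mxn_ge0.
have D1 : 0 <= D by exact: mxn_ge0.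
have dt : delta * t <= delta by rewrite ler_piMr.
have dt0 : 0 <= delta * t by rewrite mulr_ge0.
split.
  rewrite !defect_mcweeny; set q := defect p; set q' := defect p'.
  have qd : mxn q <= delta by exact: le_trans dt.
  have qd' : mxn q' <= delta by exact: le_trans dt.
  have y : mxn (q *m q - q' *m q') <= 2 * delta * G.
    rewrite mulmx_diff; apply: le_trans (mxnD _ _) _.
    have -> : 2 * delta * G = delta * G + G * delta by ring.
    rewrite lerD//; apply: le_trans (mxnM _ _) _; first by rewrite ler_wpM2r.
    by rewrite ler_wpM2l.
  have z : mxn (q *m (q *m q) - q' *m (q' *m q')) <= 3 * delta ^+ 2 * G.
    rewrite mulmx_diff; apply: le_trans (mxnD _ _) _.
    have -> : 3 * delta ^+ 2 * G = delta * (2 * delta * G) + G * (delta * delta) by ring.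
    rewrite lerD//; apply: le_trans (mxnM _ _) _; rewrite ler_pM ?mxn_ge0//.
    by apply: le_trans (mxnM _ _) _; rewrite ler_pM ?mxn_ge0.
  move: y z; move: (q *m q) (q' *m q') => a a'.
  move: (q *m a) (q' *m a') => b b' y z.
  have -> : b + b + (b + b) - (a + a + a) - (b' + b' + (b' + b') - (a' + a' + a')) =
     (b - b' + (b - b') + (b - b' + (b - b'))) - (a - a' + (a - a') + (a - a')).
    by apply/matrixP => i j; rewrite !mxE; ring.
  move: (b - b') (a - a') y z => u v y z.
  apply: le_trans (mxnB _ _) _.
  have := mxnD (u + u) (u + u); have := mxnD u u; have := mxnD (v + v) v; have := mxnD v v.
  have : 14 * (delta * G) <= G by rewrite mulrA ler_piMl.
  have : 14 * (delta ^+ 2 * G) <= delta * G.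
    by rewrite expr2 -!mulrA [14 * _]mulrA ler_piMl// mulr_ge0.
  move: y z; rewrite -!mulrA.
  have : 0 <= delta * G by rewrite mulr_ge0.
  lra.
rewrite /mcweeny mcweeny_diff.
apply: le_trans (mxnB _ _) _.
have := mxnD (p - p') (defect p - defect p').
set T := (p - p') *m defect p + p' *m (defect p - defect p').
have := mxnD T T.
have : mxn T <= D * (delta * t) + 2 * (B * G).
  apply: le_trans (mxnD _ _) _; rewrite lerD//; apply: le_trans (mxnM _ _) _.
    by rewrite ler_wpM2l.
  rewrite mulrA ler_wpM2r//; apply: le_trans bp' _; rewrite mulrC ler_wpM2r//; lra.
rewrite -/D -/G.
have : D * (delta * t) <= 150 * (B ^+ 2 * D0) * (delta * t).
  rewrite ler_wpM2r//; apply: le_trans IH2 _.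
  have -> : 150 * (B ^+ 2 * D0) = 75 * (B ^+ 2 * D0) * 2 by ring.
  by rewrite ler_wpM2l ?mulr_ge0//; lra.
have : 150 * (B ^+ 2 * D0) * (14 * delta * t) <= 150 * (B ^+ 2 * D0) * t.
  by rewrite ler_wpM2l ?mulr_ge0// ler_piMl.
have : B * G <= 3 * (B ^+ 2 * D0) * t.
  have -> : 3 * (B ^+ 2 * D0) * t = B * (3 * (B * D0) * t) by ring.
  by rewrite ler_wpM2l.
have : G <= B * G by rewrite ler_peMl.
have -> : 75 * (B ^+ 2 * D0) * (2 - 2^-1 * t) =
  75 * (B ^+ 2 * D0) * (2 - t) + 75 / 2 * (B ^+ 2 * D0 * t) by field.
have -> : 3 * (B ^+ 2 * D0) * t = 3 * (B ^+ 2 * D0 * t) by ring.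
have -> : 150 * (B ^+ 2 * D0) * t = 150 * (B ^+ 2 * D0 * t) by ring.
have -> : 150 * (B ^+ 2 * D0) * (14 * delta * t) = 14 * (150 * (B ^+ 2 * D0) * (delta * t)) by ring.
move: (150 * (B ^+ 2 * D0) * (delta * t)).
have : 0 <= B ^+ 2 * D0 * t by rewrite mulr_ge0.
move: IH2; move: (75 * (B ^+ 2 * D0) * (2 - t)) (B ^+ 2 * D0 * t) => a b.
by move=> ? ? X ? ? ? ? ? ? ?; lra.
Qed.

End matrix_norm.

(** * The limit of the iteration *)

Section purification.
Context {R : realType}.

(** The intervals [u n - 2 c / 2^n], [u n + 2 c / 2^n] are nested; the limit is the supremum of
    their left ends. *)
Lemma geometric_limit (u : nat -> R) (c : R) :
  (forall n, `|u n.+1 - u n| <= c * 2^-1 ^+ n) ->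
  exists l, forall n, `|u n - l| <= 2 * c * 2^-1 ^+ n.
Proof.
move=> uc.
pose lo n := u n - 2 * c * 2^-1 ^+ n; pose hi n := u n + 2 * c * 2^-1 ^+ n.
have lo_mon : {homo lo : n m / (n <= m)%N >-> n <= m}.
  apply/nondecreasing_seqP => n; have := uc n; rewrite ler_norml /lo exprS.
  by move: (_ ^+ n) => t; lra.
have hi_mon : {homo hi : n m / (n <= m)%N >-> m <= n}.
  apply/nonincreasing_seqP => n; have := uc n; rewrite ler_norml /hi exprS.
  by move: (_ ^+ n) => t; lra.
have lohi n m : lo n <= hi m.
  apply: (@le_trans _ _ (lo (maxn n m))); first by apply: lo_mon; exact: leq_maxl.
  apply: (@le_trans _ _ (hi (maxn n m))); last by apply: hi_mon; exact: leq_maxr.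
  have := le_trans (normr_ge0 _) (uc (maxn n m)); rewrite /lo /hi.
  by move: (_ ^+ _) => t; lra.
have ub : has_ubound (range lo) by exists (hi 0%N) => _ [n _ <-].
exists (sup (range lo)) => n; rewrite ler_norml.
have h1 : lo n <= sup (range lo) by apply: ub_le_sup => //; exists n.
have h2 : sup (range lo) <= hi n.
  by apply: ge_sup => [|_ [m _ <-]//]; exists (lo 0%N), 0%N.
by move: h1 h2; rewrite /lo /hi; lra.
Qed.

Context {d : nat}.
Local Notation M := 'M[R[i]]_d.

Lemma sum_const2 (t : R) : \sum_(i < d) \sum_(j < d) t = d%:R ^+ 2 * t.
Proof.
rewrite !sumr_const !card_ord -[t *+ d]mulr_natl -[LHS]mulr_natl.
by rewrite [LHS]mulrA expr2.
Qed.

Lemma geometric_limit_mx (u : nat -> M) (c : R) :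
  (forall n, mxn (u n.+1 - u n) <= c * 2^-1 ^+ n) ->
  exists L, forall n, mxn (u n - L) <= d%:R ^+ 2 * (4 * c) * 2^-1 ^+ n.
Proof.
move=> uc.
have cre i j : exists l, forall n, `|complex.Re (u n i j) - l| <= 2 * c * 2^-1 ^+ n.
  apply: geometric_limit => n; apply: le_trans (uc n).
  apply: le_trans (n1_le_mxn _ i j); apply: le_trans (n1_le_Re _).
  by rewrite !mxE; case: (u n.+1 i j) (u n i j) => a b [a' b'].
have cim i j : exists l, forall n, `|complex.Im (u n i j) - l| <= 2 * c * 2^-1 ^+ n.
  apply: geometric_limit => n; apply: le_trans (uc n).
  apply: le_trans (n1_le_mxn _ i j); apply: le_trans (n1_le_Im _).
  by rewrite !mxE; case: (u n.+1 i j) (u n i j) => a b [a' b'].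
exists (\matrix_(i, j) (projT1 (cid (cre i j)) +i* projT1 (cid (cim i j)))) => n.
apply: (@le_trans _ _ (\sum_(i < d) \sum_(j < d) (4 * c * 2^-1 ^+ n))); last first.
  by rewrite sum_const2 mulrA.
apply: ler_sum => i _; apply: ler_sum => j _; rewrite !mxE /n1.
case: cid => /= l /(_ n) hl; case: cid => /= l' /(_ n) hl'.
by move: hl hl'; case: (u n i j) => a b /=; lra.
Qed.

Lemma le0_of_geometric (a c : R) : (forall n, a <= c * 2^-1 ^+ n) -> a <= 0.
Proof.
move=> h.
have : (fun n => c * 2^-1 ^+ n) @ \oo --> (0 : R).
  by apply: cvg_geometric; rewrite ger0_norm// invf_lt1// ltr1n.
move=> hc; rewrite -(cvg_lim (@Rhausdorff R) hc).
by apply: limr_ge; [exact: cvgP hc|exact: nearW].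
Qed.

(** A step changes the iterate [p] by [defect p - 2 p defect p], at most [5 B delta / 2^n]; the
    factor 4 of [geometric_limit_mx] makes it 20. *)
Lemma purify_limit (w : M) (B delta : R) : 1 <= B -> mxn w <= B ->
  mxn (defect w) <= delta -> 14 * delta <= 1 -> w = w^t* ->
  exists P : M, [/\ P *m P = P, P = P^t* &
    forall n, mxn (purify n w - P) <= d%:R ^+ 2 * (20 * B * delta) * 2^-1 ^+ n].
Proof.
move=> B1 wB wd d14 wa; have pb := purify_bounds B1 wB wd d14.
have d0 : 0 <= delta by exact: le_trans (mxn_ge0 _) wd.
have pn n : mxn (purify n w) <= 2 * B.
  have [_ h] := pb n; apply: le_trans h _; rewrite mulrC ler_wpM2r//; first by lra.
  by rewrite lerBlDr lerDl exprn_ge0.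
have step n : mxn (purify n.+1 w - purify n w) <= 5 * B * delta * 2^-1 ^+ n.
  have [h _] := pb n; rewrite /purify iterS -/(purify n w).
  have := pn n; move: (purify n w) h => p h pB.
  have -> : mcweeny p - p = defect p - (p *m defect p + p *m defect p).
    by rewrite /mcweeny addrAC [p + _]addrC addrK.
  apply: le_trans (mxnB _ _) _; have := mxnD (p *m defect p) (p *m defect p).
  have : mxn (p *m defect p) <= 2 * B * (delta * 2^-1 ^+ n).
    by apply: le_trans (mxnM _ _) _; rewrite ler_pM ?mxn_ge0.
  have : delta * 2^-1 ^+ n <= B * (delta * 2^-1 ^+ n).
    by rewrite ler_peMl// mulr_ge0// exprn_ge0.
  move: h; rewrite -!mulrA; move: (delta * _) => t; lra.
have [P hP] := geometric_limit_mx step.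
have PE : 4 * (5 * B * delta) = 20 * B * delta by ring.
exists P; split; last by move=> n; rewrite -PE.
- apply/eqP; rewrite -subr_eq0; apply/eqP; apply: mxn_eq0.
  set K := d%:R ^+ 2 * (4 * (5 * B * delta)) in hP.
  have K0 : 0 <= K.
    rewrite /K; apply: mulr_ge0; first exact: sqr_ge0.
    by rewrite PE !mulr_ge0//; lra.
  have PB : mxn P <= 2 * B + K.
    have -> : P = purify 0 w - (purify 0 w - P) by rewrite opprB addrC subrK.
    apply: le_trans (mxnB _ _) _; rewrite lerD//.
    by have := hP 0%N; rewrite expr0 mulr1.
  apply: (@le0_of_geometric _ (delta + K + (2 * B + K) * K + K * (2 * B))) => n.
  have [h _] := pb n; have := pn n; have := hP n; move: (purify n w) h => p h pP pB.
  have -> : P *m P - P = defect p + (p - P) - (P *m (p - P) + (p - P) *m p).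
    rewrite /defect mulmxBr mulmxBl.
    move: (p *m p) (P *m p) (P *m P) => a b c.
    by apply/matrixP => i j; rewrite !mxE; ring.
  apply: le_trans (mxnB _ _) _.
  have := mxnD (defect p) (p - P); have := mxnD (P *m (p - P)) ((p - P) *m p).
  have : mxn (P *m (p - P)) <= (2 * B + K) * (K * 2^-1 ^+ n).
    by apply: le_trans (mxnM _ _) _; rewrite ler_pM ?mxn_ge0.
  have : mxn ((p - P) *m p) <= (K * 2^-1 ^+ n) * (2 * B).
    by apply: le_trans (mxnM _ _) _; rewrite ler_pM ?mxn_ge0.
  move: h pP; move: (_ ^+ n) => e.
  move: (mxn (P *m (p - P))) (mxn ((p - P) *m p)) (mxn (defect p)) (mxn (p - P)).
  move: (mxn (defect p + _)) (mxn (P *m _ + _)).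
  move=> a1 a2 a3 a4 a5 a6 h1 h2 h3 h4 h5 h6.
  have -> : (delta + K + (2 * B + K) * K + K * (2 * B)) * e =
    delta * e + K * e + (2 * B + K) * (K * e) + K * e * (2 * B) by ring.
  apply: le_trans (lerD h6 h5) _; rewrite -!addrA; apply: lerD => //.
  by apply: lerD => //; exact: lerD.
- have pa n : purify n w = (purify n w)^t*.
    elim: n => [//|n IH]; rewrite /purify iterS -/(purify n w).
    move: (purify n w) IH => p pa.
    have da : defect p = (defect p)^t* by rewrite /defect adjB adjM -pa.
    have dp : p *m defect p = defect p *m p.
      by rewrite /defect mulmxBr mulmxBl mulmxA.
    rewrite /mcweeny; move: (defect p) da dp => D da dp.
    by rewrite adjB !adjD adjM -pa -da -dp.
  apply/eqP; rewrite -subr_eq0; apply/eqP; apply: mxn_eq0.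
  apply: (@le0_of_geometric _ (2 * (d%:R ^+ 2 * (4 * (5 * B * delta))))) => n.
  have -> : P - P^t* = (purify n w - P)^t* - (purify n w - P).
    by rewrite adjB -pa; move: (purify n w) => p; apply/matrixP => i j; rewrite !mxE; ring.
  apply: le_trans (mxnB _ _) _; rewrite mxn_adj -mulrA.
  by have := hP n; lra.
Qed.

(** The order of the quantifiers matters: [C1] and [C2] are fixed before [w] and [delta]. As [delta]
    shrinks, [P] approaches [w] while the Lipschitz constant [C2], which dominates the energy
    densities, stays the same. *)
Lemma purification (B : R) : 1 <= B -> exists C1 C2 : R, [/\ 0 <= C1, 0 <= C2 &
  forall (w : R -> M) (delta : R), 14 * delta <= 1 ->
  (forall x, w x = (w x)^t*) -> (forall i j, rational_fun (fun x => w x i j)) ->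
  (forall x, mxn (w x) <= B) -> (forall x, mxn (defect (w x)) <= delta) ->
  exists P : R -> M, [/\ forall x, P x *m P x = P x /\ P x = (P x)^t*,
    forall x, mxn (w x - P x) <= C1 * delta,
    forall x y, mxn (P x - P y) <= C2 * mxn (w x - w y) &
    exists g, mapprox g P]].
Proof.
move=> B1; exists (d%:R ^+ 2 * (20 * B)), (150 * B ^+ 2).
have C10 : 0 <= d%:R ^+ 2 * (20 * B) by rewrite mulr_ge0 ?sqr_ge0 ?mulr_ge0//; lra.
have C20 : 0 <= 150 * B ^+ 2 by rewrite mulr_ge0 ?ler0n ?sqr_ge0.
split=> // w delta d14 wa wr wB wd.
have d0 : 0 <= delta by exact: le_trans (mxn_ge0 _) (wd 0).
pose P x := projT1 (cid (purify_limit B1 (wB x) (wd x) d14 (wa x))).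
have hP x : [/\ P x *m P x = P x, P x = (P x)^t* &
    forall n, mxn (purify n (w x) - P x) <= d%:R ^+ 2 * (20 * B * delta) * 2^-1 ^+ n].
  by rewrite /P; case: cid.
set K := d%:R ^+ 2 * (20 * B * delta) in hP.
have K0 : 0 <= K by rewrite /K mulrA mulr_ge0.
have lip n x y : mxn (purify n (w x) - purify n (w y)) <= 150 * B ^+ 2 * mxn (w x - w y).
  exact: purify_lipschitz.
exists P; split.
- by move=> x; have [] := hP x.
- by move=> x; have [_ _ /(_ 0%N)] := hP x; rewrite expr0 mulr1 /K !mulrA.
- move=> x y; rewrite -subr_le0; apply: (@le0_of_geometric _ (2 * K)) => n.
  have [_ _ /(_ n) hx] := hP x; have [_ _ /(_ n) hy] := hP y.
  have := lip n x y.
  have -> : P x - P y = (purify n (w x) - purify n (w y)) -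
     ((purify n (w x) - P x) - (purify n (w y) - P y)).
    by apply/matrixP => i j; rewrite !mxE; ring.
  have := mxnB (purify n (w x) - purify n (w y))
    ((purify n (w x) - P x) - (purify n (w y) - P y)).
  have := mxnB (purify n (w x) - P x) (purify n (w y) - P y).
  move: hx hy; rewrite -mulrA; lra.
exists (fun n x => purify n (w x)) => i j; split.
- move=> n; elim: n i j => [|n IH] i j; first exact: wr.
  have rD (f g : R -> M) : (forall i j, rational_fun (fun x => f x i j)) ->
     (forall i j, rational_fun (fun x => g x i j)) ->
     forall i j, rational_fun (fun x => (f x + g x) i j).
    by move=> rf rg k l; apply: rational_ext (rationalD (rf k l) (rg k l)) => x; rewrite mxE.
  have rB (f g : R -> M) : (forall i j, rational_fun (fun x => f x i j)) ->
     (forall i j, rational_fun (fun x => g x i j)) ->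
     forall i j, rational_fun (fun x => (f x - g x) i j).
    move=> rf rg k l.
    by apply: rational_ext (rationalD (rf k l) (rationalN (rg k l))) => x; rewrite !mxE.
  have rM (f g : R -> M) : (forall i j, rational_fun (fun x => f x i j)) ->
     (forall i j, rational_fun (fun x => g x i j)) ->
     forall i j, rational_fun (fun x => (f x *m g x) i j).
    move=> rf rg k l.
    suff : rational_fun (fun x => \sum_(m <- index_enum 'I_d) f x k m * g x m l).
      by apply: rational_ext => x; rewrite mxE.
    elim: (index_enum _) => [|m r IHr].
      by apply: rational_ext (rational_cst 0) => x; rewrite big_nil.
    apply: rational_ext (rationalD (rationalM (rf k m) (rg m l)) IHr) => x.
    by rewrite big_cons.
  have rdef : forall i j, rational_fun (fun x => defect (purify n (w x)) i j).
    exact: (rB (fun x => purify n (w x) *m purify n (w x))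
      (fun x => purify n (w x)) (rM _ _ IH IH) IH).
  have rMd := rM _ _ IH rdef.
  exact: (rB (fun x => purify n (w x) + defect (purify n (w x))) _
    (rD _ _ IH rdef) (rD _ _ rMd rMd)).
(* [w] is rational and bounded, hence chordal Lipschitz; [purify_lipschitz] is uniform in [n] and
   passes this on to all iterates with one constant. *)
- have : exists K', forall ij : 'I_d * 'I_d, nice K' (fun x => w x ij.1 ij.2).
    apply: common_nice => ij; apply: (@bounded_rational_nice _ _ B) => // x.
    by apply: le_trans (n1_le_mxn _ _ _) (wB x).
  move=> [K' hK'].
  have wK x y : mxn (w x - w y) <= d%:R ^+ 2 * (`|K'| * chi x y).
    apply: (@le_trans _ _ (\sum_(i < d) \sum_(j < d) (`|K'| * chi x y))); last first.
      by rewrite sum_const2.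
    apply: ler_sum => k _; apply: ler_sum => l _; rewrite !mxE.
    apply: le_trans ((hK' (k, l)).2 x y) _.
    by rewrite ler_wpM2r ?chi_ge0// ler_norm.
  exists (2 * B + 150 * B ^+ 2 * (d%:R ^+ 2 * `|K'|)) => n.
  have p1 : 0 <= 150 * B ^+ 2 * (d%:R ^+ 2 * `|K'|).
    by apply: mulr_ge0 => //; apply: mulr_ge0 => //; exact: sqr_ge0.
  split=> [x|x y].
    have [_ h] := purify_bounds B1 (wB x) (wd x) d14 n.
    apply: le_trans (n1_le_mxn _ i j) _; apply: le_trans h _.
    apply: (@le_trans _ _ (2 * B)); last by rewrite lerDl.
    rewrite mulrC ler_wpM2r//; first by lra.
    by rewrite lerBlDr lerDl exprn_ge0.
  apply: (@le_trans _ _ (mxn (purify n (w x) - purify n (w y)))).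
    by have := n1_le_mxn (purify n (w x) - purify n (w y)) i j; rewrite !mxE.
  apply: le_trans (lip n x y) _.
  apply: (@le_trans _ _ (150 * B ^+ 2 * (d%:R ^+ 2 * `|K'|) * chi x y)).
    rewrite -[leRHS]mulrA; apply: ler_wpM2l => //.
    by rewrite -[leRHS]mulrA.
  by rewrite ler_wpM2r ?chi_ge0// lerDr; lra.
- move=> e e0.
  have : (fun n => K * 2^-1 ^+ n) @ \oo --> (0 : R).
    by apply: cvg_geometric; rewrite ger0_norm// invf_lt1// ltr1n.
  move=> /cvgrPdist_le/(_ e e0)[N _ h]; exists N => n Nn x.
  have [_ _ /(_ n) hx] := hP x.
  have := n1_le_mxn (purify n (w x) - P x) i j; rewrite !mxE.
  move=> /le_trans; apply; apply: le_trans hx _.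
  by have := h n Nn; rewrite sub0r normrN ger0_norm// mulr_ge0// exprn_ge0.
Qed.

End purification.

(** * Density *)

Section energy_convergence.
Context {R : realType}.
Local Notation nu := (@circle_measure R).
Local Open Scope ereal_scope.

Definition energy_density (f : R -> R) (p : R * R) : R :=
  ((f p.1 - f p.2) ^+ 2 / chi2 p.1 p.2)%R.

Lemma energy_density_ge0 f p : (0 <= energy_density f p)%R.
Proof. exact: energy_integrand_ge0. Qed.

Lemma measurable_energy_density f : measurable_fun setT f ->
  measurable_fun setT (energy_density f).
Proof.
move=> mf.
by apply: measurable_energy_integrand => //; exact: measurableT_comp mf _.
Qed.

Lemma cvg_energy_density (g : nat -> R -> R) (u : R -> R) (p : R * R) :
  g ^~ p.1 @ \oo --> u p.1 -> g ^~ p.2 @ \oo --> u p.2 ->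
  (fun n => energy_density (g n) p) @ \oo --> energy_density u p.
Proof.
move=> g1 g2; apply: cvgMl; rewrite expr2; under eq_fun do rewrite expr2.
by apply: cvgM; exact: cvgB.
Qed.

Lemma energy_density_cst (c : R) p : energy_density (cst c) p = 0%R.
Proof. by rewrite /energy_density subrr expr0n mul0r. Qed.

Lemma energy_prod f : measurable_fun setT f ->
  energy f = \int[nu \x nu]_p (energy_density f p)%:E.
Proof.
move=> mf; symmetry.
apply: (circle_tonelli (G := fun x y => (energy_density f (x, y))%:E)).
  apply/measurable_EFinP.
  rewrite (_ : (fun _ => _) = energy_density f) ?funeqE; last by case.
  exact: measurable_energy_density.
by move=> x y; rewrite lee_fin energy_density_ge0.
Qed.

Lemma energy_ae_eq (f g : R -> R) : measurable_fun setT f -> measurable_fun setT g ->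
  {ae nu, forall x, f x = g x} -> energy f = energy g.
Proof.
move=> mf mg fg; rewrite !energy_prod//.
apply: ge0_ae_eq_integral => //.
- by apply/measurable_EFinP; exact: measurable_energy_density.
- by apply/measurable_EFinP; exact: measurable_energy_density.
- by move=> p _; rewrite lee_fin energy_density_ge0.
- by move=> p _; rewrite lee_fin energy_density_ge0.
apply: (@filterS _ _ (ae_filter_ringOfSetsType (nu \x nu)) _ _ _ (ae_product fg)).
by move=> p [e1 e2] _; rewrite /energy_density e1 e2.
Qed.

Lemma energy_leD (a : R) (f g h : R -> R) : (0 <= a)%R -> measurable_fun setT f ->
  measurable_fun setT g -> measurable_fun setT h ->
  (forall x y, (h x - h y) ^+ 2 <= a * ((f x - f y) ^+ 2 + (g x - g y) ^+ 2))%R ->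
  energy h <= a%:E * (energy f + energy g).
Proof.
move=> a0 mf mg mh hfg; rewrite !energy_prod//.
have mF u : measurable_fun setT u ->
    measurable_fun setT (fun p => (energy_density u p)%:E).
  by move=> mu; apply/measurable_EFinP; exact: measurable_energy_density.
have F0 u p : 0 <= (energy_density u p)%:E by rewrite lee_fin energy_density_ge0.
rewrite -ge0_integralD//; try exact: mF.
rewrite -ge0_integralZl//; last first.
- by move=> p _; rewrite adde_ge0.
- by apply: emeasurable_funD; exact: mF.
apply: ge0_le_integral => //; first exact: mF.
  by apply: emeasurable_funM => //; apply: emeasurable_funD; exact: mF.
move=> [x y] _; rewrite -EFinD -EFinM lee_fin /energy_density/= -mulrDl mulrA.
by rewrite ler_wpM2r// invr_ge0 chi2_ge0.
Qed.

Lemma energy_density_le (f : R -> R) (K : R) :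
  (forall x y, (f x - f y) ^+ 2 <= K * chi2 x y)%R ->
  (0 <= K)%R /\ forall x y, ((f x - f y) ^+ 2 / chi2 x y <= K)%R.
Proof.
move=> fK.
have c0 x y : x != y -> (0 < chi2 x y)%R.
  by move=> xy; rewrite lt_neqAle chi2_ge0 andbT eq_sym chi2_eq0.
have K0 : (0 <= K)%R.
  have := le_trans (sqr_ge0 _) (fK 1 0)%R.
  by rewrite pmulr_lge0//; apply: c0; exact: oner_neq0.
split=> // x y; have [->|xy] := eqVneq x y; first by rewrite subrr expr0n mul0r.
by rewrite ler_pdivrMr//; exact: c0.
Qed.

Lemma integral_circle_square_cst (K : R) :
  \int[nu \x nu]_p (cst K%:E p) = (K * (pi * pi))%:E.
Proof.
transitivity (K%:E * (nu \x nu) (setT `*` setT)).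
  by rewrite setXTT; exact: (integral_cst (nu \x nu) measurableT K%:E).
rewrite EFinM; congr (_ * _); transitivity (nu setT * nu setT).
  exact: product_measure1E.
by rewrite circle_measureT.
Qed.

Lemma energy_chi_lt (f : R -> R) (K : R) : measurable_fun setT f ->
  (forall x y, (f x - f y) ^+ 2 <= K * chi2 x y)%R -> energy f < +oo.
Proof.
move=> mf /energy_density_le[K0 fK]; rewrite energy_prod//.
apply: (@le_lt_trans _ _ (\int[nu \x nu]_p (cst K%:E p))).
  apply: ge0_le_integral => //.
  - by move=> p _; rewrite lee_fin energy_density_ge0.
  - by apply/measurable_EFinP; exact: measurable_energy_density.
  - by move=> p _; rewrite lee_fin; exact: fK.
by rewrite integral_circle_square_cst ltry.
Qed.

(** The majorant [a * (S (w n) p + S u p)] varies with [n], hence Pratt: it converges almost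
    everywhere, and its integral is at most that of its limit since
    [energy (w n c) <= energy (u c)], as holds for averages. *)
Lemma energy_cvg0_pratt (I : finType) (a : R) (w : nat -> I -> R -> R)
    (u : I -> R -> R) (g : nat -> R -> R) : (0 <= a)%R ->
  (forall n c, measurable_fun setT (w n c)) ->
  (forall c, measurable_fun setT (u c)) -> (forall n, measurable_fun setT (g n)) ->
  (forall n x y, (g n x - g n y) ^+ 2 <=
    a * (\sum_c (w n c x - w n c y) ^+ 2 + \sum_c (u c x - u c y) ^+ 2))%R ->
  (forall n c, energy (w n c) <= energy (u c)) ->
  (forall c, energy (u c) < +oo) ->
  (forall c, {ae nu, forall x, w ^~ c ^~ x @ \oo --> u c x}) ->
  {ae nu, forall x, g ^~ x @ \oo --> 0%R} ->
  energy (g n) @[n --> \oo] --> 0.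
Proof.
move=> a0 mw mu mg gwu wu uoo wucvg g0.
pose S (v : I -> R -> R) p := (\sum_c energy_density (v c) p)%R.
have S0 v p : (0 <= S v p)%R by apply: sumr_ge0 => c _; exact: energy_density_ge0.
have mS v : (forall c, measurable_fun setT (v c)) -> measurable_fun setT (S v).
  by move=> mv; apply: measurable_sum => c; exact: measurable_energy_density.
have iS v : (forall c, measurable_fun setT (v c)) ->
    \int[nu \x nu]_p (S v p)%:E = \sum_c energy (v c).
  move=> mv; under [RHS]eq_bigr do rewrite energy_prod//.
  rewrite -ge0_integral_sum//.
  - by apply: eq_integral => p _; rewrite sumEFin.
  - by move=> c; apply/measurable_EFinP; exact: measurable_energy_density.
  - by move=> c p _; rewrite lee_fin energy_density_ge0.
have iT v : (forall c, measurable_fun setT (v c)) ->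
    \int[nu \x nu]_p (a * (S v p + S u p))%:E =
    a%:E * (\sum_c energy (v c) + \sum_c energy (u c)).
  move=> mv; rewrite -(iS _ mv) -(iS _ mu) -ge0_integralD//; last 4 first.
  - by move=> p _; rewrite lee_fin.
  - by apply/measurable_EFinP; exact: mS.
  - by move=> p _; rewrite lee_fin.
  - by apply/measurable_EFinP; exact: mS.
  rewrite -ge0_integralZl//.
  - by apply: emeasurable_funD; apply/measurable_EFinP; exact: mS.
  - by move=> p _; rewrite adde_ge0 ?lee_fin.
rewrite (_ : (fun n => energy (g n)) =
  (fun n => \int[nu \x nu]_p (energy_density (g n) p)%:E)); last first.
  by apply/funext => n; exact: energy_prod.
apply: (@pratt_cvg0 R _ _ (nu \x nu) (fun n => energy_density (g n))
  (fun n p => a * (S (w n) p + S u p))%R (fun p => a * (S u p + S u p))%R).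
- by move=> n; exact: measurable_energy_density.
- by move=> n; apply: measurable_funM => //; apply: measurable_funD; exact: mS.
- by apply: measurable_funM => //; apply: measurable_funD; exact: mS.
- move=> n [x y]; rewrite energy_density_ge0/= /S/energy_density/=.
  by rewrite -!mulr_suml -mulrDl mulrA ler_wpM2r// invr_ge0 chi2_ge0.
- by move=> p; rewrite mulr_ge0// addr_ge0.
- apply: (@filterS _ _ (ae_filter_ringOfSetsType (nu \x nu)) _ _ _ (ae_product g0)).
  move=> p [gx gy]; rewrite -(energy_density_cst 0%R p).
  exact: cvg_energy_density.
- have wc : {ae nu, forall x, forall c, w ^~ c ^~ x @ \oo --> u c x}.
    apply: (@filterS _ _ (ae_filter_ringOfSetsType nu) _ _ _
      (@filter_forall _ I _ _ (ae_filter_ringOfSetsType nu) wucvg)).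
    by move=> x h c; exact: h.
  apply: (@filterS _ _ (ae_filter_ringOfSetsType (nu \x nu)) _ _ _ (ae_product wc)).
  move=> [x y] [/= wx wy]; apply: cvgMr; apply: cvgD; last exact: cvg_cst.
  rewrite /S; elim: (index_enum I) => [|c r IH].
    by under eq_fun do rewrite big_nil; rewrite big_nil; exact: cvg_cst.
  under eq_fun do rewrite big_cons; rewrite big_cons; apply: cvgD IH.
  by apply: (@cvg_energy_density (fun n => w n c)); [exact: wx|exact: wy].
- move=> n; have wun : \sum_c energy (w n c) <= \sum_c energy (u c).
    by apply: lee_sum => c _; exact: wu.
  rewrite (iT _ (mw n)) (iT _ mu); apply: lee_wpmul2l; first by rewrite lee_fin.
  exact: leeD wun (lexx _).
- rewrite iT//; rewrite -ge0_fin_numE; last first.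
    by rewrite mule_ge0 ?lee_fin// adde_ge0// sume_ge0// => c _; exact: energy_ge0.
  have fu : \sum_c energy (u c) \is a fin_num.
    rewrite ge0_fin_numE; first by apply: lte_sum_pinfty => c _; exact: uoo.
    by apply: sume_ge0 => c _; exact: energy_ge0.
  by rewrite fin_numM// fin_numD fu.
Qed.

(** The energy densities are at most [K], and constants are integrable over pairs of points of the
    circle. *)
Lemma energy_cvg0_chi (K : R) (g : nat -> R -> R) :
  (forall n, measurable_fun setT (g n)) ->
  (forall n x y, (g n x - g n y) ^+ 2 <= K * chi2 x y)%R ->
  (forall x, g ^~ x @ \oo --> 0%R) -> energy (g n) @[n --> \oo] --> 0.
Proof.
move=> mg gK g0.
have K0 := (energy_density_le (gK 0%N)).1.
rewrite (_ : (fun n => energy (g n)) =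
  (fun n => \int[nu \x nu]_p (energy_density (g n) p)%:E)); last first.
  by apply/funext => n; exact: energy_prod.
apply: (@pratt_cvg0 R _ _ (nu \x nu) (fun n => energy_density (g n))
  (fun _ => cst K) (cst K)) => //.
- by move=> n; exact: measurable_energy_density.
- move=> n [x y]; rewrite energy_density_ge0/=.
  exact: (energy_density_le (gK n)).2.
- apply: aeW => p; rewrite -(energy_density_cst 0%R p).
  by apply: cvg_energy_density; exact: g0.
- by apply: aeW => p; exact: cvg_cst.
by rewrite integral_circle_square_cst ltry.
Qed.

End energy_convergence.

(** * The Sobolev seminorm as a sum of energies of real coordinates *)

Section dotH12_energy.
Context {R : realType} {d : nat}.
Local Notation nu := (@circle_measure R).
Local Notation M := 'M[R[i]]_d.
Local Notation coord := ('I_d * 'I_d * bool)%type.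

Definition comp (c : coord) (A : M) : R :=
  let z := A c.1.1 c.1.2 in if c.2 then complex.Re z else complex.Im z.

Lemma sum_coord (F : coord -> R) :
  \sum_c F c = \sum_i \sum_j (F (i, j, true) + F (i, j, false)).
Proof.
transitivity (\sum_(ij : 'I_d * 'I_d) \sum_(b : bool) F (ij, b)).
  by rewrite pair_bigA; apply: eq_bigr => -[[]].
rewrite [RHS]pair_bigA; apply: eq_bigr => -[i j] _ /=.
by rewrite (bigD1 true)// (bigD1 false)//= big1 ?addr0// => -[].
Qed.

Lemma compB c A B : comp c (A - B) = comp c A - comp c B.
Proof.
rewrite /comp !mxE; case: (A _ _) (B _ _) => a b [a' b'].
by case: c.2.
Qed.

Lemma frobeniusE A : frobenius A ^+ 2 = \sum_c comp c A ^+ 2.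
Proof.
rewrite /frobenius; have -> : \tr (A^t* *m A) = (\sum_c comp c A ^+ 2)%:C.
  rewrite sum_coord exchange_big /= rmorph_sum /mxtrace; apply: eq_bigr => j _.
  rewrite mxE rmorph_sum; apply: eq_bigr => i _.
  rewrite adjE /comp/=; case: (A i j) => a b /=.
  by apply/eqP; rewrite eq_complex /=; apply/andP; split; apply/eqP; ring.
by rewrite sqr_sqrtr//= sumr_ge0// => c _; exact: sqr_ge0.
Qed.

Lemma comp_le_mxn c A : `|comp c A| <= mxn A.
Proof.
apply: le_trans (n1_le_mxn A c.1.1 c.1.2).
by rewrite /comp; case: c.2; [exact: n1_le_Re|exact: n1_le_Im].
Qed.

Lemma mxn_comp A : mxn A = \sum_c `|comp c A|.
Proof. by rewrite sum_coord. Qed.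

Lemma mxn_sq_le A : mxn A ^+ 2 <= #|{: coord}|%:R * \sum_c comp c A ^+ 2.
Proof.
rewrite mxn_comp expr2 big_distrlr /=.
apply: (@le_trans _ _ (\sum_(c : coord) \sum_(c' : coord)
    2^-1 * (comp c A ^+ 2 + comp c' A ^+ 2))).
  apply: ler_sum => c _; apply: ler_sum => c' _.
  rewrite -[comp c A ^+ 2]real_normK ?num_real// -[comp c' A ^+ 2]real_normK ?num_real//.
  have := sqr_ge0 (`|comp c A| - `|comp c' A|).
  by rewrite sqrrB; lra.
set s := \sum_c comp c A ^+ 2.
have h : \sum_(c' : coord) \sum_(c : coord) (2^-1 * comp c A ^+ 2) = #|{: coord}|%:R * (2^-1 * s).
  by rewrite sumr_const -mulr_sumr mulr_natl.
under eq_bigr do under eq_bigr do rewrite mulrDr.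
under eq_bigr do rewrite big_split /=.
rewrite big_split /= [X in X + _]exchange_big /= !h.
by move: (#|_|%:R : R) s {h} => n s; lra.
Qed.

Lemma ae_circle (P : R -> Prop) : {ae (@lebesgue_measure R), forall x, P x} ->
  {ae nu, forall x, P x}.
Proof.
move=> [N [mN N0 sN]]; exists N; split => //.
rewrite circle_measureE//; apply: null_set_integral => //.
by apply/measurable_EFinP/measurable_funTS; exact: measurable_cauchy_density.
Qed.

Definition measurable_entries (W : R -> M) :=
  forall c, measurable_fun setT (fun x => comp c (W x)).

Lemma measurable_entriesB V W : measurable_entries V -> measurable_entries W ->
  measurable_entries (V \- W).
Proof.
move=> mV mW c; under eq_fun do rewrite compB.
exact: measurable_funB.
Qed.

(** Conformal invariance of the seminorm: the two densities cancel the denominator of [chi2]. On the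
    diagonal both sides are 0. *)
Lemma inv_chi2 (x y : R) :
  (chi2 x y)^-1 * cauchy_density y * cauchy_density x = ((x - y) ^+ 2)^-1.
Proof.
have := onesq_neq0 x; have := onesq_neq0 y; rewrite /chi2 /cauchy_density.
move: (1 + x ^+ 2) (1 + y ^+ 2) => a b b0 a0; rewrite invf_div.
by rewrite -mulrA -invfM [b * a]mulrC mulrAC divff ?mul1r// mulf_neq0.
Qed.

Lemma dotH12_normE (W : R -> M) : measurable_entries W ->
  (dotH12_norm W =
    sqrte (((2 * pi)^-1)%:E * \sum_c energy (fun x => comp c (W x))))%E.
Proof.
move=> mW; congr (sqrte (_ * _)%E).
pose w c x := comp c (W x).
pose F x y := (\sum_c (w c x - w c y) ^+ 2 / chi2 x y).
have F0 x y : 0 <= F x y by apply: sumr_ge0 => c _; exact: energy_integrand_ge0.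
have mwF c x : measurable_fun setT (fun y => ((w c x - w c y) ^+ 2 / chi2 x y)).
  exact: (@measurable_energy_integrand _ _ _ (cst (w c x)) (w c) (cst x) id
    (measurable_cst _) (mW c) (measurable_cst _) (@measurable_id _ _ _)).
have mF x : measurable_fun setT (fun y => (F x y)%:E).
  by apply/measurable_EFinP; apply: measurable_sum => c.
have mp c : measurable_fun setT (fun p : R * R => ((w c p.1 - w c p.2) ^+ 2 / chi2 p.1 p.2)%:E).
  by apply/measurable_EFinP; exact: (@measurable_energy_density _ (w c) (mW c)).
have mIF : measurable_fun setT (fun x => (\int[nu]_y (F x y)%:E)%E).
  apply: (@measurable_fun_integral _ _ _ (fun x y => (F x y)%:E)); last first.
    by move=> x y; rewrite lee_fin.
  apply/measurable_EFinP.
  apply: (@measurable_sum _ _ _ _ _ _ (fun c p => energy_density (w c) p)) => c.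
  exact: (@measurable_energy_density _ (w c) (mW c)).
have mI c : measurable_fun setT (fun x => (\int[nu]_y ((w c x - w c y) ^+ 2 / chi2 x y)%:E)%E).
  apply: (@measurable_fun_integral _ _ _ (fun x y => ((w c x - w c y) ^+ 2 / chi2 x y)%:E)) => //.
  by move=> x y; rewrite lee_fin energy_integrand_ge0.
have IF0 x : (0 <= \int[nu]_y (F x y)%:E)%E.
  by apply: integral_ge0 => y _; rewrite lee_fin.
have -> : (\sum_c energy (w c) = \int[nu]_x \int[nu]_y (F x y)%:E)%E.
  rewrite -ge0_integral_sum//; last first.
    by move=> c x _; apply: integral_ge0 => y _; rewrite lee_fin energy_integrand_ge0.
  apply: eq_integral => x _; rewrite -ge0_integral_sum//.
  - by apply: eq_integral => y _; rewrite sumEFin.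
  - by move=> c; apply/measurable_EFinP; exact: mwF.
  - by move=> c y _; rewrite lee_fin energy_integrand_ge0.
rewrite integral_circle_density//; apply: eq_integral => x _.
have dens0 (t : R) : 0 <= cauchy_density t.
  by rewrite /cauchy_density invr_ge0 ltW// onesq_gt0.
have mdens : measurable_fun setT (fun t : R => (cauchy_density t)%:E).
  by apply/measurable_EFinP; exact: measurable_cauchy_density.
rewrite integral_circle_density//; last by move=> y; rewrite lee_fin.
rewrite -ge0_integralZr//.
- apply: eq_integral => y _; rewrite -!EFinM; congr _%:E.
  rewrite frobeniusE /F -mulr_suml real_normK ?num_real// -inv_chi2.
  by under eq_bigr do rewrite compB; rewrite !mulrA.
- by apply: emeasurable_funM => //; exact: mF.
- by move=> y _; rewrite mule_ge0 ?lee_fin.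
- by rewrite lee_fin.
Qed.

Lemma dotH12_norm_lty (W : R -> M) : measurable_entries W ->
  (dotH12_norm W < +oo)%E <-> forall c, (energy (fun x => comp c (W x)) < +oo)%E.
Proof.
move=> mW; rewrite dotH12_normE//.
have p0 : 0 < (2 * pi)^-1 :> R by rewrite invr_gt0 mulr_gt0 ?pi_gt0.
have S0 : (0 <= \sum_c energy (fun x => comp c (W x)))%E.
  by apply: sume_ge0 => c _; exact: energy_ge0.
have -> : (sqrte (((2 * pi)^-1)%:E * \sum_c energy (fun x => comp c (W x))) < +oo)%E =
    (\sum_c energy (fun x => comp c (W x)) < +oo)%E.
  rewrite -!ge0_fin_numE ?sqrte_ge0// sqrte_fin_num; last by rewrite mule_ge0// lee_fin ltW.
  move: S0; case: (\sum_c _)%E => [s||] // _.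
  by rewrite gt0_muley ?lte_fin.
split=> [h c|h]; last by apply: lte_sum_pinfty => c _; exact: h.
apply: le_lt_trans h; rewrite (bigD1 c)//= leeDl// sume_ge0// => c' _.
exact: energy_ge0.
Qed.

Lemma dotH12_norm_cvg0 (W : nat -> R -> M) : (forall n, measurable_entries (W n)) ->
  (forall c, energy (fun x => comp c (W n x)) @[n --> \oo] --> 0%E) ->
  dotH12_norm (W n) @[n --> \oo] --> 0%E.
Proof.
move=> mW h.
pose S n := (((2 * pi)^-1)%:E * \sum_c energy (fun x => comp c (W n x)))%E.
have S0 : S n @[n --> \oo] --> 0%E.
  rewrite -[X in _ --> X](mule0 ((2 * pi)^-1)%:E); apply: cvgeZl => //.
  have := @cvg_nnesum nat \oo (eventually_filter) R _ (index_enum coord)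
    (fun c n => energy (fun x => comp c (W n x))) (cst 0%E) xpredT.
  move=> /(_ _ (fun c _ => h c))/wrap[c _|].
    by apply: nearW => n; exact: energy_ge0.
  have -> : (\sum_(j : coord) cst 0 j = 0 :> \bar R)%E by rewrite big1.
  by [].
have Sp n : (0 <= S n)%E.
  rewrite mule_ge0 ?lee_fin ?invr_ge0 ?mulr_ge0 ?pi_ge0//.
  by apply: sume_ge0 => c _; exact: energy_ge0.
under eq_fun do rewrite dotH12_normE//.
have /fine_cvgP[Sf fS] := S0.
apply/fine_cvgP; split.
  by apply: filterS Sf => n Sn; rewrite sqrte_fin_num; [exact: Sn|exact: Sp].
have := cvg_comp _ _ fS (@sqrt_continuous R 0); rewrite sqrtr0.
apply: cvg_trans; apply: near_eq_cvg; apply: filterS Sf => n /=.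
by rewrite -/(S n); case: (S n).
Qed.

End dotH12_energy.

(** In the full rank factorization [A = col_base A *m row_base A], idempotency forces
    [row_base A *m col_base A] to be the identity of size [\rank A], and the trace is cyclic. *)
Lemma mxtrace_idempotent (F : fieldType) n (A : 'M[F]_n) :
  A *m A = A -> \tr A = (\rank A)%:R.
Proof.
move=> AA; rewrite -{1}(mulmx_base A) mxtrace_mulC -[RHS]mxtrace1; congr (\tr _).
have /row_freeP[D RD] := row_base_free A; have /row_fullP[E EC] := col_base_full A.
have := AA; rewrite -{1 2 3}(mulmx_base A) => /(congr1 (fun X => E *m X *m D)).
move: (row_base A) (col_base A) RD EC => r c RD EC.
by rewrite -!mulmxA RD mulmx1 EC !mulmxA EC mul1mx.
Qed.

(** * Averages of matrix-valued maps *)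

Section mollified_matrix.
Context {R : realType} {d : nat}.
Local Notation nu := (@circle_measure R).
Local Notation M := 'M[R[i]]_d.
Local Notation coord := ('I_d * 'I_d * bool)%type.
Implicit Types (P W : R -> M).

Lemma nice_comp (K : R) W (c : coord) x y :
  (forall i j, nice K (fun x => W x i j)) ->
  `|comp c (W x) - comp c (W y)| <= K * chi x y.
Proof.
move=> WK; rewrite -compB; apply: le_trans ((WK c.1.1 c.1.2).2 x y).
by rewrite /comp !mxE; case: c.2; [exact: n1_le_Re|exact: n1_le_Im].
Qed.

Lemma nice_measurable (K : R) W :
  (forall i j, nice K (fun x => W x i j)) -> measurable_entries W.
Proof.
move=> WK c; apply: continuous_measurable_fun.
apply: (@lipschitz_continuous _ _ K) => x y.
apply: le_trans (nice_comp c x y WK) _; apply: ler_wpM2l; last exact: chi_le_dist.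
exact: nice_ge0 (WK c.1.1 c.1.2).
Qed.

Lemma nice_comp_sq (K : R) W (c : coord) x y :
  (forall i j, nice K (fun x => W x i j)) ->
  (comp c (W x) - comp c (W y)) ^+ 2 <= K ^+ 2 * chi2 x y.
Proof.
move=> WK; rewrite -[leLHS]real_normK ?num_real//.
rewrite -[chi2 x y]sqr_sqrtr ?chi2_ge0// -exprMn lerXn2r ?nnegrE//.
  by rewrite mulr_ge0 ?chi_ge0//; exact: nice_ge0 (WK c.1.1 c.1.2).
exact: nice_comp.
Qed.

Definition mollify_mx N P (x : R) : M := \matrix_(i, j)
  (mollify N (fun y => comp (i, j, true) (P y)) x +i*
   mollify N (fun y => comp (i, j, false) (P y)) x).

Lemma comp_mollify_mx N P x (c : coord) :
  comp c (mollify_mx N P x) = mollify N (fun y => comp c (P y)) x.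
Proof. by case: c => [[i j] []]; rewrite {1}/comp !mxE. Qed.

Context (P : R -> M) (B : R).
Hypothesis mP : measurable_entries P.
Hypothesis PB : forall x, mxn (P x) <= B.

Let cB (c : coord) y : `|comp c (P y)| <= B.
Proof. exact: le_trans (comp_le_mxn _ _) (PB y). Qed.

Lemma mollifyN N (f : R -> R) (C x : R) : (0 < N)%N -> measurable_fun setT f ->
  (forall y, `|f y| <= C) -> mollify N (fun y => - f y) x = - mollify N f x.
Proof.
move=> N0 mf fC; rewrite /mollify -mulN1r -RintegralZl//; last first.
  exact: (bounded_integrable_kernel _ N0 mf fC).
by apply: eq_Rintegral => y _; rewrite mulN1r mulNr.
Qed.

Lemma mollify_mx_adj N x : (0 < N)%N -> (forall x, P x = (P x)^t*) ->
  mollify_mx N P x = (mollify_mx N P x)^t*.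
Proof.
move=> N0 PP; apply/matrixP => i j; rewrite adjE !mxE.
have hre y : comp (i, j, true) (P y) = comp (j, i, true) (P y).
  by rewrite /comp/= {1}PP adjE; case: (P y j i).
have him y : comp (i, j, false) (P y) = - comp (j, i, false) (P y).
  by rewrite /comp/= {1}PP adjE; case: (P y j i).
rewrite /=; congr (_ +i* _).
  by rewrite /mollify; apply: eq_Rintegral => y _; rewrite hre.
rewrite -(@mollifyN _ _ B)//.
by rewrite /mollify; apply: eq_Rintegral => y _; rewrite him.
Qed.

Lemma mollify_mx_rational N : (0 < N)%N ->
  forall i j, rational_fun (fun x => mollify_mx N P x i j).
Proof.
move=> N0 i j.
have rr c : rational_fun (fun x => (mollify N (fun y => comp c (P y)) x)%:C).
  have [p] := mollify_rational N0 (mP c) (cB c); move: (2 * N ^ 2)%N => m hp.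
  exists (map_poly (real_complex R) p), (map_poly (real_complex R) ((1 + 'X^2) ^+ m)).
  move=> x; rewrite !horner_map /= !hornerE.
  have q0 : (1 + x ^+ 2) ^+ m != 0 by rewrite expf_neq0// onesq_neq0.
  by split; [rewrite fmorph_eq0|rewrite hp rmorphM/= fmorphV].
apply: rational_ext (rationalD (rr (i, j, true))
  (rationalM (rational_cst 'i) (rr (i, j, false)))) => x.
rewrite mxE; apply/eqP; rewrite eq_complex /=.
by apply/andP; split; apply/eqP; ring.
Qed.

Hypothesis PE : forall c, (energy (fun x => comp c (P x)) < +oo)%E.

Lemma mollify_mx_close (e : R) : 0 < e ->
  \forall n \near \oo, forall x, exists z, mxn (mollify_mx (2 ^ n) P x - P z) <= e.
Proof.
(* The [+ 1] keeps [m] positive for [d = 0]; an error [e / m] in each real coordinate adds up to at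
   most [e]. *)
move=> e0; set m : R := #|{: coord}|%:R + 1.
have m0 : 0 < m by rewrite ltr_wpDl.
have dl0 : 0 < (e / m) ^+ 2 by rewrite exprn_gt0// divr_gt0.
have /fine_cvgP[vf v0] := @vmo_mass_cvg0 _ _ (fun (c : coord) x => comp c (P x)) mP PE.
have h : \forall n \near \oo,
    fine (vmo_mass (fun (c : coord) x => comp c (P x)) (2 ^ n)) < (e / m) ^+ 2.
  exact: (cvgr_lt _ v0 _ dl0).
near=> n => x.
have vn : (vmo_mass (fun (c : coord) x => comp c (P x)) (2 ^ n) < ((e / m) ^+ 2)%:E)%E.
  by rewrite -[X in (X < _)%E]fineK ?lte_fin; near: n.
have n0 : (0 < 2 ^ n)%N by rewrite expn_gt0.
have [z hz] := mollify_close mP cB x n0 vn.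
exists z; rewrite mxn_comp; apply: (@le_trans _ _ (\sum_(c : coord) (e / m))).
  apply: ler_sum => c _; rewrite compB comp_mollify_mx.
  have em0 : 0 <= e / m by rewrite divr_ge0// ltW.
  by rewrite -(@ler_pXn2r _ 2)// ?nnegrE// real_normK ?num_real.
rewrite sumr_const -[_ *+ _]mulr_natl mulrA ler_pdivrMr// [_ * e]mulrC.
by apply: ler_wpM2l; [exact: ltW|rewrite /m lerDl].
Unshelve. all: by end_near. Qed.

End mollified_matrix.

(** * Purified averages of a projection-valued map *)

Section projection_density.
Context {R : realType} {d k : nat}.
Local Notation nu := (@circle_measure R).
Local Notation M := 'M[R[i]]_d.
Local Notation coord := ('I_d * 'I_d * bool)%type.

(** The trace of an idempotent is its rank, an integer, and two integers at distance less than 1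
    coincide. This keeps the rank through purification. *)
Lemma hproj_trace_close (A Q : M) : hproj k A -> Q *m Q = Q -> Q = Q^t* ->
  mxn (Q - A) < 1 -> hproj k Q.
Proof.
move=> [_ _ tA] QQ Qa QA; split=> //; rewrite mxtrace_idempotent//.
have : n1 ((\rank Q)%:R - k%:R : R[i]) < 1.
  apply: le_lt_trans QA; rewrite -(mxtrace_idempotent QQ) -tA -raddfB.
  exact: n1_mxtrace.
have nz n : (n%:R : R[i]) = (n%:R : R)%:C by rewrite rmorph_nat.
rewrite !nz -rmorphB /= n1_real => h; suff -> : \rank Q = k by [].
have gap (m n : nat) : (m < n)%N -> (m%:R : R) + 1 <= n%:R.
  by rewrite natr1 ler_nat.
by case: (ltngtP (\rank Q) k) => // /gap gp; exfalso; move: h gp;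
  rewrite ltr_norml; lra.
Qed.

Lemma hproj_mxn (A : M) : hproj k A -> mxn A <= d%:R ^+ 2 * (2 * k%:R + 1).
Proof.
move=> hA; rewrite -sum_const2; apply: ler_sum => i _; apply: ler_sum => j _.
exact: hproj_entry.
Qed.

Context (P : R -> M).
Hypothesis mP : measurable_entries P.
Hypothesis kP : forall x, hproj k (P x).
Hypothesis PE : forall c, (energy (fun x => comp c (P x)) < +oo)%E.

Let B0 : R := d%:R ^+ 2 * (2 * k%:R + 1).

Let B00 : 0 <= B0.
Proof. by rewrite mulr_ge0 ?sqr_ge0// addr_ge0// mulr_ge0. Qed.

Let PB x : mxn (P x) <= B0. Proof. exact: hproj_mxn. Qed.

Lemma mollify_mx_purified : exists2 C : R, 0 <= C & forall e : R, 0 < e ->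
  \forall n \near \oo, exists Q : R -> M, [/\ forall x, hproj k (Q x),
    forall x, mxn (mollify_mx (2 ^ n) P x - Q x) <= e,
    forall x y, mxn (Q x - Q y) <=
      C * mxn (mollify_mx (2 ^ n) P x - mollify_mx (2 ^ n) P y) &
    exists g, mapprox g Q].
Proof.
have B1 : 1 <= B0 + 1 by rewrite lerDr.
have [C1 [C2 [C10 C20 pur]]] := @purification R d (B0 + 1) B1.
exists C2 => // e e0; set L := 2 * B0 + 2.
have L0 : 0 <= L by rewrite /L; lra.
set t := Num.min e 1; have t0 : 0 < t by rewrite lt_min e0 ltr01.
(* Three demands on [r]: [14 L r <= 1] for the purification, [C1 L r <= e] for its error,
   [r + C1 L r < 1] for the rank. With [t = min e 1] the identity [rD] yields them all. *)
set D := 2 * (1 + 14 * L + C1 * L).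
have CL0 : 0 <= C1 * L by rewrite mulr_ge0.
have D0 : 0 < D by rewrite /D; lra.
set r := t / D; have r0 : 0 < r by rewrite divr_gt0.
have rD : r + 14 * (L * r) + C1 * (L * r) = t / 2.
  by rewrite /r; move: D0; rewrite /D => D0; field; rewrite gt_eqF//; lra.
have Lr0 : 0 <= L * r by rewrite mulr_ge0// ltW.
have CLr0 : 0 <= C1 * (L * r) by rewrite mulr_ge0.
have te : t <= e by rewrite ge_min lexx.
have t1 : t <= 1 by rewrite ge_min lexx orbT.
near=> n; have n0 : (0 < 2 ^ n)%N by rewrite expn_gt0.
have close x : exists z, mxn (mollify_mx (2 ^ n) P x - P z) <= r.
  by move: x; near: n; exact: mollify_mx_close.
have [|x|i j|x|x|Q [hQ Qw QQ gQ]] := pur (mollify_mx (2 ^ n) P) (L * r).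
- by lra.
- apply: (@mollify_mx_adj _ _ _ B0) => // y.
  by have [_ + _] := kP y.
- exact: (@mollify_mx_rational _ _ _ B0).
- have [z hz] := close x; move: hz; move: (mollify_mx _ P x) => w hz.
  have -> : w = P z + (w - P z) by rewrite addrC subrK.
  by apply: le_trans (mxnD _ _) _; apply: lerD => //; lra.
- have [z hz] := close x; move: hz; move: (mollify_mx _ P x) => w hz.
  have [PP _ _] := kP z; have := PB z; move: (P z) PP hz => p pp hz pB.
  (* Expansion around the projection [p]: with [mxn p <= B0] and [mxn E <= r <= 1] the four terms
     add up to at most [(2 B0 + 2) r = L r]. *)
  have -> : defect w = p *m (w - p) + (w - p) *m p + ((w - p) *m (w - p) - (w - p)).
    rewrite /defect !mulmxBl !mulmxBr pp.
    move: (w *m w) (p *m w) (w *m p) => a b c.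
    by apply/matrixP => i j; rewrite !mxE; ring.
  move: (w - p) hz => E hE; have E0 := mxn_ge0 E.
  have h1 : mxn (p *m E) <= B0 * r.
    by apply: le_trans (mxnM _ _) _; rewrite ler_pM ?mxn_ge0.
  have h2 : mxn (E *m p) <= r * B0.
    by apply: le_trans (mxnM _ _) _; rewrite ler_pM ?mxn_ge0.
  have h3 : mxn (E *m E) <= r * 1.
    by apply: le_trans (mxnM _ _) _; rewrite ler_pM ?mxn_ge0//; lra.
  apply: le_trans (mxnD _ _) _; have := mxnD (p *m E) (E *m p).
  have := mxnB (E *m E) E; rewrite /L; lra.
exists Q; split => //.
- move=> x; have [z hz] := close x; have [Q1 Q2] := hQ x.
  apply: (hproj_trace_close (kP z)) => //.
  have -> : Q x - P z = (mollify_mx (2 ^ n) P x - P z) - (mollify_mx (2 ^ n) P x - Q x).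
    by rewrite opprB [RHS]addrC addrA subrK.
  apply: le_lt_trans (mxnB _ _) _; have := Qw x; lra.
- by move=> x; apply: le_trans (Qw x) _; lra.
Unshelve. all: by end_near. Qed.

End projection_density.

(** * Density of rational projection-valued maps *)

Section rational_density.
Context {R : realType} {d k : nat}.
Local Notation nu := (@circle_measure R).
Local Notation M := 'M[R[i]]_d.
Local Notation coord := ('I_d * 'I_d * bool)%type.

Lemma rational_energy_approx (Q : R -> M) g (e : R) : 0 < e -> mapprox g Q ->
  (forall x, hproj k (Q x)) ->
  measurable_entries Q /\ exists V : R -> M,
    [/\ forall i j, rational_fun (fun x => V x i j), forall x, hproj k (V x),
      measurable_entries V &
      forall c, (energy (fun x => comp c (V x - Q x)) <= e%:E)%E].
Proof.
move=> e0 gQ kQ; have [V VQ kV] := hproj_rational_approx gQ kQ.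
have /choice[K hK] : forall ij : 'I_d * 'I_d, exists K : R,
    nice K (fun x => Q x ij.1 ij.2) /\ forall n, nice K (fun x => V n x ij.1 ij.2).
  by move=> ij; exact: approx_nice (VQ ij.1 ij.2).
pose L := \sum_ij `|K ij|.
have KL ij : K ij <= L.
  apply: le_trans (ler_norm _) _; rewrite /L (bigD1 ij)//= lerDl.
  by apply: sumr_ge0.
have QL i j : nice L (fun x => Q x i j) by exact: nice_le (KL (i, j)) (hK (i, j)).1.
have VL n i j : nice L (fun x => V n x i j).
  exact: nice_le (KL (i, j)) ((hK (i, j)).2 n).
have DL n i j : nice (L + L) (fun x => (V n x - Q x) i j).
  apply: nice_ext (niceD (VL n i j) (niceN (QL i j))) => x.
  by rewrite !mxE.
have E0 (c : coord) : energy (fun x => comp c (V n x - Q x)) @[n --> \oo] --> 0%E.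
  apply: (@energy_cvg0_chi _ ((L + L) ^+ 2) (fun n x => comp c (V n x - Q x))).
  - by move=> n; exact: (nice_measurable (DL n)).
  - by move=> n x y; exact: (nice_comp_sq c x y (DL n)).
  - move=> x; apply/cvgrPdist_le => r r0.
    have [_ _ /(_ r r0)[N hN]] := VQ c.1.1 c.1.2.
    exists N => // n Nn; rewrite sub0r normrN; apply: le_trans (hN n Nn x).
    by rewrite /comp !mxE; case: c.2; [exact: n1_le_Re|exact: n1_le_Im].
split; first exact: nice_measurable QL.
have : \forall n \near \oo, forall c : coord,
    (energy (fun x => comp c (V n x - Q x)) <= e%:E)%E.
  apply: filter_forall => c; have /fine_cvgP[fE cE] := E0 c.
  near=> n; rewrite -[X in (X <= _)%E]fineK ?lee_fin; last by near: n.
  by near: n; exact: (cvgr_le _ cE _ e0).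
move=> [n _ /(_ n (leqnn n)) hn]; exists (V n); split => //.
- by move=> i j; have [+ _ _] := VQ i j; exact.
- exact: (nice_measurable (VL n)).
Unshelve. all: by end_near. Qed.

Context (P : R -> M).
Hypothesis mP : measurable_entries P.
Hypothesis kP : forall x, hproj k (P x).
Hypothesis PE : forall c, (energy (fun x => comp c (P x)) < +oo)%E.

Let PB x : mxn (P x) <= d%:R ^+ 2 * (2 * k%:R + 1). Proof. exact: hproj_mxn. Qed.

Let cB (c : coord) y : `|comp c (P y)| <= d%:R ^+ 2 * (2 * k%:R + 1).
Proof. exact: le_trans (comp_le_mxn _ _) (PB y). Qed.

Lemma hproj_density : exists V : nat -> R -> M,
  [/\ forall n i j, rational_fun (fun x => V n x i j),
    forall n x, hproj k (V n x), forall n, measurable_entries (V n) &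
    forall c, energy (fun x => comp c (V n x - P x)) @[n --> \oo] --> 0%E].
Proof.
have [C C0 hC] := mollify_mx_purified mP kP PE.
have h2 n : 0 < 2^-1 ^+ n :> R by rewrite exprn_gt0.
have h20 : (fun n => 2^-1 ^+ n : R) @ \oo --> (0 : R).
  have := @cvg_geometric R 1 2^-1; rewrite /geometric/=.
  under eq_fun do rewrite mul1r; apply.
  by rewrite ger0_norm// invf_lt1// ltr1n.
(* The demand [n <= NQ.1] sends the scales to infinity, so that the almost everywhere convergence of
   the averages passes to this subsequence. *)
have /choice[NQ hNQ] : forall n, exists NQ : nat * (R -> M), [/\ (n <= NQ.1)%N,
    forall x, hproj k (NQ.2 x),
    forall x, mxn (mollify_mx (2 ^ NQ.1) P x - NQ.2 x) <= 2^-1 ^+ n,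
    forall x y, mxn (NQ.2 x - NQ.2 y) <=
      C * mxn (mollify_mx (2 ^ NQ.1) P x - mollify_mx (2 ^ NQ.1) P y) &
    exists g, mapprox g NQ.2].
  move=> n; have [N _ /(_ (maxn n N) (leq_maxr _ _))[Q [? ? ? ?]]] := hC _ (h2 n).
  by exists (maxn n N, Q); split => //; exact: leq_maxl.
pose N n := (NQ n).1; pose Q n := (NQ n).2; pose W n := mollify_mx (2 ^ N n) P.
have Noo : N @ \oo --> \oo.
  move=> A [m _ mA]; exists m => // n mn; apply: mA.
  by rewrite /= (leq_trans mn)//; have [] := hNQ n.
have /choice[V hV] : forall n, exists V : R -> M,
    [/\ forall i j, rational_fun (fun x => V x i j), forall x, hproj k (V x),
      measurable_entries V &
      forall c, (energy (fun x => comp c (V x - Q n x)) <= (2^-1 ^+ n)%:E)%E].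
  move=> n; have [_ kQ _ _ [g gQ]] := hNQ n.
  by have [_] := rational_energy_approx (h2 n) gQ kQ.
have mQ n : measurable_entries (Q n).
  have [_ kQ _ _ [g gQ]] := hNQ n.
  by have [] := rational_energy_approx (h2 n) gQ kQ.
exists V; split; try by move=> n; have [] := hV n.
have mVQ n c : measurable_fun setT (fun x => comp c (V n x - Q n x)).
  by apply: measurable_entriesB => //; have [] := hV n.
have mVP n c : measurable_fun setT (fun x => comp c (V n x - P x)).
  by apply: measurable_entriesB => //; have [] := hV n.
have mQP n c : measurable_fun setT (fun x => comp c (Q n x - P x)).
  exact: measurable_entriesB.
have N0 n : (0 < 2 ^ N n)%N by rewrite expn_gt0.
have mW n c : measurable_fun setT (fun x => comp c (W n x)).
  under eq_fun do rewrite comp_mollify_mx.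
  exact: (measurable_mollify (N0 n) (mP c) (cB c)).
have QP0 c : energy (fun x => comp c (Q n x - P x)) @[n --> \oo] --> 0%E.
  set m : R := #|{: coord}|%:R.
  have m0 : 0 <= m by [].
  have wcvg (c' : coord) : {ae nu, forall x,
      (fun n => comp c' (W n x)) @ \oo --> comp c' (P x)}.
    have := mollify_ae_cvg (mP c') (cB c') (PE c').
    apply: (@filterS _ _ (ae_filter_ringOfSetsType nu)) => x hx.
    under eq_fun do rewrite comp_mollify_mx.
    exact: (cvg_comp _ _ Noo hx).
  (* Each of [Q n] and [P] costs a factor 2 in the square of the difference; [Q n] is compared with
     [W n] by the Lipschitz constant [C], and [m] comes from Cauchy-Schwarz in [mxn_sq_le]. *)
  apply: (@energy_cvg0_pratt _ _ (2 * C ^+ 2 * m + 2) (fun n c x => comp c (W n x))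
    (fun c x => comp c (P x)) (fun n x => comp c (Q n x - P x))).
  - by rewrite addr_ge0// mulr_ge0// mulr_ge0// sqr_ge0.
  - exact: mW.
  - exact: mP.
  - by move=> n; exact: mQP.
  - move=> n x y.
    have [_ _ _ /(_ x y) QC _] := hNQ n; rewrite -/(Q n) -/(W n) in QC.
    have h3 : (comp c (Q n x) - comp c (Q n y)) ^+ 2 <=
        C ^+ 2 * (m * \sum_c (comp c (W n x) - comp c (W n y)) ^+ 2).
      under eq_bigr do rewrite -compB.
      apply: le_trans (ler_wpM2l (sqr_ge0 _) (mxn_sq_le _)).
      rewrite -compB -exprMn -[leLHS]real_normK ?num_real//.
      rewrite lerXn2r ?nnegrE ?mulr_ge0 ?mxn_ge0//.
      by apply: le_trans (comp_le_mxn _ _) _.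
    have h4 : (comp c (P x) - comp c (P y)) ^+ 2 <=
        \sum_c (comp c (P x) - comp c (P y)) ^+ 2.
      rewrite (bigD1 c)//= lerDl; apply: sumr_ge0 => c' _; exact: sqr_ge0.
    have S1 : 0 <= \sum_c (comp c (W n x) - comp c (W n y)) ^+ 2.
      by apply: sumr_ge0 => c' _; exact: sqr_ge0.
    have S2 : 0 <= \sum_c (comp c (P x) - comp c (P y)) ^+ 2.
      by apply: sumr_ge0 => c' _; exact: sqr_ge0.
    move: h3 h4 S1 S2; rewrite !compB.
    move: (\sum_c (_ (W n x) - _) ^+ 2) (\sum_c (_ (P x) - _) ^+ 2) => s1 s2.
    move: (comp c (Q n x)) (comp c (Q n y)) (comp c (P x)) (comp c (P y)).
    move=> a b a' b' h3 h4 s10 s20.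
    have h5 : (a - a' - (b - b')) ^+ 2 <= 2 * (a - b) ^+ 2 + 2 * (a' - b') ^+ 2.
      have := sqr_ge0 ((a - b) + (a' - b')); rewrite !expr2; lra.
    apply: le_trans h5 _.
    have p1 : 0 <= 2 * C ^+ 2 * m * s2 by rewrite !mulr_ge0 ?sqr_ge0.
    have := lerD (ler_wpM2l (ler0n _ 2) h3) (ler_wpM2l (ler0n _ 2) h4).
    move=> /le_trans; apply.
    have -> : (2 * C ^+ 2 * m + 2) * (s1 + s2) = 2 * (C ^+ 2 * (m * s1)) + 2 * s2 +
      (2 * C ^+ 2 * m * s2 + 2 * s1) by ring.
    by rewrite lerDl addr_ge0// mulr_ge0.
  - move=> n c'; under eq_fun do rewrite comp_mollify_mx.
    exact: (energy_mollify (N0 n) (mP c') (cB c')).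
  - exact: PE.
  - exact: wcvg.
  (* [Q n] is [W n] minus an error uniformly at most [2^-n], so it tends to [P] wherever [W n]
     does. *)
  - apply: (@filterS _ _ (ae_filter_ringOfSetsType nu) _ _ _ (wcvg c)) => x hx.
    under eq_fun do rewrite compB.
    have -> : 0 = (comp c (P x) - 0) - comp c (P x) by rewrite subr0 subrr.
    have -> : (fun n => comp c (Q n x) - comp c (P x)) =
      (fun n => (comp c (W n x) - comp c (W n x - Q n x)) - comp c (P x)).
      by apply/funext => n; rewrite compB; congr (_ - _); ring.
    apply: cvgB; last exact: cvg_cst.
    apply: cvgB => //; apply/cvgrPdist_le => e e0.
    have /cvgrPdist_le/(_ e e0)[m' _ hm] := h20.
    exists m' => // n mn; rewrite sub0r normrN; apply: le_trans (comp_le_mxn _ _) _.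
    have [_ _ /(_ x) hx' _ _] := hNQ n; apply: le_trans hx' _.
    by have := hm n mn; rewrite sub0r normrN ger0_norm// ltW.
move=> c.
apply: (@squeeze_cvge _ _ _ _ (cst 0%E) _
  (fun n => 2%:E * ((2^-1 ^+ n)%:E + energy (fun x => comp c (Q n x - P x))))%E).
- apply: nearW => n; rewrite energy_ge0/=.
  apply: (@le_trans _ _ (2%:E * (energy (fun x => comp c (V n x - Q n x)) +
      energy (fun x => comp c (Q n x - P x))))%E).
    apply: energy_leD => // x y; rewrite !compB.
    move: (comp c (V n x)) (comp c (V n y)) (comp c (Q n x)) (comp c (Q n y)).
    move: (comp c (P x)) (comp c (P y)) => a b u v u' v'.
    have := sqr_ge0 ((u - u' - (v - v')) - (u' - a - (v' - b))).
    by rewrite !expr2; lra.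
  apply: lee_wpmul2l; first by rewrite lee_fin.
  by apply: leeD => //; have [_ _ _] := hV n; exact.
- exact: cvg_cst.
- rewrite -[X in _ --> X](mule0 2%:E); apply: cvgeZl => //.
  rewrite -[X in _ --> X](adde0 0%E); apply: cvgeD => //.
  by apply/fine_cvgP; split; [exact: nearW|exact: h20].
Qed.

End rational_density.

(** * From projections back to the Grassmannian *)

Section grassmannian.
Context {R : realType} {d k : nat}.
Local Notation nu := (@circle_measure R).
Local Notation M := 'M[R[i]]_d.
Local Notation coord := ('I_d * 'I_d * bool)%type.

Lemma hproj_Gr (P : M) : hproj k P -> Gr k (1%:M - (P + P)).
Proof.
move=> [PP Pa tP]; split.
- by rewrite adjB adjD -Pa trmx1 map_mx1.
- rewrite !mulmxBl !mulmxBr !mul1mx !mulmx1 !mulmxDl !mulmxDr PP.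
  by move: (1%:M : M) => I; apply/matrixP => i j; rewrite !mxE; ring.
- by rewrite raddfB raddfD /= mxtrace1 tP -natrD addnn mul2n.
Qed.

Lemma Gr_hproj (U : M) : Gr k U ->
  exists2 P, hproj k P & U = 1%:M - (P + P).
Proof.
move=> [Ua UU tU]; pose P := 2^-1 *: (1%:M - U).
have PU : U = 1%:M - (P + P).
  rewrite /P -scalerDl -[2^-1 + 2^-1]mulr2n -[_ *+ 2]mulr_natr mulVf ?pnatr_eq0//.
  by rewrite scale1r opprB addrC subrK.
exists P => //; split.
- rewrite /P -scalemxAl -scalemxAr mulmxBl !mulmxBr !mul1mx mulmx1 UU.
  by move: (1%:M : M) => I; apply/matrixP => i j; rewrite !mxE; field.
- have Xa : 1%:M - U = (1%:M - U)^t* by rewrite adjB trmx1 map_mx1 -Ua.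
  rewrite /P; move: (1%:M - U) Xa => X Xa; apply/matrixP => i j.
  by rewrite {1}Xa !mxE rmorphM fmorphV rmorph_nat.
- rewrite /P mxtraceZ raddfB /= mxtrace1 tU opprB addrC subrK natrM.
  by rewrite mulrA mulVf ?mul1r// pnatr_eq0.
Qed.

Lemma comp_reflection (c : coord) (A : M) :
  comp c (1%:M - (A + A)) = comp c 1%:M - 2 * comp c A.
Proof.
rewrite compB; congr (_ - _); rewrite /comp !mxE; case: (A _ _) => a b.
by case: c.2; rewrite /= mulrDl mul1r.
Qed.

(** Matrices in the Grassmannian have bounded entries, and a bounded rational function is chordal
    Lipschitz; finite energy follows. *)
Lemma rational_Gr_nice (U : R -> M) : Rat_Gr k U ->
  exists K : R, forall i j, nice K (fun x => U x i j).
Proof.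
move=> [rU GU].
have : exists K : R, forall ij : 'I_d * 'I_d, nice K (fun x => U x ij.1 ij.2).
  apply: common_nice => -[i j] /=.
  apply: (@bounded_rational_nice _ _ (1 + 2 * (2 * k%:R + 1))); first exact: rU.
  move=> x; have [P kP ->] := Gr_hproj (GU x); rewrite !mxE.
  apply: le_trans (n1BD _ _) _; apply: lerD.
    by case: eqP => _; rewrite /n1/= ?normr1 normr0 ?addr0.
  apply: le_trans (n1D _ _) _; have := hproj_entry i j kP; lra.
by move=> [K hK]; exists K => i j; exact: (hK (i, j)).
Qed.

Lemma Rat_Gr_dotH12 : @Rat_Gr R d k `<=` @dotH12_Gr R d k.
Proof.
move=> U rGU; have [K UK] := rational_Gr_nice rGU.
have mU := nice_measurable UK.
split; last by apply: aeW => x; have [_] := rGU; exact.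
split; first by move=> i j; split; [exact: (mU (i, j, true))|exact: (mU (i, j, false))].
apply/(dotH12_norm_lty mU) => c; apply: (@energy_chi_lt _ _ (K ^+ 2)) => // x y.
exact: nice_comp_sq.
Qed.

Lemma dotH12_Gr_approx (U : R -> M) : dotH12_Gr k U ->
  exists2 V : nat -> R -> M, (forall n, Rat_Gr k (V n)) &
    dotH12_norm (V n \- U) @[n --> \oo] --> 0%E.
Proof.
move=> [[mReIm U_lty] /ae_circle[N [mN N0 sN]]].
have mU : measurable_entries U.
  by move=> [[i j] []]; have [] := mReIm i j.
have UE := (dotH12_norm_lty mU).1 U_lty.
have [x0 Nx0] : exists x0, ~ N x0.
  apply/existsNP => NT; have := @circle_measureT R.
  have -> : [set: measurableTypeR R] = N by apply/seteqP; split.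
  by rewrite N0 => /eqP; rewrite eqe eq_sym gt_eqF// pi_gt0.
(* A projection is needed at every point, because [mollify_close] returns some [z] without control
   over its position. Changing the map on the null set [N] leaves the energies unchanged. *)
pose U' x := if x \in N then U x0 else U x.
have GU' x : Gr k (U' x).
  rewrite /U'; have [xN|/negP xN] := boolP (x \in N).
    by apply: contrapT => h; apply: Nx0; exact: sN.
  by apply: contrapT => h; apply: xN; rewrite inE; exact: sN.
have mU' : measurable_entries U'.
  move=> c; rewrite (_ : (fun x => comp c (U' x)) = (fun x => comp c (U x) * \1_(~` N) x +
    comp c (U x0) * \1_N x)); last first.
    apply/funext => x; rewrite /U' !indicE in_setC.
    by case: (x \in N); rewrite /= ?mulr1 ?mulr0 ?addr0 ?add0r.
  apply: measurable_funD; apply: measurable_funM => //; apply: measurable_indic => //.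
  exact: measurableC.
have UU' : {ae nu, forall x, U x = U' x}.
  exists N; split=> // x /= h; apply: contrapT => Nx; apply: h.
  by rewrite /U' memNset.
have U'E c : (energy (fun x => comp c (U' x)) < +oo)%E.
  rewrite -(@energy_ae_eq _ (fun x => comp c (U x)))//.
  by apply: (@filterS _ _ (ae_filter_ringOfSetsType nu) _ _ _ UU') => x ->.
have /choice[P hP] : forall x, exists P, hproj k P /\ U' x = 1%:M - (P + P).
  by move=> x; have [P] := Gr_hproj (GU' x); exists P.
have compP c x : comp c (U' x) = comp c 1%:M - 2 * comp c (P x).
  by rewrite (hP x).2 comp_reflection.
have mP : measurable_entries P.
  move=> c; rewrite (_ : (fun x => comp c (P x)) = (fun x => 2^-1 * (comp c 1%:M - comp c (U' x)))).
    by apply: measurable_funM => //; exact: measurable_funB.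
  by apply/funext => x; rewrite compP; field.
have PE c : (energy (fun x => comp c (P x)) < +oo)%E.
  have := @energy_leD _ 1 (fun x => comp c (U' x)) (fun x => comp c (U' x))
    (fun x => comp c (P x)) ler01 (mU' c) (mU' c) (mP c).
  move=> /(_ _)/wrap[x y|/le_lt_trans]; last first.
    by apply; rewrite mul1e lte_add_pinfty.
  rewrite !compP; move: (comp c (P x)) (comp c (P y)) => a b.
  by have := sqr_ge0 (a - b); rewrite !expr2; lra.
have [V [rV kV mV VP]] := hproj_density mP (fun x => (hP x).1) PE.
exists (fun n x => 1%:M - (V n x + V n x)).
  move=> n; split=> [i j|x]; last exact: hproj_Gr.
  apply: rational_ext (rationalD (rational_cst ((1%:M : M) i j))
    (rationalN (rationalD (rV n i j) (rV n i j)))) => x.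
  by rewrite !mxE.
have mW n : measurable_entries (fun x => 1%:M - (V n x + V n x)).
  move=> c; under eq_fun do rewrite comp_reflection.
  by apply: measurable_funB => //; apply: measurable_funM => //; exact: mV.
apply: dotH12_norm_cvg0 => [n|c]; first exact: measurable_entriesB.
apply: (@squeeze_cvge _ _ _ _ (cst 0%E) _
  (fun n => 2%:E * (energy (fun x => comp c (V n x - P x)) +
    energy (fun x => comp c (V n x - P x))))%E).
- apply: nearW => n; rewrite energy_ge0/=.
  have mVP : measurable_fun setT (fun x => comp c (V n x - P x)).
    exact: measurable_entriesB.
  rewrite (@energy_ae_eq _ _ (fun x => comp c (1%:M - (V n x + V n x) - U' x))).
  + apply: energy_leD => //; first exact: (measurable_entriesB (mW n) mU').
    move=> x y; rewrite ![comp c (_ - (_ + _) - _)]compB !comp_reflection !compP.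
    rewrite ![comp c (V n _ - _)]compB.
    move: (comp c (V n x)) (comp c (V n y)) (comp c (P x)) (comp c (P y)).
    by move=> a b u v; rewrite !expr2; lra.
  + exact: (measurable_entriesB (mW n) mU).
  + exact: (measurable_entriesB (mW n) mU').
  + by apply: (@filterS _ _ (ae_filter_ringOfSetsType nu) _ _ _ UU') => x /= ->.
- exact: cvg_cst.
- rewrite -[X in _ --> X](mule0 2%:E); apply: cvgeZl => //.
  by rewrite -[X in _ --> X](adde0 0%E); apply: cvgeD => //; exact: VP.
Qed.

End grassmannian.

Theorem theorem1p6 (R : realType) (d k : nat) (hd : (2 <= d)%N)
    (hk : (k <= d)%N) :
  dotH12_dense (@Rat_Gr R d k) (@dotH12_Gr R d k).
Proof. by split; [exact: Rat_Gr_dotH12|exact: dotH12_Gr_approx]. Qed.
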